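(* Assume the integer $k$-SUM conjecture. Then for every constant $d\in\mathbb{N}$ and every constant $\gamma>0$, there is no distribution-free distance approximation algorithm for the class of halfspaces over $\mathbb{Z}^d$ running in time $(1/\epsilon)^{\lceil (d+1)/2\rceil-\gamma}$ (as a function of $\epsilon$). This holds even if the input distribution $\mathcal{D}$ is promised to be supported on points whose coordinates have absolute value at most $(1/\epsilon)^{O_d(1)}$.
   Context: A halfspace over $\mathbb{Z}^d$ is a function $f:\mathbb{Z}^d\to\{0,1\}$ of the form $f(x)=\mathbf{1}[\langle w,x\rangle+\theta\ge0]$ for some $w\in\mathbb{R}^d,\theta\in\mathbb{R}$; $\mathcal{H}$ denotes the class of them. For a distribution $\mathcal{D}$ on $\mathbb{Z}^d$, $\mathrm{dist}_{\mathcal{D}}(f,\mathcal{H})=\inf_{g\in\mathcal{H}}\Pr_{x\sim\mathcal{D}}[f(x)\ne g(x)]$. A distribution-free distance approximation algorithm for $\mathcal{H}$, for every distribution $\mathcal{D}$ and every $f:\mathbb{Z}^d\to\{0,1\}$, given $\epsilon$ and access to labeled samples $(x,f(x))$ with $x\sim\mathcal{D}$ and to queries of $f$ at arbitrary points, outputs $\widehat\alpha$ with $|\mathrm{dist}_{\mathcal{D}}(f,\mathcal{H})-\widehat\alpha|\le\epsilon$ with probability at least $2/3$. Model: a randomized logarithmic-cost RAM (register operations cost logarithmically in the magnitudes involved, coin flips cost $O(1)$); $\epsilon$ is given on a parameter tape encoded in $O(\log(1/\epsilon))$ bits; drawing a labeled sample (written as $x_1,\dots,x_d,f(x)$ on an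 input tape) and querying $f$ at a point held in $d$ registers are unit-cost operations. $k$-SUM problem: given $k$ lists $A_1,\dots,A_k$ of $n$ distinct integers each, all in $[-n^{2k},n^{2k}]$, decide whether there exist $a_i\in A_i$ with $a_1+\dots+a_{k-1}=a_k$. Integer $k$-SUM conjecture: for every constant $k\ge2$ and $\gamma>0$, no randomized algorithm solves $k$-SUM in time $O(n^{\lceil k/2\rceil-\gamma})$ with error probability at most $1/3$. *)

(* Defs.v *)
From HB Require Import structures.
From mathcomp Require Import all_boot all_order all_algebra.
From mathcomp Require Import all_classical all_reals all_analysis.

Set Implicit Arguments.
Unset Strict Implicit.
Unset Printing Implicit Defensive.

Import Order.TTheory GRing.Theory Num.Theory.

Local Open Scope classical_set_scope.
Local Open Scope ring_scope.

(** * Randomized logarithmic-cost RAM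

    The machine has registers R_0, R_1, ... holding integers (initially 0), a
    read-only one-way input tape of integers and a read-only one-way parameter
    tape of bits.  It halts when the program counter leaves the program.  The
    type [O] lists the extra (oracle) instructions that are available. *)

(** [Ind i] is indirect addressing: it denotes the register whose index is
    the absolute value of the content of R_i. *)
Inductive loc := Reg of nat | Ind of nat.

Inductive src := Cst of int | At of loc.

Inductive arith := Add | Sub | Mul | Div.

Inductive instr (O : Type) :=
| Move of loc & src
| Arith of arith & loc & src & src
| JumpPos of src & nat
| JumpZero of src & nat
| ReadInput of loc
| ReadParam of loc
| Flip of nat
| Oracle of O.

Arguments Move {O}.
Arguments Arith {O}.
Arguments JumpPos {O}.
Arguments JumpZero {O}.
Arguments ReadInput {O}.
Arguments ReadParam {O}.
Arguments Flip {O}.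
Arguments Oracle {O}.

Definition program (O : Type) := seq (instr O).

Record config := Config {
  pc : nat;
  regs : nat -> int;
  input : seq int;
  param : seq bool }.

Definition start (inp : seq int) (par : seq bool) : config :=
  Config 0 (fun=> 0) inp par.

Definition bitlen (n : nat) : nat := (trunc_log 2 n).+1.

Definition addr (m : nat -> int) (l : loc) : nat :=
  match l with Reg i => i | Ind i => `|m i|%N end.

Definition addr_cost (m : nat -> int) (l : loc) : nat :=
  match l with
  | Reg i => bitlen i
  | Ind i => (bitlen i + bitlen `|m i|)%N
  end.

Definition value (m : nat -> int) (s : src) : int :=
  match s with Cst z => z | At l => m (addr m l) end.

Definition value_cost (m : nat -> int) (s : src) : nat :=
  match s with
  | Cst z => bitlen `|z|
  | At l => (addr_cost m l + bitlen `|m (addr m l)|)%N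
  end.

(** [Div] is Euclidean division of integers; division by 0 yields 0. *)
Definition arith_fun (o : arith) (x y : int) : int :=
  match o with
  | Add => x + y
  | Sub => x - y
  | Mul => x * y
  | Div => (x %/ y)%Z
  end.

Definition goto (c : config) (l : nat) : config :=
  Config l (regs c) (input c) (param c).

Definition advance (c : config) : config := goto c (pc c).+1.

Definition write (c : config) (i : nat) (v : int) : config :=
  Config (pc c) [eta regs c with i |-> v] (input c) (param c).

(** Reading past the end of the input tape yields 0, and reading past the end
    of the parameter tape yields -1 (so that its end can be detected). *)
Definition input_symbol (c : config) : int := head 0 (input c).

Definition param_symbol (c : config) : int :=
  match param c with [::] => -1 | b :: _ => (b : nat)%:Z end.

Definition pop_input (c : config) : config :=
  Config (pc c) (regs c) (behead (input c)) (param c).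

Definition pop_param (c : config) : config :=
  Config (pc c) (regs c) (input c) (behead (param c)).

(** The effect of one step: deterministic, branching on a fair coin, or
    branching on a fresh sample of a random element of [X]. *)
Inductive action (X : Type) :=
| Goto of config
| Toss of (bool -> config)
| Draw of (X -> config).

Arguments Goto {X}.
Arguments Toss {X}.
Arguments Draw {X}.

Definition oracle (O X : Type) := O -> config -> action X.

Definition instr_cost (O : Type) (i : instr O) (c : config) : nat :=
  let m := regs c in
  match i with
  | Move l s => (1 + addr_cost m l + value_cost m s)%N
  | Arith _ l s t => (1 + addr_cost m l + value_cost m s + value_cost m t)%N
  | JumpPos s _ | JumpZero s _ => (1 + value_cost m s)%N
  | ReadInput l => (1 + addr_cost m l + bitlen `|input_symbol c|)%N
  | ReadParam l => (1 + addr_cost m l)%N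
  | Flip _ | Oracle _ => 1%N
  end.

Definition instr_action (O X : Type) (orc : oracle O X) (i : instr O)
    (c : config) : action X :=
  let m := regs c in
  let c' := advance c in
  match i with
  | Move l s => Goto (write c' (addr m l) (value m s))
  | Arith o l s t =>
      Goto (write c' (addr m l) (arith_fun o (value m s) (value m t)))
  | JumpPos s k => Goto (if 0 < value m s then goto c k else c')
  | JumpZero s k => Goto (if value m s == 0 then goto c k else c')
  | ReadInput l => Goto (write (pop_input c') (addr m l) (input_symbol c))
  | ReadParam l => Goto (write (pop_param c') (addr m l) (param_symbol c))
  | Flip r => Toss (fun b => write c' r (b : nat)%:Z)
  | Oracle o => orc o c'
  end.

(** [None] when halted, otherwise the cost and the effect of the next step. *)
Definition step (O X : Type) (orc : oracle O X) (p : program O) (c : config) :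
    option (nat * action X) :=
  omap (fun i => (instr_cost i c, instr_action orc i c)) (onth p (pc c)).

(** * Probability and running time *)

Record distr (R : realType) (X : choiceType) := Distr {
  mass :> X -> R;
  mass_ge0 : forall x, 0 <= mass x;
  mass_total : \esum_(x in [set: X]) (mass x)%:E = 1%E }.

(** Probability that the machine started in [c] halts within [n] steps with
    registers in [E], the samples being independent and distributed as [mu]. *)
Fixpoint prob_in_steps (R : realType) (O : Type) (X : choiceType)
    (orc : oracle O X) (mu : X -> R) (p : program O) (E : set (nat -> int))
    (n : nat) (c : config) : \bar R :=
  match step orc p c, n with
  | None, _ => (\1_E (regs c))%:E
  | Some _, 0%N => 0%E
  | Some (_, Goto c'), n'.+1 => prob_in_steps orc mu p E n' c'
  | Some (_, Toss k), n'.+1 =>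
      ((2^-1)%:E * (prob_in_steps orc mu p E n' (k true)
                    + prob_in_steps orc mu p E n' (k false)))%E
  | Some (_, Draw k), n'.+1 =>
      \esum_(x in [set: X]) ((mu x)%:E * prob_in_steps orc mu p E n' (k x))%E
  end.

Definition prob (R : realType) (O : Type) (X : choiceType)
    (orc : oracle O X) (mu : X -> R) (p : program O) (E : set (nat -> int))
    (c : config) : \bar R :=
  ereal_sup (range (fun n => prob_in_steps orc mu p E n c)).

Definition successor (R : realType) (X : Type) (mu : X -> R) (a : action X) :
    set config :=
  match a with
  | Goto c => [set c]
  | Toss k => range k
  | Draw k => k @` [set x | 0 < mu x]
  end.

(** Worst-case running time: every run from [c], whatever the coins and the
    samples (drawn from the support of [mu]), halts with total cost at most
    [t]. *)
Inductive halts_within (R : realType) (O : Type) (X : choiceType)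
    (orc : oracle O X) (mu : X -> R) (p : program O) : nat -> config -> Prop :=
| halts_now t c : step orc p c = None -> halts_within orc mu p t c
| halts_step t c w a : step orc p c = Some (w, a) -> (w <= t)%N ->
    (forall c', successor mu a c' -> halts_within orc mu p (t - w) c') ->
    halts_within orc mu p t c.

(** T(n) = O(n^e).  As every T(n) is finite, a constant valid for all large
    [n] can be enlarged to one valid for all positive [n]. *)
Definition bigO_pow (R : realType) (T : nat -> nat) (e : R) : Prop :=
  exists C : R, forall n, (0 < n)%N -> (T n)%:R <= C * n%:R `^ e.

(** * k-SUM *)

Definition ksum_instance (k n : nat) (A : seq (seq int)) : Prop :=
  [/\ size A = k,
      forall L, L \in A -> size L = n /\ uniq L &
      forall L a, L \in A -> a \in L -> (`|a| <= n ^ (2 * k))%N].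

Definition ksum_yes (k : nat) (A : seq (seq int)) : Prop :=
  exists2 a : nat -> int,
    forall i, (i < k)%N -> a i \in nth [::] A i
    & \sum_(i < k.-1) a i = a k.-1.

Definition ksum_input (n : nat) (A : seq (seq int)) : seq int :=
  n%:Z :: flatten A.

(** k-SUM programs have no oracle instruction and nothing to sample. *)
Definition no_oracle : oracle void void := fun o => match o with end.

(** The program answers "yes" by halting with R_0 <> 0. *)
Definition solves_ksum (R : realType) (k : nat) (p : program void)
    (T : nat -> nat) : Prop :=
  forall n A, (0 < n)%N -> ksum_instance k n A ->
    let c := start (ksum_input n A) [::] in
    let correct := [set m : nat -> int | m 0%N <> 0 <-> ksum_yes k A] in
    halts_within no_oracle (of_void R) p (T n) c /\
    ((2 / 3)%R%:E <= prob no_oracle (of_void R) p correct c)%E.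

Definition ksum_conjecture (R : realType) : Prop :=
  forall (k : nat) (g : R), (2 <= k)%N -> 0 < g ->
    ~ exists (p : program void) (T : nat -> nat),
        bigO_pow T ((uphalf k)%:R - g) /\ solves_ksum R k p T.

(** * Halfspaces over Z^d *)

Definition halfspace (R : realType) (d : nat) (w : 'rV[R]_d) (theta : R) :
    'rV[int]_d -> bool :=
  fun x => 0 <= (\sum_(i < d) w 0 i * (x 0 i)%:~R) + theta.

Definition halfspaces (R : realType) (d : nat) : set ('rV[int]_d -> bool) :=
  [set f | exists w theta, f = @halfspace R d w theta].

Definition disagreement (R : realType) (X : choiceType) (D : distr R X)
    (f g : X -> bool) : R :=
  fine (\esum_(x in [set x | f x != g x]) (D x)%:E).

Definition dist_class (R : realType) (X : choiceType) (D : distr R X)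
    (f : X -> bool) (H : set (X -> bool)) : R :=
  inf [set disagreement D f g | g in H].

(** * Distance approximation *)

(** [QueryAt r j] queries the function at the point held in the registers
    indexed by [r] and puts the answer in R_j. *)
Inductive access (d : nat) :=
| DrawSample
| QueryAt of d.-tuple nat & nat.

Arguments DrawSample {d}.

Definition labeled (d : nat) (f : 'rV[int]_d -> bool) (x : 'rV[int]_d) :
    seq int :=
  rcons [seq x 0 i | i <- enum 'I_d] (f x : nat)%:Z.

(** A sample replaces the whole content of the input tape, the head being
    placed at its beginning. *)
Definition access_oracle (d : nat) (f : 'rV[int]_d -> bool) :
    oracle (access d) 'rV[int]_d :=
  fun o c =>
    match o with
    | DrawSample =>
        Draw (fun x => Config (pc c) (regs c) (labeled f x) (param c))
    | QueryAt r j =>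
        Goto (write c j
          (f (\row_(i < d) regs c (tnth r i)) : nat)%:Z)
    end.

(** Binary digits of [m], least significant first. *)
Definition binary (m : nat) : seq bool :=
  mkseq (fun i => odd (m %/ 2 ^ i)) (bitlen m).

(** The output is the rational number R_0 / R_1. *)
Definition output (R : realType) (m : nat -> int) : R :=
  (m 0%N)%:~R / (m 1%N)%:~R.

(** Accuracy parameters are the numbers eps = 1 / m with m a positive integer,
    given by the O(log (1 / eps)) binary digits of [m].  [S m] is the set on
    which the distribution is promised to be supported when eps = 1 / m. *)
Definition approximates_distance (R : realType) (d : nat)
    (S : nat -> set 'rV[int]_d) (p : program (access d)) (T : nat -> nat) :
    Prop :=
  forall (m : nat) (D : distr R 'rV[int]_d) (f : 'rV[int]_d -> bool),
    (0 < m)%N -> (forall x, 0 < D x -> S m x) ->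
    let c := start [::] (binary m) in
    let accurate :=
      [set r : nat -> int |
        `|dist_class D f (@halfspaces R d) - output R r| <= m%:R^-1] in
    halts_within (access_oracle f) D p (T m) c /\
    ((2 / 3)%R%:E <= prob (access_oracle f) D p accurate c)%E.

(** Distance approximation for halfspaces over Z^d under the promise [S], in
    time O((1 / eps)^e). *)
Definition approximable (R : realType) (d : nat) (S : nat -> set 'rV[int]_d)
    (e : R) : Prop :=
  exists (p : program (access d)) (T : nat -> nat),
    bigO_pow T e /\ approximates_distance R S p T.

(** The points all of whose coordinates are at most (1 / eps)^c in absolute
    value, where eps = 1 / m. *)
Definition poly_box (d c m : nat) : set 'rV[int]_d :=
  [set x : 'rV[int]_d | forall i, (`|x 0%R i| <= m ^ c)%N].
Arguments poly_box : clear implicits.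

(* Main.v *)
(** A k-SUM instance over k = d + 1 lists is turned into a distribution and a
    labelling on Z^d.  Take base points u_0, ..., u_d in Z^(d-1) with u_0, ...,
    u_(d-1) affinely independent and u_d their barycentre.  An element a of the
    list A_i gives a vertical pair of points over u_i, at heights 2da and
    2da + 1 for i < d, and 2a and 2a + 1 for i = d; a point is labelled by the
    parity of its height.  A halfspace is correct on both points of a pair
    exactly when its boundary passes between them with the upper point inside,
    and on at least one point of every pair when it is monotone upwards.  Pairs
    over the same u_i are at least one unit apart, so at most one of them is
    separated.  If d + 1 pairs are, then averaging over the u_i shows that
    2(a_0 + ... + a_(d-1)) and 2 a_d differ by less than one, hence are equal;
    conversely a solution gives such a halfspace.  So, with P pairs in all, the
    distance under the uniform distribution is at most (P - d - 1) / (2P) or at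
    least (P - d) / (2P), which an approximation to within 1 / (8P) can tell
    apart.  The number of pairs is padded to a power of two by huge elements of
    the last list, which lie in no solution, so that fair coins sample exactly
    from the distribution.

    The k-SUM machine simulates the approximation algorithm.  A query has unit
    cost however large the point is, so the parity of its last coordinate
    cannot be computed on the spot; instead the simulation keeps the parity of
    every register beside the register and updates it at each write.  All
    this costs a polylogarithmic factor and, before the simulation starts,
    O(n) steps to read the input up to that factor.

    For d = 1 the claimed exponent is below 1, and reading the input would
    already be too slow.  The bound then holds unconditionally: o(1 / eps)
    samples do not detect a point of mass 3 eps. *)

Require Import Defs.
From mathcomp Require Import all_boot all_order all_algebra.
From mathcomp Require Import all_classical all_reals all_analysis.
From mathcomp Require Import zify ring lra.
Set Implicit Arguments.
Unset Strict Implicit.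
Unset Printing Implicit Defensive.
Import Order.TTheory GRing.Theory Num.Theory.
Local Open Scope classical_set_scope.
Local Open Scope ring_scope.

Local Notation Sub := Defs.Sub.

(** Register i of a simulated machine is kept in register 4i and the parity of
    its content in register 4i + 1.  The simulator itself works in the registers
    4q + 2: those below 38 are scratch and are cleared before every simulated
    instruction; [rM] holds the unread part of the parameter tape as a number,
    [rW] the number of sample points, [rN], [rP] and [rQ] the sizes needed to
    set up the instance; then come the simulated input tape ([tape_reg] below)
    and the list elements ([list_reg]). *)
Local Notation rX := 2%N. Local Notation rY := 6%N. Local Notation rZ := 10%N.
Local Notation rA := 14%N. Local Notation rU := 18%N. Local Notation rV := 22%N.
Local Notation rI := 26%N. Local Notation rJ := 30%N. Local Notation rT := 34%N.
Local Notation rM := 38%N. Local Notation rW := 42%N. Local Notation rN := 46%N.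
Local Notation rP := 50%N. Local Notation rQ := 54%N.
Local Notation "$ i" := (At (Reg i)) (at level 1, i at level 0).

(** * Bit lengths of integers *)

Lemma bitlen_homo m n : (m <= n)%N -> (bitlen m <= bitlen n)%N.
Proof. by move=> mn; rewrite ltnS leq_trunc_log. Qed.

(** The number 0 has bit length 1, hence the condition on [b]. *)
Lemma bitlenP n b : (0 < b)%N -> (bitlen n <= b)%N = (n < 2 ^ b)%N.
Proof.
case: b => // b _; rewrite /bitlen ltnS.
case: n => [|n]; first by rewrite trunc_log0 expn_gt0.
apply/idP/idP => h.
  by apply: leq_trans (trunc_log_ltn n.+1 (isT : 1 < 2)%N) _; rewrite leq_exp2l.
rewrite leqNgt; apply/negP => h2.
have := trunc_logP (isT : 1 < 2)%N (ltn0Sn n).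
rewrite leqNgt => /negP; apply; apply: leq_trans h _.
by rewrite leq_exp2l.
Qed.

Lemma ltn_bitlen n : (n < 2 ^ bitlen n)%N.
Proof. by rewrite -bitlenP. Qed.

Lemma bitlen_leS n : (bitlen n <= n.+1)%N.
Proof. by rewrite bitlenP //; apply: ltn_trans (ltn_expl _ _). Qed.

Lemma bitlenM a b : (bitlen (a * b) <= bitlen a + bitlen b)%N.
Proof.
rewrite bitlenP ?addn_gt0 // expnD.
have := ltn_bitlen a; have := ltn_bitlen b.
nia.
Qed.

Lemma bitlenD a b : (bitlen (a + b) <= bitlen a + bitlen b)%N.
Proof.
rewrite bitlenP ?addn_gt0 // expnD.
have := ltn_bitlen a; have := ltn_bitlen b.
have : (0 < bitlen a)%N by []; have : (0 < bitlen b)%N by [].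
move=> /(leq_pexp2l (isT : 0 < 2)%N) hb /(leq_pexp2l (isT : 0 < 2)%N) ha.
rewrite !expn1 in ha hb; nia.
Qed.

Lemma bitlen_exp a c : (0 < c)%N -> (bitlen (a ^ c) <= c * bitlen a)%N.
Proof.
move=> c0; rewrite bitlenP ?muln_gt0 ?c0 // mulnC expnM ltn_exp2r //.
exact: ltn_bitlen.
Qed.

(** Bit lengths are positive, so their sum absorbs the carry of an addition as well as the length of
    a product; a quotient is no longer than the dividend. *)
Lemma bitlen_arith o (x y : int) :
  (bitlen `|arith_fun o x y| <= bitlen `|x| + bitlen `|y|)%N.
Proof.
case: o => /=.
- apply: leq_trans (bitlen_homo _) (bitlenD _ _); lia.
- apply: leq_trans (bitlen_homo _) (bitlenD _ _); lia.
- by rewrite abszM bitlenM.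
- by apply: leq_trans (leq_addr _ _); apply: bitlen_homo; exact: lez_div.
Qed.

(** * Runs of programs without oracle *)

Section Reach.
Local Open Scope nat_scope.
Variable p : program void.

(** [reach r t c Q]: after exactly [r] coin tosses and at cost at most [t] the
    run from [c] is in a configuration satisfying [Q j], where [j < 2 ^ r] is
    the outcome of the tosses read in binary, first toss most significant. *)
Inductive reach : nat -> nat -> config -> (nat -> config -> Prop) -> Prop :=
| reach_done t c (Q : nat -> config -> Prop) : Q 0 c -> reach 0 t c Q
| reach_goto r t w c c1 Q :
    step no_oracle p c = Some (w, Goto c1) -> reach r t c1 Q ->
    reach r (w + t) c Q
| reach_toss r t w c k Q :
    step no_oracle p c = Some (w, Toss k) -> reach r t (k false) Q ->
    reach r t (k true) (fun j => Q (2 ^ r + j)) -> reach r.+1 (w + t) c Q.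

Lemma reach_leq r t t' c Q : t <= t' -> reach r t c Q -> reach r t' c Q.
Proof.
move=> tt' h; elim: h t' tt' => {r t c Q} [t c Q Qc|r t w c c1 Q st _ ih|r t w c k Q st _ ih1 _ ih2] t' tt'.
- exact: reach_done.
- have -> : t' = w + (t' - w) by lia.
  by apply: reach_goto st _; apply: ih; lia.
- have -> : t' = w + (t' - w) by lia.
  by apply: reach_toss st _ _; [apply: ih1|apply: ih2]; lia.
Qed.

Lemma reach_imp r t c (Q Q' : nat -> config -> Prop) :
  (forall j c1, j < 2 ^ r -> Q j c1 -> Q' j c1) -> reach r t c Q -> reach r t c Q'.
Proof.
move=> QQ' h; elim: h Q' QQ' => {r t c Q} [t c Q Qc|r t w c c1 Q st _ ih|r t w c k Q st _ ih1 _ ih2] Q' QQ'.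
- by apply: reach_done; apply: QQ'.
- by apply: reach_goto st _; apply: ih.
- rewrite expnS in QQ'; apply: reach_toss st _ _; [apply: ih1|apply: ih2] => j c1 jr; apply: QQ'; lia.
Qed.

Lemma reach_seq r t t' c Q Q' : reach 0 t c Q ->
  (forall c1, Q 0 c1 -> reach r t' c1 Q') -> reach r (t + t') c Q'.
Proof.
have [z hz] : exists z, z = 0 by exists 0.
rewrite -{1}hz => h; elim: h hz => {z t c Q} [t c Q Qc|z t w c c1 Q st _ ih|//] hz h.
  exact: reach_leq (leq_addl _ _) (h _ Qc).
by rewrite -addnA; apply: reach_goto st _; apply: ih.
Qed.

(** Here all tosses come first, so the outcome [j] is settled and selects the postcondition of the
    second segment; [reach_seq] covers the opposite order. *)
Lemma reach_after r t t' c Q Q' : reach r t c Q ->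
  (forall j c1, j < 2 ^ r -> Q j c1 -> reach 0 t' c1 (fun _ => Q' j)) ->
  reach r (t + t') c Q'.
Proof.
move=> h; elim: h Q' => {r t c Q} [t c Q Qc|r t w c c1 Q st _ ih|r t w c k Q st _ ih1 _ ih2] Q' h.
- apply: reach_leq (leq_addl _ _) _; apply: reach_imp (h 0 c (ltn0Sn _) Qc).
  by case=> [|j] c1; rewrite expn0.
- by rewrite -addnA; apply: reach_goto st _; apply: ih.
- rewrite expnS in h; rewrite -addnA; apply: reach_toss st _ _; [apply: ih1|apply: ih2] => j c1 jr Qj; apply: h => //; lia.
Qed.

Definition code_at pc (b : seq (instr void)) :=
  exists p1 p2, p = p1 ++ b ++ p2 /\ size p1 = pc.

Lemma code_at_cat pc b1 b2 : code_at pc (b1 ++ b2) ->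
  code_at pc b1 /\ code_at (pc + size b1) b2.
Proof.
move=> [p1 [p2 [pE <-]]]; split.
  by exists p1, (b2 ++ p2); rewrite pE -catA.
by exists (p1 ++ b1), p2; rewrite pE size_cat -!catA.
Qed.

Lemma code_at_cons pc i b : code_at pc (i :: b) ->
  onth p pc = Some i /\ code_at pc.+1 b.
Proof.
rewrite -[i :: b]cat1s => /code_at_cat[[p1 [p2 [pE <-]]]]; rewrite addn1; split=> //.
by rewrite pE onthE map_cat nth_cat size_map ltnn subnn.
Qed.

Definition plain (i : instr void) :=
  match i with Move _ _ | Arith _ _ _ _ => true | _ => false end.

Definition exec (i : instr void) (m : nat -> int) : nat -> int :=
  match i with
  | Move l s => [eta m with addr m l |-> value m s]
  | Arith o l s t => [eta m with addr m l |-> arith_fun o (value m s) (value m t)]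
  | _ => m
  end.

(** Meant for instructions that do not touch the tapes, whose cost depends on the registers alone;
    the other fields are dummies. *)
Definition cost (i : instr void) (m : nat -> int) := instr_cost i (Config 0 m [::] [::]).

Fixpoint run (b : seq (instr void)) (m : nat -> int) : nat -> int :=
  if b is i :: b' then run b' (exec i m) else m.

Fixpoint run_cost (b : seq (instr void)) (m : nat -> int) : nat :=
  if b is i :: b' then cost i m + run_cost b' (exec i m) else 0.

Lemma run_cons i b m : run (i :: b) m = run b (exec i m).
Proof. by []. Qed.

Lemma run_cost_cons i b m : run_cost (i :: b) m = cost i m + run_cost b (exec i m).
Proof. by []. Qed.

Lemma run_cat b1 b2 m : run (b1 ++ b2) m = run b2 (run b1 m).
Proof. by elim: b1 m => //= i b1 ih m. Qed.

Lemma run_cost_cat b1 b2 m :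
  run_cost (b1 ++ b2) m = run_cost b1 m + run_cost b2 (run b1 m).
Proof. by elim: b1 m => //= i b1 ih m; rewrite ih addnA. Qed.

Lemma reach_run r t pc b m inp par Q :
  code_at pc b -> all plain b ->
  reach r t (Config (pc + size b) (run b m) inp par) Q ->
  reach r (run_cost b m + t) (Config pc m inp par) Q.
Proof.
elim: b pc m => [|i b ih] pc m; first by rewrite addn0.
move=> /code_at_cons[hi hb] /= /andP[pi pb] h.
have {ih} := ih _ (exec i m) hb pb; rewrite addSnnS => /(_ h) h2.
rewrite -addnA; apply: reach_goto h2.
by rewrite /step /= hi /=; case: i hi pi h => //= [l s|o l s s'] hi _.
Qed.

End Reach.

(** * Simulating one instruction *)

Section Lite.
Local Open Scope nat_scope.

Definition own r := r %% 4 == 2.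

Definition own_le V (m : nat -> int) := forall r, own r -> bitlen `|m r| <= V.

Definition lite_src V (s : src) :=
  match s with
  | Cst z => bitlen `|z| <= V
  | At (Reg i) => own i && (bitlen i <= V)
  | At (Ind _) => false
  end.

Definition lite_loc V (l : loc) :=
  match l with Reg i => bitlen i <= V | Ind i => own i && (bitlen i <= V) end.

(** A syntactic condition under which a bound on the own registers alone controls the cost. Indirect
    reads are excluded because they may reach a simulated register of unknown size. *)
Definition lite V (i : instr void) :=
  match i with
  | Move l s => lite_loc V l && lite_src V s
  | Arith _ l s t => [&& lite_loc V l, lite_src V s & lite_src V t]
  | _ => false
  end.

Lemma lite_leq V V' i : V <= V' -> lite V i -> lite V' i.
Proof.
have T := leq_trans; move=> VV'.
have hl l : lite_loc V l -> lite_loc V' l.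
  by case: l => /= [i0 h|i0 /andP[-> h]]; rewrite (leq_trans h).
have hs s : lite_src V s -> lite_src V' s.
  by case: s => //= [z h|[i0|i0] //= /andP[-> h]]; rewrite (leq_trans h).
case: i => //= [l s /andP[/hl -> /hs ->]|o l s t /and3P[/hl -> /hs -> /hs ->]] //.
Qed.

Lemma lite_plain V b : all (lite V) b -> all plain b.
Proof. by apply: sub_all; case. Qed.

Lemma lite_loc_cost V m l : own_le V m -> lite_loc V l -> addr_cost m l <= 2 * V.
Proof. by move=> h; case: l => i /= => [|/andP[/h]]; lia. Qed.

Lemma lite_src_cost V m s : own_le V m -> lite_src V s -> value_cost m s <= 2 * V.
Proof. by move=> h; case: s => [z|[]i] //=; [lia|move=> /andP[/h]; lia]. Qed.

Lemma lite_value V m s : own_le V m -> lite_src V s -> bitlen `|value m s| <= V.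
Proof. by move=> h; case: s => [z|[]i] //= /andP[/h]. Qed.

Lemma own_le_write V m i v : own_le V m -> bitlen `|v| <= V ->
  own_le V [eta m with i |-> v].
Proof. by move=> h hv r /h /=; case: eqP. Qed.

Lemma own_leq V V' m : V <= V' -> own_le V m -> own_le V' m.
Proof. by move=> VV' h r /h; lia. Qed.

Lemma lite_exec V m i : own_le V m -> lite V i ->
  cost i m <= 7 * V /\ own_le (2 * V) (exec i m).
Proof.
move=> h; have V0 : 0 < V by apply: leq_trans (h 2 isT).
case: i => //= [l s /andP[hl hs]|o l s t /and3P[hl hs ht]].
- have := lite_loc_cost h hl; have := lite_src_cost h hs; rewrite /cost /=.
  split; first lia.
  apply: own_le_write; first by apply: own_leq h; lia.
  by have := lite_value h hs; lia.
- have := lite_loc_cost h hl; have := lite_src_cost h hs; have := lite_src_cost h ht; rewrite /cost /=.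
  split; first lia.
  apply: own_le_write; first by apply: own_leq h; lia.
  have := lite_value h hs; have := lite_value h ht.
  have := bitlen_arith o (value m s) (value m t); lia.
Qed.

(** Each instruction at most doubles the bound. The exponential loss is harmless because every
    fragment has a length depending on [d] only. *)
Lemma lite_run V m b : own_le V m -> all (lite V) b ->
  run_cost b m <= 7 * size b * 2 ^ size b * V /\ own_le (2 ^ size b * V) (run b m).
Proof.
elim: b m V => [|i b ih] m V h /=; first by rewrite mul1n.
move=> /andP[hi hb]; have [hc h'] := lite_exec h hi.
have hb' : all (lite (2 * V)) b by apply: sub_all hb => j; apply: lite_leq; lia.
have [h1 h2] := ih _ _ h' hb'; rewrite expnS; split.
  have : V <= 2 ^ size b * V by rewrite leq_pmull // expn_gt0.
  move: (2 ^ size b) (size b) h1 => e s h1 h3; apply: leq_trans (leq_add hc h1) _.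
  nia.
by rewrite -mulnA mulnCA.
Qed.

End Lite.

(** * Halting times and success probabilities *)

Lemma instr_cost_gt0 (O : Type) (i : instr O) c : (0 < instr_cost i c)%N.
Proof. by case: i. Qed.

Lemma step_cost_gt0 (O X : Type) (orc : oracle O X) p c w a :
  step orc p c = Some (w, a) -> (0 < w)%N.
Proof. by rewrite /step; case: onth => //= i [<- _]; exact: instr_cost_gt0. Qed.

Section Prob.
Variables (R : realType) (O : Type) (X : choiceType) (orc : oracle O X).
Variables (mu : X -> R) (p : program O) (E : set (nat -> int)).
Hypothesis mu_ge0 : forall x, 0 <= mu x.

Lemma halts_within_leq t t' c : (t <= t')%N ->
  halts_within orc mu p t c -> halts_within orc mu p t' c.
Proof.
move=> tt' h; elim: h t' tt' => {t c} [t c st|t c w a st wt _ ih] t' tt'.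
  exact: halts_now.
apply: (halts_step st); first exact: leq_trans tt'.
by move=> c' /ih; apply; rewrite leq_sub2r.
Qed.

Lemma prob_in_steps_ge0 n c : (0 <= prob_in_steps orc mu p E n c)%E.
Proof.
elim: n c => [|n ih] c /=; case: (step orc p c) => [[w [c'|k|k]]|];
  rewrite ?lee_fin ?indicE ?lexx ?ler0n //.
  by apply: mule_ge0; rewrite ?lee_fin ?invr_ge0 ?adde_ge0.
by apply: esum_ge0 => x _; apply: mule_ge0; rewrite ?lee_fin.
Qed.

Lemma prob_in_steps_homo n n' c : (n <= n')%N ->
  (prob_in_steps orc mu p E n c <= prob_in_steps orc mu p E n' c)%E.
Proof.
elim: n n' c => [|n ih] n' c nn'.
  case st: (step orc p c) => [[w a]|].
    by rewrite [leLHS]/= st; case: a {st} => *; exact: prob_in_steps_ge0.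
  by case: n' nn' => /= [|n'] _; rewrite st.
case: n' nn' => // n' nn' /=; case: (step orc p c) => [[w a]|] //=.
case: a => [c'|k|k]; first exact: ih.
  by apply: lee_wpmul2l; rewrite ?lee_fin ?invr_ge0 // leeD // ih.
by apply: le_esum => x _; apply: lee_wpmul2l; rewrite ?lee_fin ?ih.
Qed.

Lemma prob_in_steps_halted n c : step orc p c = None ->
  prob_in_steps orc mu p E n c = (\1_E (regs c))%:E.
Proof. by case: n => /= [|n] ->. Qed.

End Prob.

Section Good.
Variables (R : realType) (p : program void) (E : set (nat -> int)).

Definition good t (v : \bar R) c :=
  halts_within no_oracle (of_void R) p t c /\
  (v <= prob_in_steps no_oracle (of_void R) p E t c)%E.

Lemma good_leq t t' v v' c : (t <= t')%N -> (v' <= v)%E -> good t v c -> good t' v' c.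
Proof.
move=> tt' vv' [h1 h2]; split; first exact: halts_within_leq h1.
by apply: le_trans vv' _; apply: le_trans h2 _; apply: prob_in_steps_homo => // -[].
Qed.

(** Mean of [V] over the outcomes of [r] tosses. The recursion follows [prob_in_steps]; the toss
    [true] contributes the leading bit, as in [reach]. *)
Fixpoint avg (r : nat) (V : nat -> \bar R) : \bar R :=
  if r is r'.+1 then ((2^-1)%:E * (avg r' (fun j => V (2 ^ r' + j)%N) + avg r' V))%E
  else V 0%N.

Lemma reach_good r t t' c Q V : reach p r t c Q ->
  (forall j c1, (j < 2 ^ r)%N -> Q j c1 -> good t' (V j) c1) ->
  good (t + t') (avg r V) c.
Proof.
move=> h; elim: h V => {r t c Q} [t c Q Qc|r t w c c1 Q st _ ih|r t w c k Q st _ ih1 _ ih2] V h /=.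
- by apply: good_leq (h 0%N c _ Qc) => //; rewrite leq_addl.
- have [h1 h2] := ih _ h; have w0 := step_cost_gt0 st; split.
    apply: (halts_step st); first lia.
    by move=> c' /= ->; apply: halts_within_leq h1; lia.
  (* A step uses one unit of the step count however large its cost [w]; monotonicity takes care of
     the surplus [w.-1]. *)
  have -> : (w + t + t' = (w.-1 + t + t').+1)%N by lia.
  rewrite /= st; apply: le_trans h2 _; apply: prob_in_steps_homo; [by case|lia].
- rewrite expnS in h.
  have [|h1 h2] := ih1 V; first by move=> j c1 jr; apply: h; lia.
  have [|h3 h4] := ih2 (fun j => V (2 ^ r + j)%N).
    by move=> j c1 jr; apply: h; lia.
  have w0 := step_cost_gt0 st; split.
    apply: (halts_step st); first lia.
    by move=> c' /= [[] _ <-]; [apply: halts_within_leq h3|apply: halts_within_leq h1]; lia.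
  have -> : (w + t + t' = (w.-1 + t + t').+1)%N by lia.
  rewrite /= st; apply: lee_wpmul2l; first by rewrite lee_fin invr_ge0.
  by apply: leeD; [apply: le_trans h4 _|apply: le_trans h2 _];
     apply: prob_in_steps_homo; (by case) || lia.
Qed.

Lemma avgE r V : (forall j, 0 <= V j)%E ->
  avg r V = (((2 ^+ r)^-1)%:E * \sum_(j < 2 ^ r) V j)%E.
Proof.
elim: r V => [|r ih] V V0; first by rewrite expr0 invr1 mul1e big_ord1.
rewrite /= !ih // -ge0_muleDr ?sume_ge0 // muleA -EFinM -invfM -exprS; congr (_ * _)%E.
rewrite expnS mul2n -addnn big_split_ord /= addeC; congr (_ + _)%E.
Qed.

End Good.

(** * Register layout and memory access of the simulator *)

Section Code.
Local Open Scope nat_scope.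

Definition tape_reg l := 4 * l + 58.
Definition list_reg d' j := 4 * (d' + j) + 66.

(** Without this reset the doubling in [lite_run] would accumulate from one simulated instruction to
    the next. *)
Definition zeros : seq (instr void) :=
  [seq Move (Reg (4 * q + 2)) (Cst 0) | q <- iota 0 9].

Definition addr_code (l : loc) : instr void :=
  Arith Mul (Reg rA) (Cst 4)
    (match l with Reg i => Cst i | Ind i => $(4 * i) end).

Definition load x (s : src) : seq (instr void) :=
  match s with
  | Cst z => [:: Move (Reg x) (Cst z)]
  | At l => [:: addr_code l; Move (Reg x) (At (Ind rA))]
  end.

(** [rA] holds 4i or -4i, so one of the registers |rA + 1| and |rA - 1| is
    4i + 1; the parity is written to both, as the other one, 4i - 1, is not
    used (both are 1 if i = 0). *)
Definition store_tail : seq (instr void) :=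
  [:: Arith Div (Reg rY) ($rX) (Cst 2);
      Arith Mul (Reg rY) ($rY) (Cst 2);
      Arith Sub (Reg rY) ($rX) ($rY);
      Move (Ind rA) ($rX);
      Arith Add (Reg rU) ($rA) (Cst 1);
      Move (Ind rU) ($rY);
      Arith Sub (Reg rU) ($rA) (Cst 1);
      Move (Ind rU) ($rY)].

Definition store (l : loc) : seq (instr void) := addr_code l :: store_tail.

Definition mirrors (ms m : nat -> int) :=
  (forall i, m (4 * i) = ms i) /\ (forall i, m (4 * i + 1) = (ms i %% 2)%Z).

Definition keeps (m m' : nat -> int) := forall r, own r -> 38 <= r -> m' r = m r.

Definition lite_factor (b : seq (instr void)) := 7 * size b * 2 ^ size b.

Local Arguments cost : simpl never.
Local Arguments addr_code : simpl never.

Lemma zeros_cost m : run_cost zeros m = 57.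
Proof. by []. Qed.

Lemma run_zeros m r : run zeros m r = if own r && (r < 38) then 0%R else m r.
Proof.
rewrite /zeros /own /=; do !case: eqP => [->//|?].
by case: ifP => // ?; exfalso; lia.
Qed.

Lemma run_zeros_sim ms m : mirrors ms m -> mirrors ms (run zeros m).
Proof.
move=> [h1 h2]; split=> i; rewrite run_zeros /own.
  by rewrite -h1; case: ifP => //; lia.
by rewrite -h2; case: ifP => //; lia.
Qed.

Lemma run_zeros_own V m : (forall r, own r -> 38 <= r -> bitlen `|m r| <= V) ->
  0 < V -> own_le V (run zeros m).
Proof.
move=> h V0 r or; rewrite run_zeros or /=; case: ltnP => // rr; exact: h.
Qed.

Lemma bitlen4 i : bitlen (4 * i) <= 3 + bitlen i.
Proof. exact: bitlenM. Qed.

(** In the indirect case [addr_code] reads a simulated register, which [lite] forbids; its cost is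
    controlled by the address cost in the simulated machine. *)
Lemma addr_code_spec ms m l V : mirrors ms m -> own_le V m -> addr_cost ms l <= V ->
  [/\ `|exec (addr_code l) m rA| = 4 * addr ms l,
      cost (addr_code l) m <= 12 * V & own_le (4 * V) (exec (addr_code l) m)].
Proof.
move=> [hv _] hm hl; have V0 : 0 < V by apply: leq_trans (hm 2 isT).
rewrite /addr_code; case: l hl => i /= hl.
  have h : `|(4%:Z * i%:Z)%R| = 4 * i by lia.
  split=> //; first by rewrite /cost /= -[bitlen 14]/4 -[bitlen 4]/3; lia.
  apply: own_le_write; first by apply: own_leq hm; lia.
  by rewrite h; have := bitlen4 i; lia.
rewrite hv; have h : `|(4%:Z * ms i)%R| = 4 * `|ms i| by lia.
split=> //; first by rewrite /cost /= ?hv -[bitlen 14]/4 -[bitlen 4]/3; have := bitlen4 i; lia.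
apply: own_le_write; first by apply: own_leq hm; lia.
by rewrite h; have := bitlen4 `|ms i|; lia.
Qed.

Lemma exec_addr_code m l r : r != rA -> exec (addr_code l) m r = m r.
Proof. by rewrite /addr_code; case: l => i /= /negbTE ->. Qed.

Lemma load_spec ms m x s V : mirrors ms m -> own_le V m -> value_cost ms s <= V ->
  x < 38 -> own x ->
  [/\ run (load x s) m x = value ms s,
      (forall r, r != rA -> r != x -> run (load x s) m r = m r),
      run_cost (load x s) m <= 40 * V & own_le (4 * V) (run (load x s) m)].
Proof.
move=> hms hm hs x38 ox; have V0 : 0 < V by apply: leq_trans (hm 2 isT).
have bx : bitlen x <= 6 by rewrite bitlenP //; lia.
case: s hs => [z|l] hs.
  rewrite /= in hs *; split=> //; rewrite ?eqxx //; first by move=> r _ /negbTE ->.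
    by rewrite /cost /=; lia.
  by apply: own_le_write; [apply: own_leq hm|]; lia.
have [|hA hc ho] := @addr_code_spec ms m l V hms hm; first by move: hs => /=; lia.
have hval : exec (addr_code l) m `|exec (addr_code l) m rA| = ms (addr ms l).
  by rewrite hA exec_addr_code ?hms.1 //; lia.
have hE r : r != rA -> exec (addr_code l) m r = m r by exact: exec_addr_code.
rewrite /load run_cons run_cost_cons.
move: (exec (addr_code l) m) (cost (addr_code l) m) hA hc ho hval hE => m0 c0 hA hc ho hval hE.
split; rewrite ?eqxx //.
- by rewrite /= eqxx.
- by move=> r rA' /= /negbTE ->; apply: hE.
- rewrite /= /cost /= hval hA -[bitlen 14]/4; have := bitlen4 (addr ms l).
  rewrite /= in hs; suff : bitlen (addr ms l) <= V by lia.
  by case: (l) hs => i /=; lia.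
- rewrite /= in hs *; apply: own_le_write; first exact: ho.
  by rewrite hval; lia.
Qed.

Lemma load_plain x s : all plain (load x s).
Proof. by case: s => [|[]]. Qed.

Lemma store_plain l : all plain (store l).
Proof. by case: l. Qed.

Lemma store_spec ms m l V : mirrors ms m -> own_le V m -> addr_cost ms l <= V ->
  [/\ mirrors [eta ms with addr ms l |-> m rX] (run (store l) m),
      keeps m (run (store l) m) &
      run_cost (store l) m <= (12 + 8 * lite_factor store_tail) * V].
Proof.
move=> hms hm hl; have V0 : 0 < V by apply: leq_trans (hm 2 isT).
have [hA hc ho] := addr_code_spec hms hm hl.
have hlite : all (lite (8 * V)) store_tail.
  by apply: (@sub_all _ (lite 8)) => // i; apply: lite_leq; lia.
have ho8 : own_le (8 * V) (exec (addr_code l) m) by apply: own_leq ho; lia.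
have [hc2 _] := lite_run ho8 hlite; clear ho8.
have hX : exec (addr_code l) m rX = m rX by exact: exec_addr_code.
set m0 := exec (addr_code l) m in hA hc ho hc2 hX *.
have E r : run (store l) m r = run store_tail m0 r by [].
have hm0 r : r != rA -> m0 r = m r by exact: exec_addr_code.
have c0 : run_cost (store l) m = cost (addr_code l) m + run_cost store_tail m0 by [].
clearbody m0.
have {hc hc2 ho hlite c0 hm hl V0} C3 : run_cost (store l) m <= (12 + 8 * lite_factor store_tail) * V.
  by rewrite c0 /lite_factor; lia.
have par : (m 2%N - (m 2%N %/ 2)%Z * 2)%R = (m 2%N %% 2)%Z by [].
(* Own registers are even but not divisible by 4, whereas the indirect writes go to a multiple of 4
   and to odd registers, so no scratch value is overwritten. *)
have e1 : (14 == `|m0 14|) = false by clear - hA; lia.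
have e2 : (6 == `|m0 14|) = false by clear - hA; lia.
have e3 : (14 == `|(m0 14%N + 1)%R|) = false by clear - hA; lia.
have e4 : (6 == `|(m0 14%N + 1)%R|) = false by clear - hA; lia.
have {}E r : run (store l) m r =
    if (r == `|(m0 14%N - 1)%R|) || (r == `|(m0 14%N + 1)%R|) then (m 2%N %% 2)%Z
    else if r == `|m0 14| then m rX else
    if r == 18 then (m0 14%N - 1)%R else if r == 6 then (m 2%N %% 2)%Z else m0 r.
  rewrite E /= hX par ?(e1, e2, e3, e4) /=.
  have e5 : (18 == `|(m0 14%N + 1)%R|) = false by clear - hA; lia.
  have e6 : (18 == `|m0 14|) = false by clear - hA; lia.
  case: (r =P 18) => [->|_]; rewrite ?e5 ?e6 /= ?orbF //.
  by case: (r == `|(m0 14%N - 1)%R|); case: (r == `|(m0 14%N + 1)%R|);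
     case: (r == `|m0 14|); case: (r == 6).
split=> //; clear par hX C3.
- split=> i; rewrite E.
  + have -> : (4 * i == `|(m0 14%N - 1)%R|) = false by lia.
    have -> : (4 * i == `|(m0 14%N + 1)%R|) = false by lia.
    have -> : (4 * i == `|m0 14|) = (i == addr ms l) by lia.
    rewrite /=; case: eqP => // _.
    have -> : (4 * i == 18) = false by lia.
    have -> : (4 * i == 6) = false by lia.
    by rewrite hm0 ?hms.1 //; lia.
  + rewrite /=; case: (i =P addr ms l) => [->|il].
      have -> // : (4 * addr ms l + 1 == `|(m0 14%N - 1)%R|) ||
        (4 * addr ms l + 1 == `|(m0 14%N + 1)%R|) by lia.
    have -> : (4 * i + 1 == `|(m0 14%N - 1)%R|) || (4 * i + 1 == `|(m0 14%N + 1)%R|) = false.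
      by lia.
    have -> : (4 * i + 1 == `|m0 14|) = false by lia.
    have -> : (4 * i + 1 == 18) = false by lia.
    have -> : (4 * i + 1 == 6) = false by lia.
    by rewrite hm0 ?hms.2 //; lia.
- move=> r or r38; rewrite /own in or; rewrite E.
  have -> : (r == `|(m0 14%N - 1)%R|) || (r == `|(m0 14%N + 1)%R|) = false by lia.
  have -> : (r == `|m0 14|) = false by lia.
  have -> : (r == 18) = false by lia.
  have -> : (r == 6) = false by lia.
  by rewrite hm0 //; lia.
Qed.

End Code.

(** * The instance and its sampling *)

Definition label (d' : nat) (x : 'rV[int]_d'.+1) : bool := odd `|x 0 ord_max|.

Section Instance.
Variables (d' n : nat) (val : nat -> int).
Local Notation d := d'.+1.

(** List elements are numbered consecutively, [n] to a list; the padding falls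
    into the last list, which is why the index is capped. *)
Definition idx (j : nat) : nat := minn (j %/ n) d.

(** The last of the base points [base i], i < d, is the origin; the coordinate
    [l = d'] of the point being its height, it plays no role here. *)
Definition base (i l : nat) : int :=
  if i == d then 1 else if i == l then d%:Z else 0.

Definition coef (i : nat) : int := if i == d then 2%:Z else (2 * d)%N%:Z.

Definition point (J : nat) : 'rV[int]_d :=
  \row_(l < d) if l == ord_max then coef (idx J./2) * val J./2 + (odd J)%:Z
               else base (idx J./2) l.

Lemma coef_even i : (coef i %% 2)%Z = 0.
Proof. by rewrite /coef; case: ifP => _ //; lia. Qed.

(** All coefficients are even, so the parity of the height is the position within the pair. *)
Lemma label_point J : label (point J) = odd J.
Proof.
rewrite /label mxE eqxx; have := coef_even (idx J./2).
move: (coef _) (val _) => a b h.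
have [c ->] : exists c, a = c * 2 by exists (a %/ 2)%Z; rewrite {1}(divz_eq a 2) h addr0.
by rewrite mulrAC; move: (c * b) => e; case: (odd J); lia.
Qed.

Lemma nth_labeled J l : (l <= d)%N ->
  nth 0 (labeled (@label d') (point J)) l =
  if l == d then (odd J)%:Z else if l == d' then coef (idx J./2) * val J./2 + (odd J)%:Z
  else base (idx J./2) l.
Proof.
move=> ld; rewrite /labeled nth_rcons size_map size_enum_ord label_point.
have [->|nld] := eqVneq l d; first by rewrite ltnn.
have ltld : (l < d)%N by rewrite ltn_neqAle nld.
rewrite ltld.
rewrite (nth_map ord0) ?size_enum_ord // mxE -val_eqE /= nth_enum_ord //.
Qed.

Lemma size_labeled (x : 'rV[int]_d) : size (labeled (@label d') x) = d.+1.
Proof. by rewrite size_rcons size_map size_enum_ord. Qed.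

End Instance.

(** * Sampling a labelled point by coin tosses *)

Section Sampling.
Local Open Scope nat_scope.
Variables (d' n P B : nat) (val : nat -> int).
Local Notation d := d'.+1.

Local Arguments tape_reg : simpl never.
Local Arguments list_reg : simpl never.
Local Arguments bitlen : simpl never.

Definition sample1 : seq (instr void) :=
  [:: Arith Div (Reg rI) ($rJ) (Cst 2);
      Arith Mul (Reg rV) ($rI) (Cst 2);
      Arith Sub (Reg rX) ($rJ) ($rV);
      Arith Mul (Reg rA) ($rI) (Cst 4);
      Arith Add (Reg rA) ($rA) (Cst (list_reg d' 0))].

(** Division by 0 yields 0, so [x / x] is the indicator of [x <> 0]: here [rV]
    becomes 1 for elements of the last list and 0 otherwise. *)
Definition sample2 : seq (instr void) :=
  [:: Arith Div (Reg rI) ($rI) ($rN);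
      Arith Div (Reg rV) ($rI) (Cst d);
      Arith Div (Reg rV) ($rV) ($rV);
      Arith Sub (Reg rY) ($rI) (Cst d);
      Arith Mul (Reg rY) ($rY) ($rV);
      Arith Sub (Reg rI) ($rI) ($rY)].

Definition sample3 : seq (instr void) :=
  [seq Move (Reg (tape_reg l)) ($rV) | l <- iota 0 d].

Definition sample4 : seq (instr void) :=
  [:: Arith Mul (Reg rA) ($rI) (Cst 4);
      Arith Add (Reg rA) ($rA) (Cst (tape_reg 0));
      Move (Ind rA) (Cst d)].

(** With the indicator [rV] the coefficient is 2d - 2d' [rV]: it is 2d in general and 2 for the last
    list, as d = d' + 1. *)
Definition sample5 : seq (instr void) :=
  [:: Arith Mul (Reg rY) ($rV) (Cst (2 * d')%N);
      Arith Sub (Reg rY) (Cst (2 * d)%N) ($rY);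
      Arith Mul (Reg rZ) ($rZ) ($rY);
      Arith Add (Reg (tape_reg d')) ($rZ) ($rX);
      Move (Reg (tape_reg d)) ($rX)].

(** The load of the list element stands by itself since [lite] excludes indirect reads. *)
Definition sample : seq (instr void) :=
  sample1 ++ Move (Reg rZ) (At (Ind rA)) :: sample2 ++ sample3 ++ sample4 ++ sample5.

Lemma sample_plain : all plain sample.
Proof. by rewrite !all_cat /= all_cat /= all_map andbT; apply/allP. Qed.

Lemma run_sample3 m r : run sample3 m r =
  if [exists l : 'I_d, r == tape_reg l] then m rV else m r.
Proof.
have gen k : run [seq Move (Reg (tape_reg l)) ($rV) | l <- iota 0 k] m r =
    if [exists l : 'I_k, r == tape_reg l] then m rV else m r; last exact: gen.
elim: k r => [|k ih] r; first by case: existsP => // -[[]].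
rewrite -[in iota _ _]addn1 iotaD map_cat run_cat add0n /= !ih.
have -> : [exists l : 'I_k, rV == tape_reg l] = false.
  by apply/existsP => -[l]; rewrite /tape_reg; lia.
case: eqP => [->|rk].
  by case: existsP => // -[]; exists ord_max.
case: existsP => [[l rl]|h]; case: existsP => // h'; exfalso.
  by apply: h'; exists (widen_ord (leqnSn k) l).
case: h' => l rl; apply: h; have lk : l < k.
  by have := ltn_ord l; rewrite ltnS leq_eqVlt => /orP[/eqP lk|//]; case: rk; rewrite -lk; apply/eqP.
by exists (Ordinal lk).
Qed.

Definition own_data (m : nat -> int) :=
  [/\ m rW = (2 * P)%:Z, m rN = n%:Z & forall j, j < P -> m (list_reg d' j) = val j].

Definition own_bound (m : nat -> int) :=
  forall r, own r -> 38 <= r -> bitlen `|m r| <= B.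

Lemma sample_spec m J : own_data m -> J < 2 * P -> m rJ = J%:Z ->
  (forall l, l <= d ->
     run sample m (tape_reg l) = nth 0%R (labeled (@label d') (point d' n val J)) l) /\
  (forall r, ~~ own r \/ [/\ own r, 38 <= r & forall l, l <= d -> r != tape_reg l] ->
     run sample m r = m r).
Proof.
move=> [_ hN hval] JP hJ.
rewrite /sample run_cat.
set j := J./2.
have jE : (J%:Z %/ 2)%Z = j%:Z by rewrite /j; lia.
have jP : j < P by rewrite /j; lia.
have [m1 [-> hI hX hA hfr1]] : exists m1 : nat -> int, [/\ run sample1 m = m1,
    m1 rI = j%:Z, m1 rX = (odd J)%:Z, m1 rA = (list_reg d' j)%:Z &
    forall r, r \notin [:: rI; rV; rX; rA] -> m1 r = m r].
  exists (run sample1 m); split=> //.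
  - by rewrite /= hJ jE.
  - by rewrite /= hJ jE /j; lia.
  - by rewrite /= hJ jE /list_reg; lia.
  - move=> r; rewrite !inE !negb_or => /and4P[/negbTE e1 /negbTE e2 /negbTE e3 /negbTE e4].
    by rewrite /= ?e1 ?e2 ?e3 ?e4.
rewrite run_cons.
have [m2 [-> hI2 hX2 hZ2 hfr2]] : exists m2 : nat -> int,
   [/\ exec (Move (Reg rZ) (At (Ind rA))) m1 = m2,
    m2 rI = j%:Z, m2 rX = (odd J)%:Z, m2 rZ = val j &
    forall r, r \notin [:: rI; rV; rX; rA; rZ] -> m2 r = m r].
  exists (exec (Move (Reg rZ) (At (Ind rA))) m1); split=> //.
  - by rewrite /= hA /= hfr1 ?hval // !inE /list_reg; lia.
  - move=> r; rewrite !inE !negb_or => /and5P[h1 h2 h3 h4 h5].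
    by rewrite /= (negbTE h5) hfr1 // !inE !negb_or h1 h2 h3.
rewrite run_cat.
set v : nat := (d <= j %/ n).
have hN2 : m2 rN = n%:Z by rewrite hfr2.
have [m3 [[-> hI3 hV3] [hX3 hZ3 hfr3]]] : exists m3 : nat -> int,
   [/\ run sample2 m2 = m3, m3 rI = (idx d' n j)%:Z & m3 rV = v%:Z] /\
   [/\ m3 rX = (odd J)%:Z, m3 rZ = val j &
    forall r, r \notin [:: rI; rV; rX; rA; rZ; rY] -> m3 r = m r].
  have vE : j %/ n %/ d %/ (j %/ n %/ d) = v by rewrite divnn divn_gt0.
  exists (run sample2 m2); split; split=> //.
  - by rewrite /= hI2 hN2 !divz_nat vE /idx /v; case: leqP => h; rewrite ?mulr1 ?mulr0; lia.
  - by rewrite /= hI2 hN2 !divz_nat vE.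
  - move=> r; rewrite !inE !negb_or => /and5P[h1 h2 h3 h4 /andP[h5 h6]].
    by rewrite /= (negbTE h6) (negbTE h1) (negbTE h2) hfr2 // !inE !negb_or h1 h2 h3 h4.
rewrite run_cat.
have [m4 [-> hI4 hV4 hX4 hZ4] [ht4 hfr4]] : exists2 m4 : nat -> int,
   [/\ run sample3 m3 = m4, m4 rI = (idx d' n j)%:Z, m4 rV = v%:Z,
       m4 rX = (odd J)%:Z & m4 rZ = val j] &
    (forall l, l <= d' -> m4 (tape_reg l) = v%:Z) /\
    (forall r, r \notin [:: rI; rV; rX; rA; rZ; rY] ->
       (forall l, l <= d -> r != tape_reg l) -> m4 r = m r).
  have E r : (forall l, l <= d -> r != tape_reg l) ->
      [exists l : 'I_d, r == tape_reg l] = false.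
    by move=> h; apply/existsP => -[l /eqP rl]; have := h l (ltnW (ltn_ord l)); rewrite rl eqxx.
  exists (run sample3 m3).
    by split=> //; rewrite run_sample3 E // => l _; rewrite /tape_reg; lia.
  split=> [l ld|r hr hl]; last by rewrite run_sample3 E // hfr3.
  have ld' : l < d by [].
  by rewrite run_sample3; case: existsP => // -[]; exists (Ordinal ld').
rewrite run_cat.
have [m5 [-> hV5 hX5 hZ5] [ht5 hfr5]] : exists2 m5 : nat -> int,
   [/\ run sample4 m4 = m5, m5 rV = v%:Z, m5 rX = (odd J)%:Z & m5 rZ = val j] &
    (forall l, l <= d' -> m5 (tape_reg l) = if l == idx d' n j then d%:Z else v%:Z) /\
    (forall r, r \notin [:: rI; rV; rX; rA; rZ; rY] ->
       (forall l, l <= d -> r != tape_reg l) -> m5 r = m r).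
  have iA : `|(idx d' n j * 4 + tape_reg 0)%N%:Z| = tape_reg (idx d' n j).
    by rewrite /tape_reg; lia.
  have E r : r != rA -> run sample4 m4 r =
      if r == tape_reg (idx d' n j) then d%:Z else m4 r.
    move=> /negbTE rA'; rewrite /= hI4 -PoszM -PoszD iA.
    by case: ifP => //; rewrite rA'.
  exists (run sample4 m4).
    split=> //; rewrite E //.
    - by have -> : (22 == tape_reg (idx d' n j)) = false by rewrite /tape_reg; lia.
    - by have -> : (2 == tape_reg (idx d' n j)) = false by rewrite /tape_reg; lia.
    - by have -> : (10 == tape_reg (idx d' n j)) = false by rewrite /tape_reg; lia.
  split=> [l ld|r hr hl].
    rewrite E ?ht4 //; last by rewrite /tape_reg; lia.
    by have -> : (tape_reg l == tape_reg (idx d' n j)) = (l == idx d' n j) by rewrite /tape_reg; lia.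
  rewrite E; last by move: hr; rewrite !inE !negb_or => /and5P[].
  by rewrite (negbTE (hl _ _)) ?hfr4 // /idx geq_minr.
have E r : r \notin [:: rY; rZ] -> run sample5 m5 r =
    if r == tape_reg d then (odd J)%:Z else
    if r == tape_reg d' then (coef d' (idx d' n j) * val j + (odd J)%:Z)%R else m5 r.
  rewrite !inE negb_or => /andP[/negbTE e1 /negbTE e2].
  have -> : (coef d' (idx d' n j) = (2 * d)%N%:Z - v%:Z * (2 * d')%N%:Z)%R.
    rewrite /coef /idx /v; case: (leqP d (j %/ n)) => h.
      by rewrite eqxx; lia.
    by rewrite ltn_eqF //; lia.
  rewrite /= hX5 hV5 hZ5 e1 e2.
  have -> : (2 == tape_reg d') = false by rewrite /tape_reg; lia.
  by rewrite [(val j * _)%R]mulrC.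
split=> [l ld|r hr].
  rewrite E; last by rewrite !inE /tape_reg; lia.
  rewrite nth_labeled // -/j.
  have -> : (tape_reg l == tape_reg d) = (l == d) by rewrite /tape_reg; lia.
  have -> : (tape_reg l == tape_reg d') = (l == d') by rewrite /tape_reg; lia.
  case: eqP => // /eqP ld1; case: eqP => // /eqP ld2.
  rewrite ht5; last by lia.
  rewrite /base /idx /v; case: (leqP d (j %/ n)) => h.
    by rewrite eqxx (negbTE ld1).
  by rewrite [l == _]eq_sym (ltn_eqF h).
have hl : forall l, l <= d -> r != tape_reg l.
  by move=> l ld; case: hr => [|[_ _]]; [rewrite /own /tape_reg; lia|exact].
have hs : r \notin [:: rI; rV; rX; rA; rZ; rY].
  by rewrite !inE; case: hr => [|[_ h _]]; rewrite /own; lia.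
rewrite E; last by move: hs; rewrite !inE !negb_or => /and5P[_ _ _ _ /andP[-> ->]].
by rewrite !(negbTE (hl _ _)) // hfr5.
Qed.

Hypothesis B_large : 4 * d' + 100 <= B.

Lemma lite_const V (i : nat) : i < V -> bitlen `|i%:Z| <= V.
Proof. exact: leq_trans (bitlen_leS i). Qed.

Lemma lite_reg V (i : nat) : i < V -> bitlen i <= V.
Proof. exact: leq_trans (bitlen_leS i). Qed.

Definition sample_factor :=
  lite_factor sample1 + 2 ^ 5 * (7 + lite_factor (sample2 ++ sample3 ++ sample4 ++ sample5)).

Lemma sample_cost m J : J < 2 * P -> m rJ = J%:Z -> own_le B m ->
  run_cost sample m <= sample_factor * B.
Proof.
move=> JP hJ hm; rewrite /sample run_cost_cat run_cost_cons.
have l1 : all (lite B) sample1 by rewrite /= !lite_reg //= /list_reg; lia.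
have l2 : all (lite B) (sample2 ++ sample3 ++ sample4 ++ sample5).
  clear JP hJ hm.
  rewrite !all_cat; apply/and4P; split.
  - by rewrite /= !lite_reg //; lia.
  - rewrite all_map; apply/allP => l; rewrite mem_iota /= => ld.
    by rewrite !lite_reg // /tape_reg; lia.
  - by rewrite /= !lite_reg // /tape_reg; lia.
  - by rewrite /= !lite_reg // /tape_reg; lia.
have {}l2 : all (lite (2 ^ 5 * B)) (sample2 ++ sample3 ++ sample4 ++ sample5).
  by apply: sub_all l2 => i; apply: lite_leq; lia.
have [c1 o1] := lite_run hm l1.
(* The address read indirectly is an own register, so the bound on own registers also covers the
   loaded value. *)
have hA : own `|run sample1 m rA|.
  have jE : (J%:Z %/ 2)%Z = (J./2)%:Z by lia.
  by rewrite /= hJ jE /own /list_reg; lia.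
have c2 : cost (Move (Reg rZ) (At (Ind rA))) (run sample1 m) <= 7 * (2 ^ 5 * B).
  have := o1 _ hA; have := o1 rA isT; move: (run sample1 m) => m1.
  change (size sample1) with 5; have : 9 <= 2 ^ 5 * B by lia.
  move: (2 ^ 5 * B) => V V9 h1 h2.
  rewrite /cost /= -[bitlen 10]/4 -[bitlen 14]/4; lia.
have o2 : own_le (2 ^ 5 * B) (exec (Move (Reg rZ) (At (Ind rA))) (run sample1 m)).
  by apply: own_le_write => //; exact: o1.
have [c3 _] := lite_run o2 l2.
rewrite -[7 * _ * _]/(lite_factor _) in c1; rewrite -[7 * _ * _]/(lite_factor _) in c3.
rewrite /sample_factor; move: (lite_factor _) (lite_factor _) c1 c3 => f1 f2 c1 c3.
apply: leq_trans (leq_add c1 (leq_add c2 c3)) _.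
by move: (2 ^ 5) => e; lia.
Qed.

(** [rT] counts down through 2 ^ r - 1, 2 ^ (r - 1) - 1, ..., 0. *)
Definition toss_loop pos : seq (instr void) :=
  [:: Flip rX; Arith Add (Reg rJ) ($rJ) ($rJ); Arith Add (Reg rJ) ($rJ) ($rX);
      Arith Div (Reg rT) ($rT) (Cst 2); JumpPos ($rT) pos].

Hypothesis B_P : bitlen (2 * P) <= B.

(** [J] holds the bits tossed so far. The hypothesis on it says that every completion by [r.+1] more
    bits stays below 2P, which keeps the registers small throughout. *)
Lemma toss_loop_spec p pc r m J inp par :
  code_at p pc (toss_loop pc) -> m rT = (2 ^ r.+1 - 1)%:Z -> m rJ = J%:Z ->
  J.+1 * 2 ^ r.+1 <= 2 * P -> own_le B m ->
  reach p r.+1 (r.+1 * (180 * B)) (Config pc m inp par) (fun j c =>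
    exists m1, [/\ c = Config (pc + 5) m1 inp par, m1 rJ = (J * 2 ^ r.+1 + j)%:Z,
      own_le B m1 & forall i, i \notin [:: rX; rJ; rT] -> m1 i = m i]).
Proof.
move=> hc; have [h0 hc1] := code_at_cons hc.
have [hc2 /code_at_cons[h4 _]] := @code_at_cat p pc.+1 [:: _; _; _] [:: _] hc1.
have B0 : 0 < B by apply: leq_trans B_P.
(* One round after the coin has fallen: the counter goes from 2^(k+1) - 1 to 2^k - 1, and the loop
   is left when it reaches 0. *)
have body k m0 J0 (b : bool) : m0 rT = (2 ^ k.+1 - 1)%N%:Z -> m0 rJ = J0%:Z ->
    J0.+1 * 2 ^ k.+1 <= 2 * P -> own_le B m0 ->
    reach p 0 (179 * B) (Config pc.+1 [eta m0 with rX |-> (b : nat)%:Z] inp par)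
      (fun _ c => exists m1, [/\ c = Config (if k == 0 then pc + 5 else pc) m1 inp par,
         m1 rT = (2 ^ k - 1)%N%:Z, m1 rJ = (J0 * 2 + b)%N%:Z, own_le B m1 &
         forall i, i \notin [:: rX; rJ; rT] -> m1 i = m0 i]).
  move=> hT0 hJ0 hJP0 hm0.
  have k0 : 0 < 2 ^ k by rewrite expn_gt0.
  have JP0 : J0 * 2 + b < 2 * P by rewrite expnS in hJP0; case: b; nia.
  have TP0 : 2 ^ k - 1 < 2 * P by rewrite expnS in hJP0; nia.
  have hb : bitlen `|(b : nat)%:Z| <= B by rewrite lite_const //; case: b {JP0}; lia.
  set b3 := [:: Arith Add (Reg rJ) ($rJ) ($rJ); Arith Add (Reg rJ) ($rJ) ($rX);
      Arith Div (Reg rT) ($rT) (Cst 2)] in hc2.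
  have o1 : own_le B [eta m0 with rX |-> (b : nat)%:Z] by exact: own_le_write.
  have l3 : all (lite B) b3 by rewrite /= !lite_reg //; lia.
  have [c3 _] := lite_run o1 l3.
  have [m1 [mE hT1 hJ1 hfr]] : exists m1, [/\ run b3 [eta m0 with rX |-> (b : nat)%:Z] = m1,
      m1 rT = (2 ^ k - 1)%N%:Z, m1 rJ = (J0 * 2 + b)%N%:Z &
      forall i, m1 i = if i == rJ then (J0 * 2 + b)%N%:Z else if i == rT then
       (2 ^ k - 1)%N%:Z else if i == rX then (b : nat)%:Z else m0 i].
    have tE : ((2 ^ k.+1 - 1)%N%:Z %/ 2)%Z = (2 ^ k - 1)%N%:Z by rewrite expnS; lia.
    have jE : (J0%:Z + J0%:Z + (b : nat)%:Z)%R = (J0 * 2 + b)%N%:Z by lia.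
    exists (run b3 [eta m0 with rX |-> (b : nat)%:Z]).
    split=> //=; rewrite ?hT0 ?hJ0 ?tE ?jE // => i.
    case: (i =P rJ) => [->//|_]; by case: (i =P rT).
  have o2 : own_le B m1.
    move=> i oi; rewrite hfr; case: eqP => _; first by apply: leq_trans (bitlen_homo _) B_P; lia.
    case: eqP => _; first by apply: leq_trans (bitlen_homo _) B_P; lia.
    by case: eqP => // _; apply: hm0.
  (* [lite_run] charges 168 B for the three arithmetic instructions; 11 B pays for the jump. *)
  have -> : 179 * B = 7 * size b3 * 2 ^ size b3 * B + 11 * B by rewrite /=; lia.
  apply: reach_leq (leq_add c3 (leqnn _)) _; apply: (reach_run hc2) => //.
  rewrite mE; have -> : 11 * B = cost (JumpPos ($rT) pc) m1 + (11 * B - cost (JumpPos ($rT) pc) m1).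
    rewrite subnKC // /cost /= -[bitlen 34]/6; have := o2 rT isT; lia.
  apply: reach_goto; first by rewrite /step [onth _ _]h4 /=.
  apply: reach_done; exists m1; split=> //=; last first.
    by move=> i; rewrite hfr !inE !negb_or => /and3P[/negbTE-> /negbTE-> /negbTE->].
  rewrite hT1; case: (k) k0 => [_|k'].
    by rewrite expn0 subnn ltxx /advance /goto /=; congr Config; lia.
  rewrite expnS => k0; have -> : (0 < (2 * 2 ^ k' - 1)%N%:Z)%R by lia.
  by [].
have flip m0 : step no_oracle p (Config pc m0 inp par) =
    Some (1, Toss (fun b => Config pc.+1 [eta m0 with rX |-> (b : nat)%:Z] inp par)).
  by rewrite /step /= h0.
elim: r m J => [|r ih] m J hT hJ hJP hm.
  apply: (@reach_leq _ _ (1 + 179 * B)); first by lia.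
  apply: reach_toss (flip m) _ _.
    apply: reach_imp (body 0 m J false hT hJ hJP hm) => -[|//] c _ [m1 [-> _ h1 h2 h3]].
    by exists m1; split=> //; rewrite h1; lia.
  apply: reach_imp (body 0 m J true hT hJ hJP hm) => -[|//] c _ [m1 [-> _ h1 h2 h3]].
  by exists m1; split=> //; rewrite h1; lia.
apply: (@reach_leq _ _ (1 + (179 * B + r.+1 * (180 * B)))); first by lia.
have next (b : bool) : reach p r.+1 (179 * B + r.+1 * (180 * B))
    (Config pc.+1 [eta m with rX |-> (b : nat)%:Z] inp par) (fun j c =>
    exists m1, [/\ c = Config (pc + 5) m1 inp par,
      m1 rJ = (J * 2 ^ r.+2 + (b * 2 ^ r.+1 + j))%:Z,
      own_le B m1 & forall i, i \notin [:: rX; rJ; rT] -> m1 i = m i]).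
  apply: reach_seq (body r.+1 m J b hT hJ hJP hm) _ => c1 [m1 [-> h1 h2 h3 h4']].
  have hb : (J * 2 + b).+1 * 2 ^ r.+1 <= 2 * P.
    by clear -hJP; apply: leq_trans hJP; rewrite [2 ^ r.+2]expnS; case: b; nia.
  apply: reach_imp (ih m1 _ h1 h2 hb h3) => j c _ [m2 [-> h5 h6 h7]].
  exists m2; split=> //; first by rewrite h5 [2 ^ r.+2]expnS; congr Posz; nia.
  by move=> i hi; rewrite h7 // h4'.
apply: reach_toss (flip m) _ _.
  by apply: reach_imp (next false) => j c _; rewrite mul0n.
by apply: reach_imp (next true) => j c _; rewrite mul1n.
Qed.

End Sampling.

(** * Code generated for single instructions *)

Section Translation.
Local Open Scope nat_scope.
Variables (d' : nat).
Local Notation d := d'.+1.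

(** The quotient of [rM - 1] by [rM + 1] is -1 if [rM] is 0, that is at the end
    of the tape, and 0 otherwise. *)
Definition param_code : seq (instr void) :=
  [:: Arith Div (Reg rY) ($rM) (Cst 2);
      Arith Mul (Reg rZ) ($rY) (Cst 2);
      Arith Sub (Reg rX) ($rM) ($rZ);
      Arith Sub (Reg rZ) ($rM) (Cst 1);
      Arith Add (Reg rU) ($rM) (Cst 1);
      Arith Div (Reg rZ) ($rZ) ($rU);
      Arith Add (Reg rX) ($rX) ($rZ);
      Move (Reg rM) ($rY)].

Definition shift k : seq (instr void) :=
  [seq Move (Reg (tape_reg l)) ($(tape_reg l.+1)) | l <- iota 0 k].

(** The simulated tape never holds more than d + 1 symbols, so a read can shift all of it; the 0
    moved in is what reading past the end returns. *)
Definition read_code : seq (instr void) :=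
  Move (Reg rX) ($(tape_reg 0)) :: shift d ++ [:: Move (Reg (tape_reg d)) (Cst 0)].

Definition draw_init : seq (instr void) :=
  [:: Arith Sub (Reg rT) ($rW) (Cst 1); Move (Reg rJ) (Cst 0)].

(** [lab] gives the addresses of the translated blocks. The offset 11 is the length of [zeros] and
    [draw_init], so the toss loop jumps back to its own start. *)
Definition translate (lab : nat -> nat) (pos : nat) (i : instr (access d)) : seq (instr void) :=
  zeros ++ match i with
  | Move l s => load rX s ++ store l
  | Arith o l s t =>
      load rX s ++ load rZ t ++ Arith o (Reg rX) ($rX) ($rZ) :: store l
  | JumpPos s k => load rX s ++ [:: JumpPos ($rX) (lab k)]
  | JumpZero s k => load rX s ++ [:: JumpZero ($rX) (lab k)]
  | ReadInput l => read_code ++ store l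
  | ReadParam l => param_code ++ store l
  | Flip r => Flip rX :: store (Reg r)
  | Oracle DrawSample => draw_init ++ toss_loop (pos + 11) ++ sample d'
  | Oracle (QueryAt r j) =>
      Move (Reg rX) ($(4 * tnth r ord_max + 1)) :: store (Reg j)
  end.

(** [Flip] and [Oracle] have unit cost whatever registers they name, so these indices need a
    separate bound; elsewhere the cost of the instruction bounds them. *)
Definition instr_consts_le B (i : instr (access d)) :=
  match i with
  | Flip r => bitlen r <= B
  | Oracle (QueryAt r j) => (bitlen (4 * tnth r ord_max + 1) <= B) && (bitlen j <= B)
  | _ => true
  end.

(** Unlike [binary], [bits] represents 0 by an empty tape. *)
Definition bits q : seq bool := if q == 0 then [::] else binary q.

Lemma bitlen_half q : 1 < q -> bitlen q = (bitlen (q %/ 2)).+1.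
Proof.
move=> q1; rewrite /bitlen; congr _.+1.
by rewrite (trunc_log2S q1) divn2.
Qed.

(** Least significant digits come first, so consuming a bit is a division by 2, which lets a single
    number stand for the parameter tape. *)
Lemma bits_cons q : 0 < q -> bits q = odd q :: bits (q %/ 2).
Proof.
move=> q0; rewrite /bits -[q == 0]negbK -lt0n q0 /=.
have [q1|q1] := leqP q 1; first by have -> : q = 1 by lia.
have -> : (q %/ 2 == 0) = false by lia.
rewrite /binary bitlen_half // /mkseq; move: (bitlen (q %/ 2)) => b.
rewrite /= divn1 (iotaDl 1 0) -map_comp; congr cons; apply: eq_map => i /=.
by rewrite add1n expnS divnMA.
Qed.

Lemma run_shift k m :
  (forall l, l < k -> run (shift k) m (tape_reg l) = m (tape_reg l.+1)) /\
  (forall r, (forall l, l < k -> r != tape_reg l) -> run (shift k) m r = m r).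
Proof.
elim: k => [|k [ih1 ih2]]; first by [].
have E r : run (shift k.+1) m r =
    if r == tape_reg k then m (tape_reg k.+1) else run (shift k) m r.
  rewrite /shift -[in iota _ _]addn1 iotaD map_cat run_cat add0n /= -/(shift k).
  by rewrite [run (shift k) m (tape_reg k.+1)]ih2 // => l lk; rewrite /tape_reg; lia.
split=> [l lk|r hr]; rewrite E.
  case: eqP => [kl|kl]; first by have -> : l = k by rewrite /tape_reg in kl; lia.
  by apply: ih1; rewrite /tape_reg in kl; lia.
by rewrite (negbTE (hr k _)) // ih2 // => l lk; apply: hr; lia.
Qed.

End Translation.

(** * The simulation relation and its preservation by each instruction *)

Section Simulation.
Local Open Scope nat_scope.
Variables (d' n s B : nat) (val : nat -> int).
Local Notation d := d'.+1.
Local Notation P := (2 ^ s).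

Record sim (c : config) (m : nat -> int) : Prop := Sim {
  sim_regs : mirrors (regs c) m;
  sim_data : own_data d' n P val m;
  sim_bound : own_bound B m;
  sim_input : size (input c) <= d.+1 /\
    forall l, l <= d -> m (tape_reg l) = nth 0%R (input c) l;
  sim_param : exists q, m rM = q%:Z /\ param c = bits q }.

Hypothesis B_large : 4 * d' + 100 <= B.
Hypothesis B_P : bitlen (2 * P) <= B.
Hypothesis B_point : forall J l, J < 2 * P -> l <= d ->
  bitlen `|nth 0%R (labeled (@label d') (point d' n val J)) l| <= B.

Lemma sim_keeps c c1 m m' : sim c m -> keeps m m' -> mirrors (regs c1) m' ->
  input c1 = input c -> param c1 = param c -> sim c1 m'.
Proof.
move=> [h1 [h2 h3 h4] h5 [h6 h7] [q [h8 h9]]] k h ei ep; split=> //.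
- by split=> [||j jP]; rewrite k // ?h4 // /own /list_reg; lia.
- by move=> r o r38; rewrite k ?h5.
- by rewrite ei; split=> // l ld; rewrite k ?h7 // /own /tape_reg; lia.
- by exists q; rewrite k ?ep.
Qed.

Lemma reach_plain p pos b t m inp par (Q : config -> Prop) : code_at p pos b ->
  all plain b -> run_cost b m <= t -> Q (Config (pos + size b) (run b m) inp par) ->
  reach p 0 t (Config pos m inp par) (fun _ => Q).
Proof.
move=> h1 h2 h3 h4; rewrite -(subnKC h3).
by apply: (reach_run h1 h2); apply: reach_done.
Qed.

Lemma mirrors_frame ms m m' : mirrors ms m ->
  (forall r, ~~ own r -> m' r = m r) -> mirrors ms m'.
Proof.
move=> [h1 h2] h; split=> i; rewrite h ?h1 ?h2 // /own; lia.
Qed.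

Definition store_factor := 12 + 8 * lite_factor store_tail.

Definition read_factor b := lite_factor b + 2 ^ size b * store_factor.

Definition sim_factor :=
  2000 + 100 * store_factor + 2 * read_factor (read_code d') +
  2 * read_factor param_code + sample_factor d'.

Lemma sim_zeros c m : sim c m -> sim c (run zeros m) /\ own_le B (run zeros m).
Proof.
move=> hs; split.
  apply: (sim_keeps hs _ (run_zeros_sim (sim_regs hs))) => // r o r38.
  by rewrite run_zeros o ltnNge r38.
by apply: run_zeros_own; [move=> r o r38; have := sim_bound hs o r38|]; lia.
Qed.

Lemma sim_load c m V x sr : sim c m -> own_le V m -> value_cost (regs c) sr <= V ->
  x < 38 -> own x ->
  [/\ sim c (run (load x sr) m), run (load x sr) m x = value (regs c) sr,
      forall r, r != rA -> r != x -> run (load x sr) m r = m r,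
      run_cost (load x sr) m <= 40 * V & own_le (4 * V) (run (load x sr) m)].
Proof.
move=> hs hm hv x38 ox; have [h1 h2 h3 h4] := load_spec (sim_regs hs) hm hv x38 ox.
split=> //; apply: (sim_keeps hs) => //.
  by move=> r o r38; apply: h2; lia.
apply: mirrors_frame (sim_regs hs) _ => r o; apply: h2; last by apply: contraNneq o => ->.
by move: o; rewrite /own; lia.
Qed.

Lemma sim_store c m V l v : sim c m -> own_le V m -> addr_cost (regs c) l <= V ->
  m rX = v ->
  sim (write (advance c) (addr (regs c) l) v) (run (store l) m) /\
  run_cost (store l) m <= store_factor * V.
Proof.
move=> hs hm hl hv; have [h1 h2 h3] := store_spec (sim_regs hs) hm hl.
by split=> //; apply: (sim_keeps hs h2) => //; rewrite -hv.
Qed.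

Lemma sim_lite c m m' : sim c m -> keeps m m' -> (forall r, ~~ own r -> m' r = m r) ->
  sim c m'.
Proof.
by move=> hs k h; apply: (sim_keeps hs k) => //; apply: mirrors_frame (sim_regs hs) h.
Qed.

(** A simulated step of cost [w] may take time proportional to B^2 w. The second factor B is there
    for sampling, whose loop makes s + 1 <= B rounds of cost O(B). *)
Definition reach_sim r p w (lab : nat -> nat) c0 m inp par (k : nat -> config) :=
  reach p r (sim_factor * (B * B * w)) (Config (lab (pc c0)) m inp par)
    (fun j c' => exists m', c' = Config (lab (pc (k j))) m' inp par /\ sim (k j) m').

Section Step.
Variables (p : program void) (lab : nat -> nat) (c : config) (i : instr (access d)).
Variables (m : nat -> int) (inp : seq int) (par : seq bool).
Hypothesis hs : sim c m.
Hypothesis hc : code_at p (lab (pc c)) (translate lab (lab (pc c)) i).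
Hypothesis hl : lab (pc c).+1 = lab (pc c) + size (translate lab (lab (pc c)) i).
Let w := instr_cost i c.

(** The number 57 is the cost of [zeros], and [B] and [w] are each at most B^2 w. *)
Lemma cost_bound x t : t <= 57 + x * (B + w) -> 57 + 2 * x <= sim_factor ->
  t <= sim_factor * (B * B * w).
Proof.
move=> h1 h2; have w0 : 0 < w by exact: instr_cost_gt0.
have B0 : 0 < B by lia.
have h3 : B <= B * B * w by rewrite -mulnA leq_pmulr // muln_gt0 B0.
have h4 : w <= B * B * w by rewrite leq_pmull // muln_gt0 B0.
move: (B * B * w) h3 h4 => e h3 h4.
apply: leq_trans h1 _; apply: leq_trans (leq_mul h2 (leqnn e)) => {h2}.
have h5 : x * (B + w) <= x * (2 * e) by rewrite leq_mul2l; apply/orP; right; lia.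
by apply: leq_trans (leq_add (leqnn _) h5) _; nia.
Qed.

Lemma step_plain b k : translate lab (lab (pc c)) i = zeros ++ b -> all plain b ->
  pc k = (pc c).+1 -> sim k (run b (run zeros m)) ->
  (exists2 x, run_cost b (run zeros m) <= x * (B + w) & 57 + 2 * x <= sim_factor) ->
  reach_sim 0 p w lab c m inp par (fun=> k).
Proof.
move=> ib pb pck hk [x hx xs].
apply: (reach_plain hc); rewrite ib.
- by rewrite all_cat pb.
- by apply: cost_bound xs; rewrite run_cost_cat zeros_cost leq_add2l.
- by eexists; split; first by rewrite pck hl ib.
Qed.

Let sim1 : sim c (run zeros m). Proof. by case: (sim_zeros hs). Qed.
Let own0 : own_le B (run zeros m). Proof. by case: (sim_zeros hs). Qed.
Let own1 : own_le (B + w) (run zeros m).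
Proof. by apply: own_leq own0; rewrite leq_addr. Qed.

Lemma step_move l sr : i = Move l sr -> reach_sim 0 p w lab c m inp par
  (fun=> write (advance c) (addr (regs c) l) (value (regs c) sr)).
Proof.
move=> iE; have wE : w = instr_cost (Move l sr : instr (access d)) c by rewrite /w iE.
rewrite /= in wE.
have [||//|s2 v2 _ c2 o2] := @sim_load c _ (B + w) rX sr sim1 own1; [lia|by []|].
have [|s3 c3] := sim_store s2 o2 _ v2 (l := l); first by lia.
apply: (@step_plain (load rX sr ++ store l)) => //; first by rewrite iE.
- by rewrite all_cat load_plain store_plain.
- by rewrite run_cat.
exists (40 + 4 * store_factor); last by rewrite /sim_factor; lia.
by rewrite run_cost_cat; apply: leq_trans (leq_add c2 c3) _; lia.
Qed.

Lemma step_arith o l s1 s2 : i = Arith o l s1 s2 -> reach_sim 0 p w lab c m inp par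
  (fun=> write (advance c) (addr (regs c) l)
           (arith_fun o (value (regs c) s1) (value (regs c) s2))).
Proof.
move=> iE; have wE : w = instr_cost (Arith o l s1 s2 : instr (access d)) c by rewrite /w iE.
rewrite /= in wE.
have [||//|t2 v2 _ c2 o2] := @sim_load c _ (B + w) rX s1 sim1 own1; [lia|by []|].
have [||//|t3 v3 f3 c3 o3] := @sim_load c _ _ rZ s2 t2 o2; [lia|by []|].
have v3' := f3 rX isT isT; rewrite v2 in v3'.
pose a := Arith o (Reg rX) ($rX) ($rZ) : instr void.
have [|ca oa] := @lite_exec _ _ a o3.
  by rewrite /= -[bitlen 2]/2 -[bitlen 10]/4; lia.
have sa : sim c (exec a (run (load rZ s2) (run (load rX s1) (run zeros m)))).
  by apply: (sim_lite t3) => r; rewrite /=; case: eqP => // ->.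
have [|s4 c4] := sim_store sa oa _ (erefl _) (l := l); first by lia.
apply: (@step_plain (load rX s1 ++ load rZ s2 ++ a :: store l)) => //; first by rewrite iE.
- by rewrite !all_cat !load_plain -[a :: _]cat1s all_cat store_plain.
- by rewrite !run_cat run_cons; move: s4; rewrite {1}/a /= v3 v3'.
exists (500 + 32 * store_factor); last by rewrite /sim_factor; lia.
rewrite !run_cost_cat run_cost_cons.
by apply: leq_trans (leq_add c2 (leq_add c3 (leq_add ca c4))) _; lia.
Qed.

(** The jump and its test are abstract so that both conditional jumps are covered. *)
Lemma step_jump s1 k jump (test : pred int) :
  translate lab (lab (pc c)) i = zeros ++ load rX s1 ++ [:: jump] ->
  value_cost (regs c) s1 <= w ->
  (forall c1, instr_action no_oracle jump c1 =
     Goto (if test (regs c1 rX) then goto c1 (lab k) else advance c1)) ->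
  (forall c1, instr_cost jump c1 = 3 + bitlen `|regs c1 rX|) ->
  reach_sim 0 p w lab c m inp par
    (fun=> if test (value (regs c) s1) then goto (advance c) k else advance c).
Proof.
move=> iE hw ja jc.
have [||//|t2 v2 _ c2 o2] := @sim_load c _ (B + w) rX s1 sim1 own1; [lia|by []|].
move: hc hl; rewrite iE catA => hc' hl'.
have [h1 /code_at_cons[h2 _]] := code_at_cat hc'.
rewrite /reach_sim; set t := sim_factor * _.
have ct : run_cost (zeros ++ load rX s1) m + (3 + bitlen `|value (regs c) s1|) <= t.
  apply: (@cost_bound 200); last by rewrite /sim_factor; lia.
  rewrite run_cost_cat zeros_cost; have := o2 rX isT; rewrite v2; lia.
rewrite -(subnKC ct) -addnA; apply: (reach_run h1).
  by rewrite all_cat load_plain.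
move: v2 t2; rewrite -!run_cat; move: (run (zeros ++ _) m) => m2 v2 t2.
apply: reach_goto.
  by rewrite /step h2 /= jc ja /= v2.
apply: reach_done; exists m2; split; last first.
  by apply: (sim_keeps t2) => //; case: ifP => _ //; exact: (sim_regs t2).
have {}hl' : lab (pc c).+1 = (lab (pc c) + size (zeros ++ load rX s1)).+1.
  by rewrite hl' size_cat addnA; exact: addn1.
by case: ifP => _; rewrite ?[pc _]/= ?hl'.
Qed.

Lemma step_flip r : i = Flip r -> bitlen r <= B -> reach_sim 1 p w lab c m inp par
  (fun j => write (advance c) r (j : nat)%:Z).
Proof.
move=> iE rB; move: hc hl; rewrite iE /translate => hc' hl'.
have [h1 h2] := code_at_cat hc'.
have [h3 h4] := code_at_cons h2.
rewrite /reach_sim; set t := sim_factor * _.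
have ct : run_cost zeros m + (1 + store_factor * (B + w)) <= t.
  apply: (@cost_bound (1 + store_factor)); last by rewrite /sim_factor; lia.
  rewrite zeros_cost; lia.
rewrite -(subnKC ct) -addnA; apply: (reach_run h1); first by [].
move: (t - _) => t1; rewrite -addnA.
have {}hl' : lab (pc c).+1 = (lab (pc c) + size zeros).+1 + size (store (Reg r)).
  by rewrite hl' size_cat addnA addSnnS.
have branch (b : bool) t' : reach p 0 (store_factor * (B + w) + t')
   (Config (lab (pc c) + size zeros).+1 [eta run zeros m with rX |-> (b : nat)%:Z] inp par)
   (fun _ c' => exists m', c' = Config (lab (pc c).+1) m' inp par /\
      sim (write (advance c) r (b : nat)%:Z) m').
  have s2 : sim c [eta run zeros m with rX |-> (b : nat)%:Z].
    by apply: (sim_lite sim1) => q /=; case: eqP => // ->.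
  have o2 : own_le (B + w) [eta run zeros m with rX |-> (b : nat)%:Z].
    by apply: own_le_write => //; case: b {s2}; rewrite -?[bitlen _]/1; lia.
  have [|s3 c3] := sim_store s2 o2 _ (erefl _) (l := Reg r); first by rewrite /=; lia.
  apply: (reach_plain h4); rewrite ?store_plain //.
    by apply: leq_trans c3 _; rewrite leq_addr.
  by exists (run (store (Reg r)) [eta run zeros m with rX |-> (b : nat)%:Z]); rewrite hl'.
apply: reach_toss; first by rewrite /step h3 /=.
  apply: reach_imp (branch false _) => -[|//] c1 _; exact.
apply: reach_imp (branch true _) => -[|//] c1 _; exact.
Qed.

(** The answer is the parity of the last coordinate, which is kept beside the register holding that
    coordinate; the point itself is not read. *)
Lemma step_query r j : i = Oracle (QueryAt r j) -> instr_consts_le B i ->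
  reach_sim 0 p w lab c m inp par
  (fun=> write (advance c) j (label (\row_(l < d) regs c (tnth r l)) : nat)%:Z).
Proof.
move=> iE; rewrite {1}iE /= => /andP[rB jB].
pose a := Move (Reg rX) ($(4 * tnth r ord_max + 1)) : instr void.
suff [s3 c3] : sim (write (advance c) j (label (\row_(l < d) regs c (tnth r l)) : nat)%:Z)
    (run (a :: store (Reg j)) (run zeros m)) /\
    run_cost (a :: store (Reg j)) (run zeros m) <= (10 + store_factor) * (B + w).
  apply: (@step_plain (a :: store (Reg j))) => //; first by rewrite iE.
  by exists (10 + store_factor); last by rewrite /sim_factor; lia.
move: sim1 own1; move: (run zeros m) => m1 s1 o1.
have hv : m1 (4 * tnth r ord_max + 1) =
    (label (\row_(l < d) regs c (tnth r l)) : nat)%:Z.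
  by rewrite (sim_regs s1).2 /label mxE; lia.
have o2 : own_le (B + w) (exec a m1).
  by apply: own_le_write => //; rewrite /= hv; case: label; rewrite -?[bitlen _]/1; lia.
have s2 : sim c (exec a m1).
  by apply: (sim_lite s1) => q /=; case: eqP => // ->.
have [|s3 c3] := sim_store s2 o2 _ hv (l := Reg j); first by rewrite /=; lia.
split; first by rewrite run_cons.
rewrite run_cost_cons mulnDl; apply: leq_add c3.
by rewrite /cost /= hv (_ : bitlen `|_| = 1) -?[bitlen 2]/2; [lia|case: label].
Qed.

Lemma step_store b c' l v :
  translate lab (lab (pc c)) i = zeros ++ b ++ store l -> all (lite B) b ->
  addr_cost (regs c) l <= w -> pc c' = pc c -> regs c' = regs c ->
  2 * read_factor b <= 2 * read_factor (read_code d') + 2 * read_factor param_code ->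
  (forall m1, sim c m1 -> sim c' (run b m1) /\ run b m1 rX = v) ->
  reach_sim 0 p w lab c m inp par (fun=> write (advance c') (addr (regs c) l) v).
Proof.
move=> iE lb hw pe re hf hb.
have [s2 v2] := hb _ sim1; have [c2 o2] := lite_run own0 lb.
have V2 : 0 < 2 ^ size b by rewrite expn_gt0.
have {}o2 : own_le (2 ^ size b * (B + w)) (run b (run zeros m)).
  by apply: own_leq o2; rewrite leq_mul2l leq_addr orbT.
have [|s3 c3] := sim_store s2 o2 _ v2 (l := l); first by rewrite re; nia.
rewrite re in s3; apply: (@step_plain (b ++ store l)) => //=.
- by rewrite all_cat store_plain (lite_plain lb).
- by rewrite pe.
- by rewrite run_cat.
exists (read_factor b); last by rewrite /sim_factor; lia.
rewrite run_cost_cat /read_factor mulnDl; apply: leq_add.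
  by apply: leq_trans c2 _; rewrite leq_mul2l leq_addr orbT.
by apply: leq_trans c3 _; rewrite mulnCA mulnA.
Qed.

Lemma step_read l : i = ReadInput l -> reach_sim 0 p w lab c m inp par
  (fun=> write (pop_input (advance c)) (addr (regs c) l) (input_symbol c)).
Proof.
move=> iE; have wE : w = instr_cost (ReadInput l : instr (access d)) c by rewrite /w iE.
rewrite /= in wE.
have hb m1 : sim c m1 -> sim (pop_input c) (run (read_code d') m1) /\
    run (read_code d') m1 rX = input_symbol c.
  move=> hs1; have [hr [hW hN hval] hb [hi1 hi2] hp] := hs1.
  have E r : run (read_code d') m1 r = if r == tape_reg d then 0%R else
      run (shift d) [eta m1 with rX |-> m1 (tape_reg 0)] r by rewrite /read_code run_cons run_cat.
  have [sh1 sh2] := run_shift d [eta m1 with rX |-> m1 (tape_reg 0)].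
  have Et l0 : l0 <= d -> run (read_code d') m1 (tape_reg l0) = nth 0%R (behead (input c)) l0.
    move=> ld; rewrite E nth_behead; case: eqP => [e|e].
      (* The tape has at most d + 1 symbols, so after a read its cell [d] is past the end. *)
      have -> : l0 = d by clear -e; rewrite /tape_reg in e; lia.
      by rewrite nth_default.
    have ltd : l0 < d by move: e; rewrite /tape_reg; lia.
    by rewrite sh1 //= (_ : (_ == 2) = false) ?hi2 // /tape_reg; lia.
  have Eo r : (forall l, l <= d -> r != tape_reg l) -> r != rX -> run (read_code d') m1 r = m1 r.
    move=> h /negbTE rX'; rewrite E (negbTE (h _ _)) // sh2 /= ?rX' // => l0 l0d.
    by apply: h; apply: ltnW.
  split; last first.
    rewrite E sh2 /=; last by move=> l0 _; rewrite /tape_reg; lia.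
    rewrite (_ : (2 == tape_reg d) = false); last by rewrite /tape_reg; lia.
    by rewrite hi2 // -nth0.
  split.
  - apply: mirrors_frame hr _ => r; rewrite /own => o; apply: Eo; last by lia.
    by move=> l0 _; rewrite /tape_reg; lia.
  - by split=> [||j jP]; rewrite Eo ?hval // ?/list_reg; try lia;
      move=> l0 ld; rewrite /tape_reg; lia.
  - move=> r o r38; case: (boolP [exists l0 : 'I_d.+1, r == tape_reg l0]).
      move=> /existsP[[l0 ld] /eqP ->]; rewrite (Et l0) //.
      rewrite nth_behead; case: (ltnP l0 d) => l0d; first by rewrite -hi2 //; apply: hb; rewrite /own /tape_reg; lia.
      by rewrite nth_default; [apply: leq_trans B_P|apply: leq_trans hi1 _].
    move=> /existsPn h; rewrite Eo ?hb //; last by lia.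
    by move=> l0 ld; have := h (Ordinal (ld : l0 < d.+1)).
  - by split=> //; rewrite size_behead; lia.
  - by case: hp => q [h1 h2]; exists q; rewrite Eo // => l0 _; rewrite /tape_reg; lia.
apply: (step_store (b := read_code d') (c' := pop_input c)) => //; rewrite ?iE //; try by lia.
have ho l0 : own (tape_reg l0) by rewrite /own /tape_reg; lia.
rewrite /read_code -cat1s !all_cat; apply/and3P; split.
- by rewrite /= !lite_reg // /tape_reg; lia.
- rewrite all_map; apply/allP => l0; rewrite mem_iota /= => ld.
  by rewrite ho !lite_reg // /tape_reg; lia.
- by rewrite /= !lite_reg // /tape_reg; lia.
Qed.

Lemma step_param l : i = ReadParam l -> reach_sim 0 p w lab c m inp par
  (fun=> write (pop_param (advance c)) (addr (regs c) l) (param_symbol c)).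
Proof.
move=> iE; have wE : w = instr_cost (ReadParam l : instr (access d)) c by rewrite /w iE.
rewrite /= in wE.
have hb m1 : sim c m1 -> sim (pop_param c) (run param_code m1) /\
    run param_code m1 rX = param_symbol c.
  move=> hs1; have [hr [hW hN hval] hb [hi1 hi2] [q [hq1 hq2]]] := hs1.
  have qE : (q%:Z %/ 2)%Z = (q %/ 2)%N by rewrite divz_nat.
  have EM : run param_code m1 rM = (q %/ 2)%N by rewrite /= hq1 qE.
  have Eo r : r \notin [:: rX; rY; rZ; rU; rM] -> run param_code m1 r = m1 r.
    rewrite !inE !negb_or => /and5P[/negbTE e1 /negbTE e2 /negbTE e3 /negbTE e4 /negbTE e5].
    by rewrite /= !(e1, e2, e3, e4, e5).
  split; last first.
    rewrite /= hq1 qE /param_symbol hq2; case: (posnP q) => [->//|q0].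
    rewrite bits_cons //= (_ : ((q%:Z - 1) %/ (q%:Z + 1))%Z = 0%R) ?addr0; first by lia.
    by rewrite divz_small //; lia.
  split.
  - apply: mirrors_frame hr _ => r; rewrite /own => o; apply: Eo.
    by rewrite !inE; lia.
  - by split=> [||j jP]; rewrite Eo ?hval // !inE /list_reg; lia.
  - move=> r o r38; case: (r =P rM) => [->|rM'].
      rewrite EM; have := hb rM isT isT; rewrite hq1; apply: leq_trans.
      by apply: bitlen_homo; exact: leq_div.
    by rewrite Eo ?hb // !inE; lia.
  - by split=> // l0 ld; rewrite Eo ?hi2 // !inE /tape_reg; lia.
  - exists (q %/ 2); split=> //=; rewrite hq2; case: (posnP q) => [->//|q0].
    by rewrite bits_cons.
apply: (step_store (b := param_code) (c' := pop_param c)) => //; rewrite ?iE //; try by lia.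
by rewrite /= !lite_reg //; lia.
Qed.

Lemma step_draw : i = Oracle DrawSample -> reach_sim s.+1 p w lab c m inp par
  (fun j => Config (pc c).+1 (regs c) (labeled (@label d') (point d' n val j)) (param c)).
Proof.
move=> iE; move: hc hl; rewrite iE /translate catA => hc' hl'.
have [h1 h2] := code_at_cat hc'; have [h3 h4] := code_at_cat h2.
set b0 := zeros ++ draw_init in hc' hl' h1 h2 h3 h4.
have [hr [hW hN hval] hb [hi1 hi2] [q [hq1 hq2]]] := sim1.
have [m2 [m2E hT hJ hfr]] : exists m2, [/\ run b0 m = m2, m2 rT = (2 ^ s.+1 - 1)%N%:Z,
    m2 rJ = 0%N%:Z & forall r, r \notin [:: rJ; rT] -> m2 r = run zeros m r].
  exists (run b0 m); rewrite run_cat; move: hW; move: (run zeros m) => m1 hW.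
  have s0 : 0 < 2 ^ s by rewrite expn_gt0.
  split=> //=; first by rewrite hW expnS; clear -s0; lia.
  by move=> r; rewrite !inE !negb_or => /andP[/negbTE -> /negbTE ->].
have o2 : own_le B m2.
  move=> r o; case: (boolP (r \in [:: rJ; rT])); last by move=> h; rewrite hfr ?own0.
  rewrite !inE => /orP[/eqP->|/eqP->]; first by rewrite hJ; apply: leq_trans B_P.
  by rewrite hT; apply: leq_trans (bitlen_homo _) B_P; rewrite expnS; lia.
have c0 : run_cost b0 m <= 57 + 56 * B.
  rewrite run_cost_cat zeros_cost leq_add2l.
  have [|c0 _] := @lite_run _ _ draw_init own0; first by rewrite /= !lite_reg //; lia.
  exact: c0.
have hJP : 1 * 2 ^ s.+1 <= 2 * P by rewrite mul1n expnS.
have loop := toss_loop_spec B_large B_P inp par h3 hT hJ hJP o2.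
(* The number of rounds of the toss loop is itself bounded by a bit length, hence by [B]. *)
have sB : s.+1 <= B.
  by apply: leq_trans B_P; rewrite -expnS ltnW // ltnNge bitlenP // -leqNgt.
rewrite /reach_sim; set t := sim_factor * _.
have ct : run_cost b0 m + (s.+1 * (180 * B) + sample_factor d' * B) <= t.
  have w1 : w = 1 by rewrite /w iE.
  rewrite /t w1 muln1; have B1 : B <= B * B by nia.
  have h5 : s.+1 * (180 * B) <= 180 * (B * B) by nia.
  apply: (@leq_trans ((113 + 180 + sample_factor d') * (B * B))).
    apply: leq_trans (leq_add c0 (leq_add h5 (leqnn _))) _.
    by move: (sample_factor d') => e; nia.
  by rewrite leq_mul2r /sim_factor; apply/orP; right; lia.
rewrite -(subnKC ct) -addnA; apply: (reach_run h1); first by [].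
rewrite m2E; apply: reach_leq (leq_addr _ _) _.
apply: (reach_after loop) => j c1 js [m3 [-> hJ3 o3 hfr3]].
rewrite mul0n add0n in hJ3.
have hfr4 r : r \notin [:: rX; rJ; rT] -> m3 r = run zeros m r.
  move=> h; rewrite hfr3 // hfr //.
  by move: h; rewrite !inE !negb_or => /and3P[_ -> ->].
have d3 : own_data d' n P val m3.
  by split=> [||j0 jP]; rewrite hfr4 ?hval // !inE /list_reg; lia.
have jP : j < 2 * P by rewrite -expnS.
have [sp1 sp2] := sample_spec d3 jP hJ3.
apply: (reach_plain h4).
- exact: sample_plain.
- exact: (sample_cost B_large jP hJ3 o3).
exists (run (sample d') m3); split.
  by rewrite [pc _]/= hl' size_cat [size (toss_loop _ ++ _)]size_cat !addnA.
have keep r : ~~ own r \/ [/\ own r, 38 <= r & forall l, l <= d -> r != tape_reg l] ->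
    run (sample d') m3 r = run zeros m r.
  by move=> h; rewrite sp2 // hfr4 // !inE; case: h; [rewrite /own|case]; lia.
move: (run (sample d') m3) sp1 keep => m4 t1 keep; split=> /=.
- by apply: mirrors_frame hr _ => r o; apply: keep; left.
- split=> [||j0 j0P]; rewrite keep ?hval //; right; split=> //; rewrite /own /list_reg /tape_reg; lia.
- move=> r o r38; case: (boolP [exists l0 : 'I_d.+1, r == tape_reg l0]).
    by move=> /existsP[[l0 ld] /eqP ->]; rewrite (t1 l0) //; apply: B_point.
  move=> /existsPn h; rewrite keep ?hb //; right; split=> // l0 ld.
  by have := h (Ordinal (ld : l0 < d.+1)).
- by rewrite size_labeled; split=> // l0 ld; rewrite t1.
- by exists q; split=> //; rewrite keep //; right; split=> // l0 ld; rewrite /tape_reg; lia.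
Qed.

End Step.

End Simulation.

(** * Simulating a program *)

Section Assembly.
Local Open Scope nat_scope.
Variable d' : nat.
Local Notation d := d'.+1.

(** The length of a block depends neither on the labels nor on its position, so the jump targets can
    be computed before the code is generated. *)
Definition block_size (i : instr (access d)) := size (translate (fun=> 0) 0 i).

Lemma size_translate lab pos i : size (translate lab pos i) = block_size i.
Proof. by rewrite /block_size; case: i => // -[]. Qed.

Definition label_of (pos : nat) (p : program (access d)) (k : nat) :=
  pos + sumn [seq block_size i | i <- take k p].

Fixpoint translate_prog lab pos (p : program (access d)) : program void :=
  if p is i :: p' then translate lab pos i ++ translate_prog lab (pos + block_size i) p'
  else [::].

Lemma translate_prog_cons lab pos i p : translate_prog lab pos (i :: p) =
  translate lab pos i ++ translate_prog lab (pos + block_size i) p.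
Proof. by []. Qed.

Lemma size_translate_prog lab pos p :
  size (translate_prog lab pos p) = sumn [seq block_size i | i <- p].
Proof.
elim: p pos => // i p ih pos.
by rewrite translate_prog_cons size_cat size_translate ih.
Qed.

Lemma onth_take_sumn (T : Type) (g : T -> nat) (p : seq T) k i : onth p k = Some i ->
  sumn [seq g j | j <- take k.+1 p] = sumn [seq g j | j <- take k p] + g i.
Proof.
elim: p k => [|j p ih] [|k] //=; first by case=> ->; rewrite take0 /= addn0.
by move=> /ih /= ->; rewrite addnA.
Qed.

Lemma code_at_translate P lab pos p k i :
  code_at P pos (translate_prog lab pos p) -> onth p k = Some i ->
  code_at P (label_of pos p k) (translate lab (label_of pos p k) i).
Proof.
rewrite /label_of; elim: p k pos => [|j p ih] [|k] pos //; rewrite translate_prog_cons => /code_at_cat[h1 h2].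
  by case=> <-; rewrite take0 addn0.
rewrite size_translate in h2; move=> /(ih _ _ h2).
by rewrite -addnA.
Qed.

End Assembly.

(** An instruction pays for the lengths of the values it reads, so bit lengths grow by at most its
    cost. This bounds the output registers, which the closing computation reads. *)
Lemma step_bound (d' : nat) p c w a (R : realType) (D : 'rV[int]_d'.+1 -> R) V c1 :
  step (access_oracle (@label d')) p c = Some (w, a) -> successor D a c1 ->
  (forall r, bitlen `|regs c r| <= V)%N ->
  forall r, (bitlen `|regs c1 r| <= V + w)%N.
Proof.
move=> st su hV.
have V0 : (0 < V)%N by apply: leq_trans (hV 0%N).
have hw v j (r : nat) (c2 : config) : (forall r, bitlen `|regs c2 r| <= V)%N ->
    (bitlen `|v| <= V + w)%N -> (bitlen `|regs (write c2 j v) r| <= V + w)%N.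
  by move=> h1 h2 /=; case: eqP => _ //; apply: leq_trans (h1 r) (leq_addr _ _).
have hb (b : bool) : (bitlen `|(b : nat)%:Z| <= V + w)%N.
  by case: b; rewrite -?[bitlen _]/1%N; lia.
have hvc s : (bitlen `|value (regs c) s| <= value_cost (regs c) s)%N.
  by case: s => //= l; rewrite leq_addl.
move: st; rewrite /step; case: onth => //= i [wE aE].
have w0 : (0 < w)%N by rewrite -wE instr_cost_gt0.
move=> r; move: su; rewrite -aE; case: i wE aE => [l s|o l s t|s k|s k|l|l|r0|[|t j]] /= wE aE.
- by move=> ->; apply: hw => //; have := hvc s; lia.
- move=> ->; apply: hw => //; apply: leq_trans (bitlen_arith _ _ _) _.
  by have := hvc s; have := hvc t; lia.
- by move=> ->; case: ifP => _ /=; apply: leq_trans (hV r) (leq_addr _ _).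
- by move=> ->; case: ifP => _ /=; apply: leq_trans (hV r) (leq_addr _ _).
- by move=> ->; apply: hw => //; lia.
- move=> ->; apply: hw => //; rewrite /param_symbol; case: (param c) => [|b _]; last exact: hb.
  by rewrite -[bitlen _]/1%N; lia.
- by move=> [b _ <-]; apply: hw.
- by move=> [x _ <-] /=; apply: leq_trans (hV r) (leq_addr _ _).
- by move=> ->; apply: hw.
Qed.

Section Simulate.
Variables (R : realType) (d' n s B : nat) (val : nat -> int).
Local Notation d := d'.+1.
Variables (D : 'rV[int]_d -> R) (p : program (access d)) (base : nat).
Variables (P' : program void) (E E' : set (nat -> int)) (end_cost : nat -> nat).
Local Notation lab := (label_of base p).
Local Notation f := (@label d').
Local Notation sim := (sim d' n s B val).

Hypothesis D_ge0 : forall x, 0 <= D x.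
Hypothesis D_avg : forall F : 'rV[int]_d -> \bar R, (forall x, 0 <= F x)%E ->
  (\esum_(x in [set: 'rV[int]_d]) ((D x)%:E * F x) = avg s.+1 (fun j => F (point d' n val j)))%E.
Hypothesis D_point : forall j, (j < 2 ^ s.+1)%N -> 0 < D (point d' n val j).
Hypothesis B_large : (4 * d' + 100 <= B)%N.
Hypothesis B_P : (bitlen (2 * 2 ^ s) <= B)%N.
Hypothesis B_point : forall J l, (J < 2 * 2 ^ s)%N -> (l <= d)%N ->
  (bitlen `|nth 0%R (labeled f (point d' n val J)) l| <= B)%N.
Hypothesis B_consts : forall k i, onth p k = Some i -> instr_consts_le B i.
Hypothesis P'_code : code_at P' base (translate_prog lab base p).
Hypothesis end_mono : {homo end_cost : a b / (a <= b)%N}.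
Hypothesis end_good : forall c m inp par V, sim c m ->
  (forall r, bitlen `|regs c r| <= V)%N ->
  good P' E' (end_cost V) (\1_E (regs c) : R)%:E (Config (lab (size p)) m inp par).

(** Induction on the halting derivation. The budget does not depend on [k], so the estimate passes
    to the supremum that defines [prob]. *)
Lemma simulate t c : halts_within (access_oracle f) D p t c ->
  forall m inp par V k, sim c m -> (forall r, bitlen `|regs c r| <= V)%N ->
  good P' E' (sim_factor d' * (B * B * t) + end_cost (V + t))
    (prob_in_steps (access_oracle f) D p E k c) (Config (lab (pc c)) m inp par).
Proof.
elim=> {t c} [t c st|t c w a st wt _ ih] m inp par V k hs hV.
  rewrite prob_in_steps_halted //.
  have -> : lab (pc c) = lab (size p).
    rewrite /label_of take_size take_oversize //.
    by move: st; rewrite /step; case: (ltnP (pc c) (size p)) => // h; rewrite onthE (nth_map (ReadInput (Reg 0))).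
  apply: good_leq (end_good inp par hs hV) => //.
  by apply: leq_trans (leq_addl _ _); apply: end_mono; rewrite leq_addr.
suff main : forall k, good P' E' (sim_factor d' * (B * B * t) + end_cost (V + t))
    (prob_in_steps (access_oracle f) D p E k.+1 c) (Config (lab (pc c)) m inp par).
  by apply: good_leq (main k) => //; apply: prob_in_steps_homo.
move=> {}k; have [i hi [wE aE]] : exists2 i, onth p (pc c) = Some i &
    w = instr_cost i c /\ a = instr_action (access_oracle f) i c.
  by move: st; rewrite /step; case: onth => //= i [<- <-]; exists i.
have hc := code_at_translate P'_code hi.
have hl : lab (pc c).+1 = (lab (pc c) + size (translate lab (lab (pc c)) i))%N.
  by rewrite size_translate /label_of (onth_take_sumn _ hi) addnA.
(* The bound on the registers grows by [w] while the remaining time shrinks by [w], so the cost of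
   the closing computation is unchanged. *)
have tE : (sim_factor d' * (B * B * t) + end_cost (V + t) =
   sim_factor d' * (B * B * w) + (sim_factor d' * (B * B * (t - w)) + end_cost (V + w + (t - w))))%N.
  have e1 : (B * B * t = B * B * w + B * B * (t - w))%N by rewrite -mulnDr subnKC.
  have e2 : (V + w + (t - w) = V + t)%N by rewrite -addnA subnKC.
  by move: (sim_factor d') => K; rewrite e1 e2 mulnDr addnA.
rewrite tE /= st.
have hV' c1 : successor D a c1 -> forall r, (bitlen `|regs c1 r| <= V + w)%N.
  by move=> su; exact: step_bound st su hV.
have go c1 : successor D a c1 -> forall m1 inp par, sim c1 m1 ->
    good P' E' (sim_factor d' * (B * B * (t - w)) + end_cost (V + w + (t - w)))
     (prob_in_steps (access_oracle f) D p E k c1) (Config (lab (pc c1)) m1 inp par).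
  by move=> su m1 inp1 par1 s1; apply: ih => //; exact: hV'.
have goto_case c1 : a = Goto c1 -> reach_sim d' n s B val 0 P' w lab c m inp par (fun=> c1) ->
  good P' E' (sim_factor d' * (B * B * w) + (sim_factor d' * (B * B * (t - w)) + end_cost (V + w + (t - w))))
   (prob_in_steps (access_oracle f) D p E k c1) (Config (lab (pc c)) m inp par).
  move=> ac h; apply: (reach_good (V := fun=> prob_in_steps (access_oracle f) D p E k c1) h).
  by move=> j _ _ [m1 [-> s1]]; apply: go => //; rewrite ac.
clear tE ih wt; subst a w.
case: i hi st hc hl hV' go goto_case =>
  [l sr|o l s1 s2|s1 k1|s1 k1|l|l|r0|[|tt j]] hi st hc hl hV' go goto_case.
- by apply: goto_case => //; apply: (step_move B_large B_P inp par hs hc hl).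
- by apply: goto_case => //; apply: (step_arith B_large B_P inp par hs hc hl).
- apply: goto_case => //; apply: (step_jump B_large B_P inp par hs hc hl (test := fun x : int => 0 < x)
    (jump := JumpPos ($rX) (lab k1))) => //=.
- apply: goto_case => //; apply: (step_jump B_large B_P inp par hs hc hl (test := fun x : int => x == 0)
    (jump := JumpZero ($rX) (lab k1))) => //=.
- by apply: goto_case => //; apply: (step_read B_large B_P inp par hs hc hl).
- by apply: goto_case => //; apply: (step_param B_large B_P inp par hs hc hl).
- have h := step_flip B_large B_P inp par hs hc hl (erefl _) (B_consts hi).
  apply: (reach_good (V := fun j => prob_in_steps (access_oracle f) D p E k (write (advance c) r0 (j : nat)%:Z)) h).
  move=> j _ j2 [m1 [-> s1]]; apply: go => //=.
  by case: j j2 s1 => [|[|//]] _ _; [exists false|exists true].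
- have h := step_draw B_large B_P B_point inp par hs hc hl (erefl _).
  pose F x := prob_in_steps (access_oracle f) D p E k
    (Config (pc c).+1 (regs c) (labeled f x) (param c)).
  have F0 x : (0 <= F x)%E by exact: prob_in_steps_ge0.
  (* The expectation over the sample becomes the mean over [s.+1] tosses. *)
  rewrite -[X in good _ _ _ X _]/(\esum_(x in [set: 'rV[int]_d]) ((D x)%:E * F x)%E) (D_avg F0).
  apply: (reach_good h) => j _ j2 [m1 [-> s1]]; apply: go => //=.
  by exists (point d' n val j) => //=; exact: D_point.
- by apply: goto_case => //; apply: (step_query B_large B_P inp par hs hc hl (erefl _) (B_consts hi)).
Qed.

End Simulate.

(** * The reduction *)

Section Reduction.
Local Open Scope nat_scope.
Variable d' : nat.
Local Notation d := d'.+1.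

(** Jumps back to its own start, at address 3, until [rW] reaches the number [rP] of list
    elements. *)
Definition doubling : seq (instr void) :=
  [:: Arith Add (Reg rW) ($rW) ($rW); Arith Sub (Reg rX) ($rP) ($rW); JumpPos ($rX) 3].

Definition prelude1 : seq (instr void) :=
  [:: Arith Mul (Reg rP) ($rN) (Cst d.+1); Move (Reg rW) (Cst 1)].

Definition prelude2 : seq (instr void) :=
  Move (Reg rQ) (Cst d) ::
  nseq (2 * d.+1) (Arith Mul (Reg rQ) ($rQ) ($rN)) ++ [:: Move (Reg rJ) (Cst 0)].

(** The first two instructions compute the indicator of j >= N by the division trick. Past the lists
    the tape returns 0, so the same code stores the padding value Q + j. *)
Definition fill_body : seq (instr void) :=
  [:: Arith Div (Reg rY) ($rJ) ($rP);
      Arith Div (Reg rY) ($rY) ($rY);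
      Arith Add (Reg rZ) ($rQ) ($rJ);
      Arith Mul (Reg rZ) ($rZ) ($rY);
      Arith Add (Reg rX) ($rX) ($rZ);
      Arith Mul (Reg rA) ($rJ) (Cst 4);
      Arith Add (Reg rA) ($rA) (Cst (list_reg d' 0));
      Move (Ind rA) ($rX);
      Arith Add (Reg rJ) ($rJ) (Cst 1);
      Arith Sub (Reg rY) ($rW) ($rJ)].

Definition fill pos : seq (instr void) :=
  ReadInput (Reg rX) :: fill_body ++ [:: JumpPos ($rY) pos].

Definition prelude3 : seq (instr void) :=
  [:: Arith Mul (Reg rM) ($rW) (Cst 8); Arith Mul (Reg rW) ($rW) (Cst 2)].

Definition fill_pos := 6 + size prelude2.

Definition prelude : seq (instr void) :=
  ReadInput (Reg rN) :: prelude1 ++ doubling ++ prelude2 ++ fill fill_pos ++ prelude3.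

Definition decide : seq (instr void) :=
  [:: Arith Sub (Reg rZ) ($rW) (Cst (2 * d + 1)%N);
      Arith Mul (Reg rZ) ($rZ) ($rU);
      Arith Mul (Reg rA) ($rW) (Cst 2);
      Arith Mul (Reg rA) ($rA) ($rX);
      Arith Sub (Reg rZ) ($rZ) ($rA);
      Arith Mul (Reg rZ) ($rZ) ($rU);
      Arith Div (Reg rY) ($rU) ($rU);
      Arith Sub (Reg rY) (Cst 1) ($rY);
      Arith Add (Reg rZ) ($rZ) ($rY);
      Move (Reg 0) (Cst 1)].

Definition answer : seq (instr void) :=
  zeros ++ [:: Move (Reg rX) ($0); Move (Reg rU) ($4)] ++ decide.

(** The answer 1 is already in place: a positive [rZ] jumps past the end of the program, which
    halts, and otherwise the answer is overwritten by 0. *)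
Definition postlude pos : seq (instr void) :=
  answer ++ [:: JumpPos ($rZ) (pos + size answer + 2); Move (Reg 0) (Cst 0)].

Definition reduction (p : program (access d)) : program void :=
  prelude ++ translate_prog (label_of (size prelude) p) (size prelude) p ++
  postlude (label_of (size prelude) p (size p)).

Lemma reduction_code p : code_at (reduction p) (size prelude)
  (translate_prog (label_of (size prelude) p) (size prelude) p).
Proof. by exists prelude, (postlude (label_of (size prelude) p (size p))). Qed.

Lemma reduction_postlude p :
  code_at (reduction p) (label_of (size prelude) p (size p))
    (postlude (label_of (size prelude) p (size p))) /\
  size (reduction p) = label_of (size prelude) p (size p) + size answer + 2.
Proof.
have hs : size (prelude ++ translate_prog (label_of (size prelude) p) (size prelude) p) =
    label_of (size prelude) p (size p).
  by rewrite size_cat size_translate_prog /label_of take_size.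
split; first by eexists; exists [::]; split; last exact: hs; rewrite cats0 -catA.
by rewrite /reduction catA size_cat hs size_cat addnA.
Qed.

(** Up to the factor [y ^ 2], this compares [x / y] with the midpoint
    (W - 2d - 1) / (2W) between the two cases; the last summand is 1 if [y] is 0,
    when the output [x / y] is 0, and 0 otherwise. *)
Definition decision (W x y : int) : int :=
  ((W - (2 * d + 1)%N%:Z) * y - W * 2 * x) * y + (1 - (y %/ y)%Z).

Definition end_factor := 100 + 2 * lite_factor decide.

(** * Turning the approximation into an answer *)

Section End.
Variables (R : realType) (n s B : nat) (val : nat -> int) (p : program (access d)).
Variables (E : set (nat -> int)) (yes : Prop).
Local Notation W := (2 * 2 ^ s)%N.
Hypothesis B_large : 4 * d' + 100 <= B.
Hypothesis B_P : bitlen W <= B.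
Hypothesis E_decides : forall r, E r -> (0 < decision W (r 0%N) (r 1%N))%R <-> yes.

(** If the simulated registers lie outside [E], the claimed probability is 0 and any answer will
    do. *)
Lemma end_good c m inp par V : sim d' n s B val c m ->
  (forall r, bitlen `|regs c r| <= V) ->
  good (reduction p) [set m : nat -> int | m 0 <> 0%R <-> yes]
    (end_factor * (B + V)) (\1_E (regs c) : R)%:E
    (Config (label_of (size prelude) p (size p)) m inp par).
Proof.
move=> hs hV; have [hc hsz] := reduction_postlude p.
set pos := label_of _ _ _ in hc hsz *.
have [h1 /code_at_cons[h2 /code_at_cons[h3 _]]] := code_at_cat hc.
have [hs1 own1] := sim_zeros B_large B_P hs.
have [hW _ _] := sim_data hs1.
have m0 : run zeros m 0 = regs c 0 by rewrite -((sim_regs hs1).1 0).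
have m4 : run zeros m 4 = regs c 1 by rewrite -((sim_regs hs1).1 1).
have hV0 := hV 0; have hV1 := hV 1.
pose b0 : seq (instr void) := [:: Move (Reg rX) ($0); Move (Reg rU) ($4)].
have [m2 [m2E mX mU mW o2]] : exists m2, [/\ run b0 (run zeros m) = m2,
    m2 rX = regs c 0, m2 rU = regs c 1, m2 rW = W%:Z & own_le (B + V) m2].
  exists (run b0 (run zeros m)); move: (run zeros m) own1 m0 m4 hW => m1 o1 m0 m4 hW.
  split=> //=.
  have o1' : own_le (B + V) m1 by apply: own_leq o1; rewrite leq_addr.
  apply: own_le_write; last by rewrite /= m4 (leq_trans hV1) ?leq_addl.
  by apply: own_le_write; last by rewrite m0 (leq_trans hV0) ?leq_addl.
have c1 : run_cost b0 (run zeros m) <= 20 + 2 * V.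
  clear m2E; move: (run zeros m) m0 m4 => m1 m0 m4; rewrite /= /cost /= m0 m4.
  by rewrite -[bitlen 2]/2 -[bitlen 18]/5 -[bitlen 4]/3 -[bitlen 0]/1; lia.
have ld : all (lite (B + V)) decide by rewrite /= !lite_reg //; lia.
have [c2 o3] := lite_run o2 ld.
have [m3 [m3E mZ m30]] : exists m3, [/\ run decide m2 = m3,
    m3 rZ = decision W (regs c 0) (regs c 1) & m3 0 = 1%R].
  by exists (run decide m2); split=> //=; rewrite mX mU mW.
have runE : run answer m = m3.
  by rewrite /answer run_cat run_cat m2E m3E.
have oZ : bitlen `|m3 rZ| <= 2 ^ size decide * (B + V) by rewrite -m3E; exact: o3.
have costE : run_cost answer m + ((5 + bitlen `|m3 rZ|) + 3) <= end_factor * (B + V).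
  rewrite /answer !run_cost_cat zeros_cost m2E -/b0.
  have h4 : 2 ^ size decide <= lite_factor decide by rewrite /lite_factor leq_pmull.
  apply: leq_trans (leq_add (leq_add (leqnn _) (leq_add c1 c2)) (leq_add (leq_add (leqnn 5) oZ) (leqnn 3))) _.
  rewrite -[7 * _ * _]/(lite_factor decide) /end_factor.
  have h5 : 2 ^ size decide * (B + V) <= lite_factor decide * (B + V) by rewrite leq_mul2r h4 orbT.
  by move: (lite_factor _) (2 ^ _) h4 h5 => e1 e2 h4 h5; nia.
clear c1 c2 o3 oZ ld o2 m2E.
pose out : int := if (0 < m3 rZ)%R then 1%R else 0%R.
have run_end : reach (reduction p) 0 (end_factor * (B + V)) (Config pos m inp par)
    (fun _ c1 => step no_oracle (reduction p) c1 = None /\ regs c1 0 = out).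
  rewrite -(subnKC costE) -addnA; apply: (reach_run h1); first by [].
  have halt m4' : step no_oracle (reduction p) (Config (pos + size answer + 2) m4' inp par) = None.
    by rewrite /step [pc _]/= onth_default ?hsz.
  rewrite runE -addnA; apply: reach_goto.
    by rewrite /step [onth _ _]h2.
  rewrite /out; case: ifP => hZ /=.
    by apply: reach_done; split; [exact: halt|exact: m30].
  rewrite -addnA; apply: reach_goto; first by rewrite /step [onth _ _]h3.
  apply: reach_done; split=> //.
  by rewrite /advance /goto /write /= -addn2; exact: halt.
rewrite -[end_factor * _]addn0.
apply: (reach_good (V := fun=> (\1_E (regs c) : R)%:E) run_end) => j c1 _ [hn ho].
split; first exact: halts_now.
rewrite prob_in_steps_halted // lee_fin !indicE ler_nat.
case: (boolP (_ \in E)) => // /set_mem /E_decides hE.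
rewrite mem_set //= ho /out mZ -hE; case: ifP => h; split=> //.
Qed.

End End.

(** * Building the instance in memory *)

Section Prelude.
Variables (n s B : nat) (L : seq int) (P' : program void).
Local Notation N := (d.+1 * n).
Local Notation Q := (d * n ^ (2 * d.+1)).

(** The padding values exceed any sum of [d] list elements. *)
Definition pad_val (j : nat) : int := (nth 0 L j + (if (N <= j)%N then (Q + j)%N%:Z else 0))%R.

Hypothesis n0 : 0 < n.
Hypothesis sE : s = up_log 2 N.
Hypothesis sL : size L = N.
Hypothesis B_large : 4 * d' + 100 <= B.
Hypothesis B_s : bitlen (8 * 2 ^ s) <= B.
Hypothesis B_Q : bitlen (Q + 2 ^ s) <= B.
Hypothesis B_reg : bitlen (list_reg d' (2 ^ s)) <= B.
Hypothesis B_L : forall j, bitlen `|(nth 0 L j)%R| <= B.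
Hypothesis B_val : forall j, j < 2 ^ s -> bitlen `|pad_val j| <= B.
Hypothesis P'_code : code_at P' 0 prelude.

Lemma N_le_P : N <= 2 ^ s.
Proof. by rewrite sE; apply: up_logP. Qed.

Lemma P_le_N : 2 ^ s <= 2 * N.
Proof.
have N1 : 1 < N by nia.
by have /andP[h _] := @up_log_bounds 2 N isT N1; rewrite sE -(prednK (_ : 0 < up_log 2 N)) ?up_log_gt0 // expnS; lia.
Qed.

Definition doubling_inv a (m : nat -> int) :=
  [/\ m rW = (2 ^ a)%N%:Z, m rP = N%:Z, m rN = n%:Z, own_le B m &
      forall r, r \notin [:: rX; rW; rP; rN] -> m r = 0%R].

Lemma bitlen_P k : k <= 2 ^ s -> bitlen k <= B.
Proof. by move=> h; apply: leq_trans (bitlen_homo _) B_s; lia. Qed.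

Lemma doubling_spec k a m inp par : code_at P' 3 doubling -> a + k.+1 = s ->
  doubling_inv a m ->
  reach P' 0 (k.+1 * (100 * B)) (Config 3 m inp par)
    (fun _ c => exists m1, c = Config 6 m1 inp par /\ doubling_inv s m1).
Proof.
move=> hc; have [h1 /code_at_cons[h2 _]] := @code_at_cat P' 3 [:: _; _] [:: _] hc.
set b := [:: Arith Add (Reg rW) ($rW) ($rW); Arith Sub (Reg rX) ($rP) ($rW)] in h1 h2.
have body a0 m0 : a0 < s -> doubling_inv a0 m0 ->
    reach P' 0 (100 * B) (Config 3 m0 inp par) (fun _ c =>
      exists m1, c = Config (if a0.+1 < s then 3 else 6) m1 inp par /\ doubling_inv a0.+1 m1).
  move=> as0 [hW hP hN ho hfr].
  have W1 : 2 ^ a0.+1 <= 2 ^ s by rewrite leq_exp2l.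
  have NP := N_le_P.
  have [m1 [m1E hW1 hX1 hfr1]] : exists m1, [/\ run b m0 = m1, m1 rW = (2 ^ a0.+1)%N%:Z,
      m1 rX = (N%:Z - (2 ^ a0.+1)%N%:Z)%R & forall r, r \notin [:: rX; rW] -> m1 r = m0 r].
    have e : ((2 ^ a0)%N%:Z + (2 ^ a0)%N%:Z)%R = (2 ^ a0.+1)%N%:Z by rewrite expnS; lia.
    exists (run b m0); split=> //=; rewrite ?hW ?hP ?e // => r.
    by rewrite !inE negb_or => /andP[/negbTE -> /negbTE ->].
  have ld : all (lite B) b by rewrite /= !lite_reg //; lia.
  have [c1 _] := lite_run ho ld.
  have bX : bitlen `|m1 rX| <= B by rewrite hX1; apply: bitlen_P; lia.
  have cE : run_cost b m0 + (3 + bitlen `|m1 rX|) <= 100 * B.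
    by apply: leq_trans (leq_add c1 (leq_add (leqnn 3) bX)) _; rewrite /=; lia.
  rewrite -(subnKC cE) -addnA; apply: (reach_run h1); first by [].
  rewrite m1E; apply: reach_goto; first by rewrite /step [onth _ _]h2.
  apply: reach_done; exists m1; split.
    (* The loop continues exactly while 2^(a0+1) < N, which by minimality of [up_log] means a0 + 1 <
       s. *)
    have -> : (0 < value m1 ($rX))%R = (a0.+1 < s).
      rewrite [value _ _]hX1 subr_gt0 ltz_nat sE ltnNge [in RHS]ltnNge.
      congr (~~ _); apply/idP/idP => h; first exact: up_log_min.
      apply: (@leq_trans (2 ^ up_log 2 N)); first exact: up_logP.
      by rewrite leq_exp2l.
    by case: ifP.
  split=> //; rewrite ?hfr1 //.
    move=> r o; case: (boolP (r \in [:: rX; rW])); last by move=> h; rewrite hfr1 ?ho.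
    rewrite !inE => /orP[/eqP->|/eqP->] //; rewrite hW1; exact: bitlen_P.
  move=> r h; rewrite hfr1 ?hfr //; move: h; rewrite !inE !negb_or.
  by move=> /and4P[-> -> _ _].
elim: k a m => [|k ih] a m ak hi.
  apply: (@reach_leq _ _ (100 * B)); first by lia.
  apply: reach_imp (body a m _ hi); last by lia.
  move=> j c _ [m1 [-> h]]; exists m1; have e : a.+1 = s by lia.
  by rewrite e ltnn; split=> //; rewrite -e.
apply: (@reach_leq _ _ (100 * B + k.+1 * (100 * B))); first by lia.
apply: reach_seq (body a m _ hi) _; first by lia.
move=> c1 [m1 [-> h]]; have -> : a.+1 < s by lia.
by apply: ih h; lia.
Qed.

(** The last line keeps the simulated registers and tape in the initial state that [sim] requires
    when the simulation begins. *)
Definition fill_inv j (m : nat -> int) :=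
  [/\ [/\ m rW = (2 ^ s)%N%:Z, m rP = N%:Z, m rN = n%:Z & m rQ = Q%:Z],
      m rJ = j%:Z, own_le B m, forall i, i < j -> m (list_reg d' i) = pad_val i &
      (forall r, ~~ own r -> m r = 0%R) /\ forall l, l <= d -> m (tape_reg l) = 0%R].

Definition fill_factor := lite_factor fill_body + 9.

Lemma lite_fill : all (lite B) fill_body.
Proof. by rewrite /= !lite_reg // /list_reg; lia. Qed.

Lemma fill_spec pos k j m par : code_at P' pos (fill pos) -> j + k.+1 = 2 ^ s ->
  fill_inv j m ->
  reach P' 0 (k.+1 * (fill_factor * B)) (Config pos m (drop j L) par)
    (fun _ c => exists m1 inp, c = Config (pos + 12) m1 inp par /\ fill_inv (2 ^ s) m1).
Proof.
move=> hc; have [h0 hc1] := code_at_cons hc.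
have [h1 /code_at_cons[h2 _]] := code_at_cat hc1.
have body j0 m0 : j0 < 2 ^ s -> fill_inv j0 m0 ->
    reach P' 0 (fill_factor * B) (Config pos m0 (drop j0 L) par) (fun _ c => exists m1,
      c = Config (if j0.+1 < 2 ^ s then pos else pos + 12) m1 (drop j0.+1 L) par /\
      fill_inv j0.+1 m1).
  move=> js [[hW hP hN hQ] hJ ho hval [hno ht]].
  have NP := N_le_P; have PN := P_le_N.
  set x := input_symbol (Config pos m0 (drop j0 L) par).
  have xE : x = nth 0%R L j0 by rewrite /x /input_symbol /= -nth0 nth_drop addn0.
  pose y : nat := N <= j0.
  have [m1 [m1E hfr]] : exists m1, run fill_body [eta m0 with rX |-> x] = m1 /\
     forall r, m1 r = if r == rY then ((2 ^ s)%N%:Z - j0.+1%:Z)%R else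
       if r == rJ then j0.+1%:Z else if r == list_reg d' j0 then pad_val j0 else
       if r == rA then (list_reg d' j0)%:Z else if r == rX then pad_val j0 else
       if r == rZ then ((Q + j0) * y)%N%:Z else m0 r.
    exists (run fill_body [eta m0 with rX |-> x]); split=> // r.
    have e1 : ((j0%:Z %/ N%:Z)%Z %/ (j0%:Z %/ N%:Z)%Z)%Z = y%:Z.
      by rewrite !divz_nat divnn divn_gt0 //; nia.
    have e2 : ((Q%:Z + j0%:Z) * y%:Z)%R = ((Q + j0) * y)%N%:Z by rewrite -PoszD -PoszM.
    have e3 : (x + ((Q + j0) * y)%N%:Z)%R = pad_val j0.
      by rewrite xE /pad_val /y; case: (N <= j0)%N; rewrite ?muln1 ?muln0.
    have e4 : (j0%:Z * 4 + (list_reg d' 0)%:Z)%R = (list_reg d' j0)%:Z.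
      by rewrite /list_reg; lia.
    have e5 : (j0%:Z + 1)%R = j0.+1%:Z by lia.
    have ne q : q < 60 -> (q == list_reg d' j0) = false by clear; rewrite /list_reg; lia.
    rewrite /= hJ hP hQ e1 e2 e3 e4 /= ?(ne 30 isT) ?(ne 42 isT) /= ?hJ ?hW ?e5.
    case: (r =P rY) => // _; case: (r =P rJ) => // _; case: (r =P list_reg d' j0) => // _.
    by case: (r =P rA) => // _; case: (r =P rX) => // _; case: (r =P rZ) => // _.
  have bx : bitlen `|x| <= B by rewrite xE.
  have ox : own_le B [eta m0 with rX |-> x] by exact: own_le_write.
  have [c1 _] := lite_run ox lite_fill.
  have hY : m1 rY = ((2 ^ s)%N%:Z - j0.+1%:Z)%R by rewrite hfr.
  have bY : bitlen `|m1 rY| <= B by rewrite hY; apply: bitlen_P; lia.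
  have cE : (3 + bitlen `|x|) + (run_cost fill_body [eta m0 with rX |-> x] +
      (4 + bitlen `|m1 rY|)) <= fill_factor * B.
    apply: leq_trans (leq_add (leq_add (leqnn 3) bx) (leq_add c1 (leq_add (leqnn 4) bY))) _.
    rewrite -[7 * _ * _]/(lite_factor fill_body) /fill_factor.
    by move: (lite_factor _) => e; lia.
  apply: reach_leq cE _; apply: reach_goto; first by rewrite /step [onth _ _]h0.
  apply: (reach_run h1); first by [].
  have -> : run fill_body (regs (write (pop_input (advance (Config pos m0 (drop j0 L) par))) rX x)) = m1.
    exact: m1E.
  rewrite -[4 + _]addn0; apply: reach_goto; first by rewrite /step [onth _ _]h2.
  apply: reach_done; exists m1; split.
    have -> : (0 < value m1 ($rY))%R = (j0.+1 < 2 ^ s) by rewrite [value _ _]hY subr_gt0 ltz_nat.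
    have dE : behead (drop j0 L) = drop j0.+1 L by rewrite -drop1 drop_drop add1n.
    have pE : (pos.+1 + size fill_body).+1 = pos + 12 by rewrite /=; lia.
    by case: ifP => _; rewrite /advance /goto [pc _]/= ?pE /= dE.
  have frame r : (r \notin [:: rX; rY; rZ; rA; rJ]) -> r != list_reg d' j0 -> m1 r = m0 r.
    rewrite !inE !negb_or => /and5P[h3 h4 h5 h6 h7] h8.
    by rewrite hfr !ifN.
  split.
  - by rewrite !frame // /list_reg; lia.
  - by rewrite hfr.
  - move=> r o; rewrite hfr.
    case: ifP => _; first by rewrite hY in bY.
    case: ifP => _; first by apply: bitlen_P; lia.
    case: ifP => _; first exact: B_val.
    case: ifP => _; first by apply: leq_trans (bitlen_homo _) B_reg; rewrite /list_reg; lia.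
    case: ifP => _; first exact: B_val.
    case: ifP => _; last exact: ho.
    apply: leq_trans (bitlen_homo _) B_Q; rewrite /y /=.
    by case: (N <= j0)%N; rewrite ?muln1 ?muln0; lia.
  - move=> i ij; case: (i =P j0) => [->|ne].
      by rewrite hfr eqxx !ifN //; rewrite /list_reg; lia.
    rewrite frame ?hval //; [lia| |]; rewrite ?inE /list_reg; lia.
  - split=> [r o|l ld].
      rewrite frame ?hno //; first by rewrite !inE; move: o; rewrite /own; lia.
      by move: o; rewrite /own /list_reg; lia.
    by rewrite frame ?ht // ?inE /tape_reg /list_reg; lia.
elim: k j m => [|k ih] j m jk hi.
  apply: (@reach_leq _ _ (fill_factor * B)); first by rewrite mul1n.
  apply: reach_imp (body j m _ hi); last by lia.
  move=> i c _ [m1 [-> h]]; exists m1, (drop j.+1 L); have e : j.+1 = 2 ^ s by lia.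
  by rewrite [in if _ then _ else _]e ltnn; split=> //; rewrite -e.
apply: (@reach_leq _ _ (fill_factor * B + k.+1 * (fill_factor * B))); first by rewrite [k.+2 * _]mulSn.
apply: reach_seq (body j m _ hi) _; first by lia.
move=> c1 [m1 [-> h]]; have -> : j.+1 < 2 ^ s by lia.
by apply: ih h; lia.
Qed.

Lemma run_powers k m r : run (nseq k (Arith Mul (Reg rQ) ($rQ) ($rN) : instr void)) m r =
  if r == rQ then (m rQ * m rN ^+ k)%R else m r.
Proof.
elim: k m => [|k ih] m /=; first by rewrite expr0 mulr1; case: eqP => [->|].
by rewrite ih /= exprS mulrA; case: eqP.
Qed.

Definition prelude_factor :=
  110 + lite_factor prelude1 + lite_factor prelude2 + fill_factor + lite_factor prelude3.

(** The simulated machine starts on the parameter 8P, that is with accuracy 1/(8P). *)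
Lemma prelude_spec :
  reach P' 0 (prelude_factor * (B * 2 ^ s)) (start (n%:Z :: L) [::])
    (fun _ c => exists m inp, c = Config (size prelude) m inp [::] /\
       sim d' n s B pad_val (start [::] (binary (8 * 2 ^ s))) m).
Proof.
have NP := N_le_P; have PN := P_le_N.
have [h0 hc1] := code_at_cons P'_code.
have [h1 hc2] := code_at_cat hc1; have [h2 hc3] := code_at_cat hc2.
have [h3 hc4] := code_at_cat hc3; have [h4 h5] := code_at_cat hc4.
have s0 : 0 < s by rewrite sE up_log_gt0; nia.
have b1 : bitlen n <= B by apply: bitlen_P; nia.
have B0 : 0 < B by lia.
pose m0 : nat -> int := [eta (fun=> 0%R) with rN |-> n%:Z].
have o0 : own_le B m0 by apply: own_le_write => // r _; rewrite absz0.
have l1 : all (lite B) prelude1 by rewrite /= !lite_reg //; lia.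
have [c1 _] := lite_run o0 l1.
have [m1 [m1E i1]] : exists m1, run prelude1 m0 = m1 /\ doubling_inv 0 m1.
  exists (run prelude1 m0); split=> //; split=> //=.
  - by rewrite mulnC PoszM.
  - have P1 : 0 < 2 ^ s by rewrite expn_gt0.
    move=> r o /=; case: ifP => _; first by apply: bitlen_P.
    case: ifP => _; first by apply: bitlen_P; rewrite abszM mulnC.
    exact: o0.
  - move=> r; rewrite !inE !negb_or => /and4P[_ /negbTE e1 /negbTE e2 /negbTE e3].
    by rewrite /= e1 e2 /m0 /= e3.
have c5 : prelude_factor * (B * 2 ^ s) >= (7 + bitlen n) + (run_cost prelude1 m0 +
    (s * (100 * B) + (lite_factor prelude2 * B + (2 ^ s * (fill_factor * B) +
     lite_factor prelude3 * B)))).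
  have e1 : 1 <= 2 ^ s by rewrite expn_gt0.
  have e2 : s <= 2 ^ s by apply: ltnW; apply: ltn_expl.
  move: c1; rewrite -[7 * _ * _]/(lite_factor prelude1) /prelude_factor.
  move: (lite_factor prelude1) (lite_factor prelude2) (lite_factor prelude3)
    fill_factor (run_cost _ _) (2 ^ s) e1 e2 => f1 f2 f3 f4 c e e1 e2 h.
  have hb := b1; clear -e1 e2 h hb B0.
  have g1 : B <= B * e by rewrite leq_pmulr.
  have g2 : s * (100 * B) <= 100 * (B * e) by rewrite mulnCA leq_mul2l mulnC leq_mul2l e2 orbT.
  have g3 f : f * B <= f * (B * e) by rewrite leq_mul2l g1 orbT.
  have g4 : e * (f4 * B) = f4 * (B * e) by rewrite mulnCA [e * B]mulnC.
  have := g3 f1; have := g3 f2; have := g3 f3; rewrite g4 !mulnDl.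
  move: (B * e) (s * (100 * B)) g1 g2 => be sb g1 g2; lia.
apply: reach_leq c5 _; apply: reach_goto; first by rewrite /step [onth _ _]h0.
apply: (reach_run h1); first by [].
have -> : run prelude1 (regs (write (pop_input (advance (start (n%:Z :: L) [::]))) rN n%:Z)) = m1.
  exact: m1E.
apply: (@reach_seq _ _ (s * (100 * B))).
  have -> : s * (100 * B) = s.-1.+1 * (100 * B) by rewrite prednK.
  by apply: doubling_spec h2 _ i1; rewrite add0n prednK.
move=> _ [m2 [-> [hW hP hN ho hfr]]].
have l2 : all (lite B) prelude2.
  rewrite /prelude2 /= all_cat all_nseq /= !lite_reg //=; lia.
have [c2 _] := lite_run ho l2.
rewrite -[7 * _ * _]/(lite_factor prelude2) in c2.
apply: reach_seq.
  apply: (@reach_plain P' 6 prelude2 _ m2 L [::] (fun c => c = Config fill_pos (run prelude2 m2) L [::])) => //.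
  - exact: lite_plain l2.
move=> _ ->.
have i3 : fill_inv 0 (run prelude2 m2).
  have E r : run prelude2 m2 r = if r == rJ then 0%R else if r == rQ then Q%:Z else m2 r.
    rewrite /prelude2 run_cons run_cat.
    have := run_powers (2 * d.+1); move: (nseq _ _) => b hb.
    rewrite /= hb; case: (r =P rJ) => // _; case: (r =P rQ) => [_|/eqP/negbTE rQ'] /=.
      by rewrite hN PoszM -[(n ^ _)%:Z]natz natrX natz.
    by rewrite rQ'.
  have frame r : r \notin [:: rX; rW; rP; rN] -> r \notin [:: rJ; rQ] ->
      run prelude2 m2 r = 0%R.
    move=> h; rewrite !inE negb_or => /andP[/negbTE e1 /negbTE e2].
    by rewrite E e1 e2 hfr.
  split.
  - by rewrite !E.
  - by rewrite E.
  - move=> r o; rewrite E; case: ifP => _; first by apply: bitlen_P.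
    case: ifP => _; last exact: ho.
    by apply: leq_trans (bitlen_homo _) B_Q; apply: leq_addr.
  - by [].
  - by split=> [r|l ld]; rewrite /own => *; rewrite frame // !inE /tape_reg; lia.
have P0 : 0 < 2 ^ s by rewrite expn_gt0.
apply: (@reach_seq _ _ (2 ^ s * (fill_factor * B))).
  rewrite -[in X in reach _ _ X](prednK P0) -[L in Config _ _ L](drop0 L).
  by apply: fill_spec h4 _ i3; rewrite add0n prednK.
move=> _ [m3 [inp [-> [[hW3 hP3 hN3 hQ3] hJ3 o3 hval3 [hno3 ht3]]]]].
have l3 : all (lite B) prelude3 by rewrite /= !lite_reg //; lia.
have [c3 _] := lite_run o3 l3; rewrite -[7 * _ * _]/(lite_factor prelude3) in c3.
apply: (@reach_plain P' _ prelude3) => //.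
have E r : run prelude3 m3 r = if r == rW then (2 * 2 ^ s)%N%:Z else
    if r == rM then (8 * 2 ^ s)%N%:Z else m3 r.
  by rewrite /= hW3; case: ifP => _; [lia|case: ifP => _ //; lia].
exists (run prelude3 m3), inp; split.
  have -> : size prelude = 6 + size prelude2 + 14.
    by rewrite /prelude; move: fill_pos prelude2 => q b; rewrite /= !size_cat /=; lia.
  by congr Config; rewrite /fill_pos; move: prelude2 => b; rewrite /=; lia.
move: (run prelude3 m3) E => m4 E; split=> /=.
- split=> i /=; rewrite E !ifN ?hno3 // /own; lia.
- split=> [||j jP]; rewrite E //.
  by rewrite !ifN ?hval3 // /list_reg; lia.
- move=> r o r38; rewrite E; case: ifP => _; first by apply: leq_trans (bitlen_homo _) B_s; lia.
  by case: ifP => _; [exact: B_s|exact: o3].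
- by split=> // l ld; rewrite E !ifN ?ht3 ?nth_nil // /tape_reg; lia.
- exists (8 * 2 ^ s); split; first by rewrite E.
  by rewrite /bits ifN //; lia.
Qed.

End Prelude.

End Reduction.

(** * Correctness of the instance *)

Section Pushforward.
Variables (R : realType) (X : choiceType) (W : nat) (q : nat -> R) (pt : nat -> X).
Hypothesis q_ge0 : forall j, 0 <= q j.

(** Law of [pt j] for an index [j] drawn with weight [q]; summing over indices allows points to
    coincide. *)
Definition push_mass (x : X) : R := \sum_(j < W) q j * (pt j == x)%:R.

Lemma push_mass_ge0 x : 0 <= push_mass x.
Proof. by apply: sumr_ge0 => j _; rewrite mulr_ge0. Qed.

(** Each mass is split into the contributions of the indices, and the two sums of nonnegative terms
    are exchanged. *)
Lemma esum_push (A : set X) (F : X -> \bar R) : (forall x, 0 <= F x)%E ->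
  (\esum_(x in A) ((push_mass x)%:E * F x) =
   \sum_(j < W | pt j \in A) (q j)%:E * F (pt j))%E.
Proof.
move=> F0; rewrite esum_mkcond big_mkcond /=.
pose a x (j : 'I_W) := (if x == pt j then
   if pt j \in A then (q j)%:E * F (pt j) else 0 else 0)%E.
have a0 x j : (0 <= a x j)%E.
  by rewrite /a; do 2!case: ifP => // _; apply: mule_ge0; rewrite ?lee_fin.
rewrite (eq_esum (b := fun x => \sum_(j < W) a x j)%E); last first.
  move=> x _; rewrite /push_mass /a; case: ifP => xA; last first.
    by rewrite big1 // => j _; case: eqP => // <-; rewrite xA.
  rewrite -sumEFin ge0_sume_distrl; last by move=> j _; rewrite lee_fin mulr_ge0.
  apply: eq_bigr => j _; rewrite [pt j == x]eq_sym; case: eqP => [<-|_].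
    by rewrite mulr1 xA.
  by rewrite mulr0 mul0e.
rewrite esum_sum //; apply: eq_bigr => j _.
rewrite -(esum_set1 (t := pt j) (a := fun=> if pt j \in A then (q j)%:E * F (pt j) else 0)%E); last first.
  by case: ifP => // _; apply: mule_ge0; rewrite ?lee_fin.
rewrite [RHS]esum_mkcond; apply: eq_esum => x _; rewrite /a.
by rewrite (_ : (x \in [set pt j]) = (x == pt j)) //; apply/idP/eqP => [/set_mem//|->]; apply: mem_set.
Qed.

Hypothesis q_total : \sum_(j < W) q j = 1.

Lemma push_mass_total : (\esum_(x in [set: X]) (push_mass x)%:E = 1)%E.
Proof.
have := @esum_push setT (fun=> 1%E) (fun=> lee01).
under eq_esum do rewrite mule1.
by move=> ->; rewrite (eq_bigl xpredT) => [|j]; [under eq_bigr do rewrite mule1; rewrite sumEFin q_total|exact: mem_set].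
Qed.

Definition push : distr R X := Distr push_mass_ge0 push_mass_total.

Lemma push_gt0 j : (j < W)%N -> 0 < q j -> 0 < push (pt j).
Proof.
move=> jW qj; rewrite /= /push_mass (bigD1 (Ordinal jW)) //= eqxx mulr1.
by rewrite ltr_pwDl // sumr_ge0 // => i _; rewrite mulr_ge0.
Qed.

Lemma push_support x : 0 < push x -> exists2 j, (j < W)%N & x = pt j.
Proof.
move=> h; have [/existsP[j /eqP <-]|] := boolP [exists j : 'I_W, pt j == x].
  by exists j.
move=> /existsPn hn; move: h; rewrite /= /push_mass big1 ?ltxx // => j _.
by rewrite (negbTE (hn j)) mulr0.
Qed.

Lemma disagreement_push f g :
  disagreement push f g = \sum_(j < W | f (pt j) != g (pt j)) q j.
Proof.
rewrite /disagreement; have := @esum_push [set x | f x != g x] (fun=> 1%E) (fun=> lee01).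
under eq_esum do rewrite mule1.
move=> ->; under eq_bigr do rewrite mule1.
rewrite sumEFin /=; apply: eq_bigl => j; apply/idP/idP => [/set_mem//|h]; exact: mem_set.
Qed.

End Pushforward.

Section Distance.
Variables (R : realType) (X : choiceType) (D : distr R X) (f : X -> bool) (H : set (X -> bool)).

Lemma disagreement_ge0 g : 0 <= disagreement D f g.
Proof. by apply: fine_ge0; apply: esum_ge0 => x _; rewrite lee_fin mass_ge0. Qed.

Lemma dist_class_le g e : H g -> disagreement D f g <= e -> dist_class D f H <= e.
Proof.
move=> Hg; apply: le_trans; apply: ge_inf; last by exists g.
by exists 0 => _ [h _ <-]; exact: disagreement_ge0.
Qed.

Lemma dist_class_ge g e : H g -> (forall h, H h -> e <= disagreement D f h) ->
  e <= dist_class D f H.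
Proof.
move=> Hg he; apply: lb_le_inf; first by exists (disagreement D f g), g.
by move=> _ [h Hh <-]; exact: he.
Qed.

End Distance.

(** * Halfspaces and vertical pairs of points *)

Lemma sum_pairs (P : nat) (F : nat -> nat) :
  (\sum_(J < 2 * P) F J = \sum_(j < P) (F (2 * j) + F (2 * j).+1))%N.
Proof.
elim: P => [|P ih]; first by rewrite muln0 !big_ord0.
by rewrite mulnS !addSn add0n !big_ord_recr /= ih addnA.
Qed.

(** The boundary height -g/w lies strictly above [a] and not above [b + 1]. *)
Lemma lt_of_strip (R : realType) (g w : R) (a b : int) : 0 < w ->
  g + w * a%:~R < 0 -> 0 <= g + w * (b%:~R + 1) -> a < b + 1.
Proof.
move=> w0 ha hb; rewrite -(ltr_int R) intrD -(ltr_pM2l w0) -(ltrD2l g).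
exact: lt_le_trans ha hb.
Qed.

Section Geometry.
Variables (R : realType) (d' n P : nat) (val : nat -> int).
Local Notation d := d'.+1.
Local Notation idx := (idx d' n).
Local Notation point := (point d' n val).

Definition errors (h : 'rV[int]_d -> bool) : nat :=
  (\sum_(J < 2 * P) (label (point J) != h (point J)))%N.

Definition separated (h : 'rV[int]_d -> bool) (j : nat) : bool :=
  ~~ h (point (2 * j)) && h (point (2 * j).+1).

Lemma errors_pairs h : errors h =
  (\sum_(j < P) (h (point (2 * j)) + ~~ h (point (2 * j).+1)))%N.
Proof.
rewrite /errors (sum_pairs P (fun J => (label (point J) != h (point J)) : nat)).
apply: eq_bigr => j _; rewrite !label_point /= mul2n odd_double /=.
by case: (h _); case: (h _).
Qed.

Definition sep_set h : {set 'I_P} := [set j : 'I_P | separated h j].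

(** A pair that is not separated contributes at least one error. *)
Lemma errors_ge h : (P - #|sep_set h| <= errors h)%N.
Proof.
rewrite leq_subLR errors_pairs -sum1_card -[X in (X <= _)%N]card_ord -sum1_card.
rewrite big_mkcond /= [X in (_ <= X + _)%N]big_mkcond -big_split /=.
apply: leq_sum => j _; rewrite inE /separated.
by case: (h _); case: (h _).
Qed.

(** A function monotone on each pair errs at most once on it, and not at all if the pair is
    separated. *)
Lemma errors_le (h : 'rV[int]_d -> bool) : (forall j, h (point (2 * j)) -> h (point (2 * j).+1)) ->
  (errors h + #|sep_set h| <= P)%N.
Proof.
move=> hh; rewrite errors_pairs -sum1_card -[X in (_ <= X)%N]card_ord -sum1_card.
rewrite [X in (_ + X <= _)%N]big_mkcond -big_split /=.
apply: leq_sum => j _; rewrite inE /separated.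
by have := hh j; case: (h _); case: (h _) => // /(_ isT).
Qed.

(** The affine function without its height term, at the base point [i]. *)
Definition level (w : 'rV[R]_d) (theta : R) (i : nat) : R :=
  \sum_(l < d') w 0 (widen_ord (leqnSn d') l) * (base d' i l)%:~R + theta.

Lemma halfspace_point w theta J : halfspace w theta (point J) =
  (0 <= level w theta (idx J./2) +
     w 0 ord_max * (coef d' (idx J./2) * val J./2 + (odd J)%:Z)%:~R).
Proof.
rewrite /halfspace big_ord_recr /= addrAC; congr (_ <= _ + _ + _).
  apply: eq_bigr => l _; rewrite mxE; case: eqP => // /(congr1 (@nat_of_ord _)) /= h.
  by have := ltn_ord l; rewrite h ltnn.
by rewrite mxE eqxx.
Qed.

(** The base point [d] is the barycentre of the others, and [level] is affine in the base point. *)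
Lemma level_sum w theta :
  \sum_(i < d) level w theta i = d%:R * level w theta d.
Proof.
rewrite /level big_split /= sumr_const card_ord mulrDr; congr (_ + _); last by rewrite mulr_natl.
rewrite exchange_big /= mulr_sumr; apply: eq_bigr => l _.
rewrite -mulr_sumr [RHS]mulrCA; congr (_ * _).
have ld : (l < d)%N := ltnW (ltn_ord l).
rewrite (bigD1 (Ordinal ld)) //= big1 ?addr0; last first.
  move=> i /eqP il; rewrite /base ltn_eqF; last exact: ltn_ord.
  by case: eqP => // e; case: il; apply: val_inj.
by rewrite /base !eqxx (ltn_eqF ld) mulr1.
Qed.

Hypothesis val_inj : forall j j', (j < P)%N -> (j' < P)%N -> idx j = idx j' ->
  val j = val j' -> j = j'.

Definition solution (j : nat -> nat) : Prop :=
  (forall i, (i <= d)%N -> (j i < P)%N /\ idx (j i) = i) /\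
  \sum_(i < d) val (j i) = val (j d).

(** The points of a pair differ by one unit of height only, so separating them forces a positive
    height coefficient. *)
Lemma sep_bounds (w : 'rV[R]_d) (theta : R) j : separated (halfspace w theta) j ->
  let: i := idx j in let v := (coef d' i * val j)%:~R in
  [/\ 0 < w 0 ord_max, level w theta i + w 0 ord_max * v < 0 &
      0 <= level w theta i + w 0 ord_max * (v + 1)].
Proof.
rewrite /separated !halfspace_point /= mul2n doubleK uphalf_double odd_double /=.
rewrite !intrD addr0 -ltNge => /andP[h1 h2]; split=> //.
by have := lt_le_trans h1 h2; rewrite mulrDr addrA mulr1 ltrDl.
Qed.

(** The boundary meets a vertical line once, so the heights of the two pairs differ by less than
    one; both are multiples of the same coefficient, which is at least 2. *)
Lemma sep_injective (w : 'rV[R]_d) (theta : R) j j' : (j < P)%N -> (j' < P)%N ->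
  separated (halfspace w theta) j -> separated (halfspace w theta) j' ->
  idx j = idx j' -> j = j'.
Proof.
move=> jP jP' /sep_bounds[w0 h1 h2] /sep_bounds[_ h3 h4] ij; apply: val_inj => //.
rewrite -ij in h3 h4.
have c0 : 2 <= coef d' (idx j) by rewrite /coef; case: ifP => _; lia.
have := lt_of_strip w0 h1 h4; have := lt_of_strip w0 h3 h2.
by move: (coef _ _) c0 => c c0; nia.
Qed.

Lemma sep_card (w : 'rV[R]_d) (theta : R) : ~ (exists j, solution j) ->
  (#|sep_set (halfspace w theta)| <= d)%N.
Proof.
move=> nosol; rewrite leqNgt; apply/negP => hd; apply: nosol.
set S := sep_set _ in hd *.
pose g (j : 'I_P) : 'I_d.+1 := inord (idx j).
have gE j : g j = idx j :> nat by rewrite inordK // ltnS geq_minr.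
have sepS j : j \in S -> separated (halfspace w theta) j by rewrite inE.
have ginj : {in S &, injective g}.
  move=> j j' /sepS sj /sepS sj' e; apply: ord_inj; apply: (sep_injective _ _ sj sj') => //.
  by rewrite -!gE e.
(* More than d separated pairs have distinct indices among 0, ..., d, so every index occurs. *)
have gS : g @: S = finset.setT.
  apply/eqP; rewrite eqEcard finset.subsetT /= cardsT card_ord card_in_imset //.
have ex (i : 'I_d.+1) : exists j : 'I_P, (j \in S) && (g j == i).
  have : i \in g @: S by rewrite gS finset.in_setT.
  by move=> /imsetP[j jS ->]; exists j; rewrite jS eqxx.
have [j0 hj0] := fin_all_exists ex.
pose j (i : nat) : nat := j0 (inord i).
have hj i : (i <= d)%N -> separated (halfspace w theta) (j i) /\ idx (j i) = i.
  move=> id; have /andP[/sepS h1 /eqP h2] := hj0 (inord i).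
  by split=> //; rewrite -gE h2 inordK.
exists j; split; first by move=> i /hj[_ ->]; split=> //; exact: ltn_ord.
set lv := level w theta; set wd := w 0 ord_max.
have coefI (i : 'I_d) : coef d' i = (2 * d)%N%:Z by rewrite /coef ltn_eqF.
have coefd : coef d' d = 2 by rewrite /coef eqxx.
pose sum := \sum_(i < d) val (j i).
have [/sep_bounds[w0 lo hi] idd] := hj d (leqnn d).
rewrite idd coefd -/lv -/wd in w0 lo hi.
have sumE : \sum_(i < d) ((coef d' i * val (j i))%:~R : R) = d%:R * (2 * sum)%:~R.
  rewrite -(rmorph_sum (intmul 1)) /= /sum mulr_sumr -[d%:R]/(d%:Z%:~R) -intrM mulr_sumr.
  by congr (_%:~R); apply: eq_bigr => i _; rewrite coefI; lia.
(* The bounds for i < d are added up; by [level_sum] the levels amount to d times the level at the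
   last base point. *)
have LO : d%:R * lv d + wd * (d%:R * (2 * sum)%:~R) < 0.
  rewrite -level_sum -/lv -sumE mulr_sumr -big_split /=.
  have z : \sum_(i < d) (0 : R) = 0 by rewrite big1.
  rewrite -[ltRHS]z.
  apply: ltr_sum => [|i _]; first by apply/hasP; exists ord0; rewrite ?mem_index_enum.
  by have [/sep_bounds[_ + _] e] := hj i (ltnW (ltn_ord i)); rewrite e.
have HI : 0 <= d%:R * lv d + wd * (d%:R * (2 * sum)%:~R + d%:R).
  have -> : d%:R * (2 * sum)%:~R + d%:R =
      \sum_(i < d) ((coef d' i * val (j i))%:~R + 1) :> R.
    by rewrite big_split /= sumE sumr_const card_ord.
  rewrite -level_sum -/lv mulr_sumr -big_split /=; apply: sumr_ge0 => i _.
  by have [/sep_bounds[_ _ +] e] := hj i (ltnW (ltn_ord i)); rewrite e.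
have D0 : 0 < d%:R :> R by rewrite ltr0n.
have {}LO : lv d + wd * (2 * sum)%:~R < 0.
  by rewrite -(pmulr_rlt0 _ D0) mulrDr mulrCA.
have {}HI : 0 <= lv d + wd * ((2 * sum)%:~R + 1).
  rewrite -(pmulr_rge0 _ D0); move: HI; congr (0 <= _).
  by move: (lv d) ((2 * sum)%:~R : R) => a b; ring.
(* All bounds now concern the same base point, so the integers 2 [sum] and 2 [val (j d)] differ by
   less than one. *)
have := lt_of_strip w0 LO hi; have := lt_of_strip w0 lo HI.
by rewrite -/sum; lia.
Qed.

Lemma errors_no (h : 'rV[int]_d -> bool) : halfspaces R h ->
  ~ (exists j, solution j) -> (P - d <= errors h)%N.
Proof.
move=> [w [theta ->]] nosol; apply: leq_trans (errors_ge _).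
by rewrite leq_sub2l // sep_card.
Qed.

(** The hyperplane through the upper points of the d pairs over the vertices passes, by the
    equation, through the upper point of the last pair too, and so separates all d + 1 pairs. *)
Lemma errors_yes j : solution j ->
  exists2 h : 'rV[int]_d -> bool, halfspaces R h & (errors h + d.+1 <= P)%N.
Proof.
move=> [hj hsum].
pose a i : R := (val (j i))%:~R.
(* The vertices are d times the unit vectors, and the origin for index [d']; prescribing the
   boundary heights 2d a_i + 1 there determines these coefficients. *)
pose w : 'rV[R]_d := \row_l (if l == ord_max then 1 else - 2 * (a l - a d')).
pose theta : R := - (2 * d%:R * a d' + 1).
have wd1 : w 0 ord_max = 1 by rewrite mxE eqxx.
have wl (l : 'I_d') : w 0 (widen_ord (leqnSn d') l) = - 2 * (a l - a d').
  rewrite mxE; case: eqP => // /(congr1 (@nat_of_ord _)) /= e.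
  by have := ltn_ord l; rewrite e ltnn.
have lvE i : (i <= d)%N -> level w theta i = - ((coef d' i)%:~R * a i + 1).
  have thE : theta = - (2 * d%:R * a d' + 1) by [].
  rewrite leq_eqVlt => /orP[/eqP->|id]; last first.
    rewrite /level /coef ltn_eqF // (_ : ((2 * d)%N%:Z%:~R : R) = 2 * d%:R); last first.
      by rewrite -natrM.
    have [id'|id'] := ltnP i d'.
      rewrite (bigD1 (Ordinal id')) //= big1 ?addr0; last first.
        move=> l /eqP li; rewrite /base ltn_eqF //; case: eqP => [e|_]; last by rewrite mulr0.
        by case: li; apply: ord_inj.
      rewrite wl /base eqxx ltn_eqF //= thE.
      by rewrite -[d%:Z%:~R]/(d%:R : R); ring.
    have -> : i = d' by apply/eqP; rewrite eqn_leq id' andbT.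
    rewrite big1 ?add0r ?thE // => l _; rewrite /base ltn_eqF // gtn_eqF ?mulr0 //.
  rewrite /level /coef eqxx /base.
  have -> : \sum_(l < d') w 0 (widen_ord (leqnSn d') l) *
      (if d == d then 1 else if d == l then d%:Z else 0)%:~R = \sum_(l < d') (- 2 * (a l - a d')).
    by apply: eq_bigr => l _; rewrite eqxx mulr1 wl.
  (* Here the equation enters: it puts the boundary at height 2 a_d + 1 over the barycentre. *)
  have ad : a d = \sum_(l < d') a l + a d'.
    by rewrite /a -hsum big_ord_recr /= intrD (rmorph_sum (intmul 1)).
  rewrite -mulr_sumr big_split /= sumr_const card_ord ad thE -mulr_natr.
  have -> : d%:R = d'%:R + 1 :> R by rewrite -natr1.
  by ring.
exists (halfspace w theta); first by exists w, theta.
have mono k : halfspace w theta (point (2 * k)) -> halfspace w theta (point (2 * k).+1).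
  rewrite !halfspace_point /= mul2n doubleK uphalf_double odd_double /= wd1 !mul1r !intrD.
  by move: (level _ _ _) (_%:~R) => a1 a2; lra.
have := errors_le mono; apply: leq_trans; rewrite leq_add2l.
pose g (i : 'I_d.+1) : 'I_P := insubd (Ordinal (hj d (leqnn d)).1) (j i).
have gE i : g i = j i :> nat.
  by rewrite /g val_insubd; have [-> _] := hj i (ltn_ord i).
have ginj : injective g.
  move=> i i' e; apply: ord_inj; have [_ <-] := hj i (ltn_ord i).
  by have [_ <-] := hj i' (ltn_ord i'); rewrite -!gE e.
rewrite -[d.+1]card_ord -cardsT -(card_imset _ ginj); apply: subset_leq_card.
apply/fintype.subsetP => _ /imsetP[i _ ->]; rewrite inE /separated !halfspace_point gE.
rewrite /= mul2n doubleK uphalf_double odd_double /= wd1 !mul1r.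
have [_ e] := hj i (ltn_ord i); rewrite e (lvE i (ltn_ord i)).
by rewrite !intrD !intrM /a; lra.
Qed.

End Geometry.

(** * The instance built from a k-SUM input and its distance to halfspaces *)

Lemma nth_flatten_uniform (T : eqType) (x0 : T) n (A : seq (seq T)) i r :
  (forall L, L \in A -> size L = n) -> (r < n)%N ->
  nth x0 (flatten A) (i * n + r) = nth x0 (nth [::] A i) r.
Proof.
elim: A i => [|L A ih] i hA rn; first by rewrite /= !nth_nil.
have sL : size L = n by apply: hA; rewrite mem_head.
case: i => [|i]; first by rewrite /= nth_cat sL rn.
rewrite /= nth_cat sL mulSn -addnA ltnNge leq_addr /= addKn ih // => M MA.
by apply: hA; rewrite inE MA orbT.
Qed.

Lemma size_flatten_uniform (T : eqType) n (A : seq (seq T)) :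
  (forall L, L \in A -> size L = n) -> size (flatten A) = (size A * n)%N.
Proof.
elim: A => [|L A ih] hA //=; rewrite size_cat ih => [|M MA].
  by rewrite hA ?mem_head // mulSn.
by apply: hA; rewrite inE MA orbT.
Qed.

Section Instance.
Variables (d' n : nat) (A : seq (seq int)).
Local Notation d := d'.+1.
Local Notation k := d'.+2.
Local Notation L := (flatten A).
Local Notation N := (k * n)%N.
Local Notation Q := (d * n ^ (2 * k))%N.
Local Notation val := (pad_val d' n L).
Hypothesis n0 : (0 < n)%N.
Hypothesis inst : ksum_instance k n A.

Lemma size_lists M : M \in A -> size M = n.
Proof. by case: inst => _ h _ /h[]. Qed.

Lemma size_L : size L = N.
Proof. by rewrite (size_flatten_uniform size_lists); case: inst => ->. Qed.

Lemma nth_list i : (i < k)%N -> nth [::] A i \in A.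
Proof. by move=> ik; apply: mem_nth; case: inst => ->. Qed.

Lemma val_list j : (j < N)%N -> val j = nth 0 (nth [::] A (j %/ n)) (j %% n).
Proof.
move=> jN; rewrite /pad_val leqNgt jN addr0 {1}(divn_eq j n).
by rewrite nth_flatten_uniform ?ltn_pmod //; exact: size_lists.
Qed.

Lemma val_pad j : (N <= j)%N -> val j = (Q + j)%N%:Z.
Proof. by move=> jN; rewrite /pad_val jN nth_default ?size_L // add0r. Qed.

Lemma val_mem j : (j < N)%N -> val j \in nth [::] A (j %/ n).
Proof.
move=> jN; rewrite val_list //; apply: mem_nth.
by rewrite size_lists ?ltn_pmod // nth_list // ltn_divLR.
Qed.

Lemma val_bound j : (j < N)%N -> (`|val j| <= n ^ (2 * k))%N.
Proof.
move=> jN; case: inst => _ _ h; apply: h (val_mem jN).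
by apply: nth_list; rewrite ltn_divLR.
Qed.

Lemma powQ : (n ^ (2 * k) <= Q)%N. Proof. by rewrite leq_pmull. Qed.

Lemma idx_lt j : (idx d' n j < d)%N -> (j < N)%N /\ (j %/ n)%N = idx d' n j.
Proof.
rewrite /idx gtn_min ltnn orbF => jd; rewrite (minn_idPl (ltnW jd)); split=> //.
by rewrite -ltn_divLR //; apply: ltn_trans jd _.
Qed.

Lemma idx_list j : (j < N)%N -> idx d' n j = (j %/ n)%N.
Proof. by rewrite -ltn_divLR // ltnS => h; apply/minn_idPl. Qed.

(** Elements of one list are distinct; padding values are distinct and exceed the absolute value of
    every list element. *)
Lemma val_injective j j' : idx d' n j = idx d' n j' -> val j = val j' -> j = j'.
Proof.
wlog jj : j j' / (j <= j')%N.
  by move=> h; case: (leqP j j') => [|/ltnW] /h // h1 e1 e2; rewrite h1.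
move=> e ev; have [j'N|Nj'] := ltnP j' N; last first.
  have [jN|Nj] := ltnP j N; last by move: ev; rewrite !val_pad //; lia.
  have := val_bound jN; rewrite ev val_pad // => h; have := powQ; lia.
have jN : (j < N)%N by lia.
move: e ev; rewrite !idx_list // !val_list // => e; rewrite e => ev.
rewrite (divn_eq j n) (divn_eq j' n) e; congr (_ + _)%N; apply/eqP.
have mA : nth [::] A (j' %/ n) \in A by apply: nth_list; rewrite ltn_divLR.
have [_ h _] := inst; have [sz un] := h _ mA.
by rewrite -(nth_uniq 0 _ _ un) ?sz ?ltn_pmod //; apply/eqP.
Qed.

(** No solution uses padding: it has an index in the last list only, and its values exceed Q, while
    d list elements sum to at most Q in absolute value. *)
Lemma solution_ksum P : (N <= P)%N ->
  (exists j, solution d' n P val j) <-> ksum_yes k A.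
Proof.
move=> NP; split=> [[j [hj hs]]|[a ha hs]].
  have small i : (i < d)%N -> (j i < N)%N /\ (j i %/ n)%N = i.
    by move=> id; have [_ e] := hj i (ltnW id); have := @idx_lt (j i); rewrite e => /(_ id).
  have jd : (j d < N)%N.
    rewrite ltnNge; apply/negP => Nj; move: hs; rewrite (val_pad Nj) => hs.
    have : (`|(\sum_(i < d) val (j i))%R| <= Q)%N.
      rewrite -lez_nat abszE; apply: le_trans (ler_norm_sum _ _ _) _.
      have -> : Q%:Z = \sum_(i < d) (n ^ (2 * k))%N%:Z by rewrite sumr_const card_ord -mulr_natl PoszM natz.
      apply: ler_sum => i _; rewrite -abszE lez_nat; apply: val_bound.
      by have [] := small i (ltn_ord i).
    by rewrite hs; lia.
  have jd' : (j d %/ n)%N = d by have [_ e] := hj d (leqnn d); rewrite -idx_list.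
  exists (fun i => val (j i)) => //.
  move=> i; rewrite ltnS leq_eqVlt => /orP[/eqP->|id].
    by rewrite -{2}jd'; apply: val_mem.
  by have [h1 h2] := small i id; rewrite -{2}h2; apply: val_mem.
pose r i := index (a i) (nth [::] A i).
have hr i : (i < k)%N -> (r i < n)%N.
  by move=> ik; rewrite -(size_lists (nth_list ik)) index_mem ha.
have jN i : (i < k)%N -> (i * n + r i < N)%N.
  by move=> ik; have := hr i ik; nia.
have hv i : (i < k)%N -> val (i * n + r i) = a i.
  move=> ik; rewrite val_list ?jN // divnMDl // divn_small ?hr // addn0.
  by rewrite modnMDl modn_small ?hr // nth_index ?ha.
exists (fun i => (i * n + r i)%N); split.
  move=> i ik; split; first by apply: leq_trans NP; apply: jN.
  by rewrite idx_list ?jN // divnMDl // divn_small ?hr // addn0.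
rewrite hv // -hs; apply: eq_bigr => i _; rewrite hv //.
by apply: ltn_trans (ltn_ord i) _.
Qed.

Section Bounds.
Variable s : nat.
Local Notation P := (2 ^ s)%N.
Local Notation M := (8 * 2 ^ s)%N.
Hypothesis NP : (N <= P)%N.

Lemma pow_bound e : (0 < e <= 2 * k + 2)%N -> (P ^ e <= M ^ (2 * k + 2))%N.
Proof.
move=> /andP[e0 ec]; apply: (@leq_trans (M ^ e)); first by rewrite leq_exp2r //; lia.
by rewrite leq_pexp2l // muln_gt0 expn_gt0.
Qed.

Lemma Q_bound : (Q + P <= M ^ (2 * k + 2))%N.
Proof.
have h1 : (Q <= P ^ (2 * k).+1)%N.
  rewrite expnS leq_mul //; first by nia.
  by rewrite leq_exp2r //; nia.
have h2 : (P <= P ^ (2 * k).+1)%N by rewrite -{1}[P]expn1 leq_pexp2l ?expn_gt0.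
apply: leq_trans (leq_add h1 h2) _; rewrite addnn -mul2n.
apply: (@leq_trans (M * M ^ (2 * k).+1)).
  apply: leq_mul; first by have : (0 < P)%N by [rewrite expn_gt0]; lia.
  by rewrite leq_exp2r //; lia.
by rewrite -expnS leq_pexp2l // ?muln_gt0 ?expn_gt0 //; lia.
Qed.

Lemma val_bound_pad j : (j < P)%N -> (`|val j| <= Q + P)%N.
Proof.
move=> jP; have [jN|Nj] := ltnP j N; last by rewrite val_pad //=; lia.
by apply: leq_trans (val_bound jN) _; have := powQ; lia.
Qed.

(** As d <= P and Q <= P^(2k+1), a height is at most 2d(Q + P) + 1 <= 5 P^(2k+2), which is below
    (8P)^(2k+2). *)
Lemma point_bound J l : (J < 2 * P)%N -> (`|point d' n val J 0%R l| <= M ^ (2 * k + 2))%N.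
Proof.
move=> JP; have P0 : (0 < P)%N by rewrite expn_gt0.
have dP : (d <= P)%N by nia.
have big : (2 * d * (Q + P) + 1 <= M ^ (2 * k + 2))%N.
  have h1 : (Q <= P ^ (2 * k).+1)%N.
    rewrite expnS leq_mul //.
    by rewrite leq_exp2r //; nia.
  have h2 : (P <= P ^ (2 * k).+1)%N by rewrite -{1}[P]expn1 leq_pexp2l ?expn_gt0.
  have h3 : (2 * d * (Q + P) + 1 <= 5 * (P * P ^ (2 * k).+1))%N.
    have : (1 <= P * P ^ (2 * k).+1)%N by rewrite muln_gt0 P0 expn_gt0 P0.
    have : (d * (Q + P) <= P * (2 * P ^ (2 * k).+1))%N by apply: leq_mul => //; lia.
    by move: (P ^ _)%N => e; nia.
  apply: leq_trans h3 _; rewrite -expnS.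
  have -> : (2 * k + 2 = (2 * k).+2)%N by rewrite addn2.
  rewrite expnMn leq_mul2r expn_eq0; apply/orP; right.
  by apply: leq_trans (leq_pexp2l (isT : 0 < 8)%N (isT : 1 <= (2 * k).+2)%N).
rewrite mxE; case: eqP => _.
  have jP : (J./2 < P)%N by lia.
  apply: leq_trans big; apply: (@leq_trans (`|coef d' (idx d' n J./2)| * `|val J./2| + 1)%N).
    by rewrite -abszM; case: (odd J); lia.
  rewrite leq_add2r; apply: leq_mul; last exact: val_bound_pad.
  by rewrite /coef; case: ifP => _ /=; lia.
apply: (@leq_trans (P ^ 1)); last by apply: pow_bound.
by rewrite expn1 /base; case: ifP => _; [lia|case: ifP => _; lia].
Qed.

End Bounds.

Section Distance.
Variables (R : realType) (s : nat).
Local Notation P := (2 ^ s)%N.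
Local Notation W := (2 * 2 ^ s)%N.
Local Notation pt := (point d' n val).
Hypothesis NP : (N <= P)%N.

Lemma weight_ge0 (j : nat) : 0 <= (W%:R^-1 : R).
Proof. by rewrite invr_ge0. Qed.

Lemma weight_total : \sum_(j < W) (W%:R^-1 : R) = 1.
Proof.
rewrite sumr_const card_ord -(mulr_natl (W%:R^-1)) divff // pnatr_eq0 -lt0n muln_gt0 expn_gt0 //.
Qed.

Definition instance_distr : distr R 'rV[int]_d := push pt weight_ge0 weight_total.

Lemma instance_distr_avg (F : 'rV[int]_d -> \bar R) : (forall x, 0 <= F x)%E ->
  (\esum_(x in [set: 'rV[int]_d]) ((instance_distr x)%:E * F x) =
   avg s.+1 (fun j => F (pt j)))%E.
Proof.
move=> F0; rewrite [LHS](esum_push W pt weight_ge0 setT F0).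
rewrite avgE // ge0_sume_distrr //; rewrite expnS exprS.
rewrite (eq_bigl xpredT) => [|j]; last exact: mem_set.
by rewrite natrM natrX.
Qed.

Lemma instance_distr_gt0 j : (j < W)%N -> 0 < instance_distr (pt j).
Proof.
by move=> jW; apply: push_gt0 => //; rewrite invr_gt0 ltr0n muln_gt0 expn_gt0.
Qed.

Lemma disagreement_errors h :
  disagreement instance_distr (@label d') h = (errors n P val h)%:R / W%:R.
Proof.
rewrite disagreement_push /errors natr_sum mulr_suml big_mkcond /=.
by apply: eq_bigr => j _; case: (_ != _); rewrite ?mul1r ?mul0r.
Qed.

Local Notation dist := (dist_class instance_distr (@label d') (halfspaces R (d := d))).

Lemma dist_yes : ksum_yes k A -> dist <= (P%:R - d%:R - 1) / W%:R.
Proof.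
move=> /(solution_ksum NP)[j hj].
have [h hh eh] := errors_yes R hj.
apply: (dist_class_le hh); rewrite disagreement_errors ler_pM2r ?invr_gt0 ?ltr0n ?muln_gt0 ?expn_gt0 //.
by rewrite -addrA -opprD natr1 lerBrDr -natrD ler_nat.
Qed.

Lemma dist_no : ~ ksum_yes k A -> (P%:R - d%:R) / W%:R <= dist.
Proof.
move=> no; apply: (@dist_class_ge _ _ _ _ _ (halfspace 0 0)); first by exists 0, 0.
move=> h hh; rewrite disagreement_errors ler_pM2r ?invr_gt0 ?ltr0n ?muln_gt0 ?expn_gt0 //.
have inj j j' : (j < P)%N -> (j' < P)%N -> idx d' n j = idx d' n j' -> val j = val j' -> j = j'.
  by move=> _ _; apply: val_injective.
have := errors_no inj hh; move=> /(_ _)/wrap[|he].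
  by move=> /(solution_ksum NP).
have dP : (d <= P)%N by nia.
by rewrite -natrB // ler_nat.
Qed.

(** After scaling by 4P the distance is at most 2P - 2d - 2 or at least 2P - 2d and the accuracy is
    1/2, so comparing the output with 2P - 2d - 1 decides. *)
Lemma decision_correct (r : nat -> int) :
  `|dist - output R r| <= ((8 * P)%N%:R)^-1 ->
  (0 < decision d' W (r 0%N) (r 1%N))%R <-> ksum_yes k A.
Proof.
rewrite /output; move: (r 0%N) (r 1%N) => x y; rewrite ler_distl => /andP[lo hi].
have P0 : 0 < P%:R :> R by rewrite ltr0n expn_gt0.
have WE : W%:R = 2 * P%:R :> R by rewrite natrM.
have dP : d%:R + 1 <= P%:R :> R by rewrite natr1 ler_nat; nia.
have ME : (8 * P)%N%:R = 8 * P%:R :> R by rewrite natrM.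
rewrite ME in lo hi.
set o := x%:~R / y%:~R in lo hi.
have e0 : 4 * P%:R * (8 * P%:R)^-1 = 2^-1 :> R by field; rewrite gt_eqF.
have scale a b : a <= b -> 4 * P%:R * a <= 4 * P%:R * b :> R.
  by move=> ab; rewrite ler_pM2l // mulr_gt0.
have yes_le : ksum_yes k A -> 4 * P%:R * dist <= 2 * (P%:R - d%:R - 1).
  move=> /dist_yes /scale /le_trans; apply; rewrite WE.
  by rewrite le_eqVlt; apply/orP; left; apply/eqP; field; rewrite gt_eqF.
have no_ge : ~ ksum_yes k A -> 2 * (P%:R - d%:R) <= 4 * P%:R * dist.
  move=> /dist_no /scale; apply: le_trans; rewrite WE.
  by rewrite le_eqVlt; apply/orP; left; apply/eqP; field; rewrite gt_eqF.
have key : (0 < 2 * P%:R - 2 * d%:R - 1 - 4 * P%:R * o) <-> ksum_yes k A.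
  have := scale _ _ lo; have := scale _ _ hi; rewrite mulrDr mulrBr e0.
  move: (4 * P%:R * o) (4 * P%:R * dist) yes_le no_ge => v u yes_le no_ge h1 h2.
  split=> h; last by have := yes_le h; lra.
  by apply: contrapT => /no_ge; lra.
rewrite -key -(ltr0z R) /decision.
(* With a zero denominator the output is 0 and both conditions hold: [decision] is 1, and P >= d + 1
   makes the midpoint positive. *)
have [y0|y0] := eqVneq y 0.
  have o0 : o = 0 by rewrite /o y0 mulr0z invr0 mulr0.
  by rewrite y0 o0 !mulr0 divz0 subr0 add0r; split=> _ //; lra.
have yR : y%:~R != 0 :> R by rewrite intr_eq0.
rewrite divzz y0 subrr addr0.
have -> : (((W%:Z - (2 * d + 1)%N%:Z) * y - W%:Z * 2 * x) * y)%:~R =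
    y%:~R ^+ 2 * (2 * P%:R - 2 * d%:R - 1 - 4 * P%:R * o) :> R.
  rewrite /o !(intrM, intrB, rmorphM, rmorphB) /= -!pmulrn.
  rewrite WE (natrD _ (2 * d)%N) (natrM _ 2 d) -[(1 + 1)%:R]/(2%:R : R); field.
  exact: yR.
by rewrite pmulr_rgt0 // exprn_even_gt0.
Qed.

End Distance.

End Instance.

(** * The reduction solves k-SUM *)

Section Solves.
Local Open Scope nat_scope.
Variables (R : realType) (d' : nat) (p : program (access d'.+1)) (T : nat -> nat).
Local Notation d := d'.+1.
Local Notation k := d'.+2.

Definition box_exponent := 2 * k + 2.

Definition instr_consts (i : instr (access d)) : nat :=
  match i with
  | Flip r => bitlen r
  | Oracle (QueryAt r j) => bitlen (4 * tnth r ord_max + 1) + bitlen j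
  | _ => 0
  end.

Lemma instr_constsP B i : instr_consts i <= B -> instr_consts_le B i.
Proof. by case: i => //= -[//|r j] /=; lia. Qed.

Definition log_size n := up_log 2 (k * n).

Definition accuracy n := 8 * 2 ^ log_size n.

(** One word length for the whole run: it covers the constants of the generated code, those of [p],
    and all numbers up to the size of the promised box. *)
Definition word_bound n :=
  4 * d' + 100 + sumn [seq instr_consts i | i <- p] + box_exponent * bitlen (accuracy n).

(** The summands pay for set-up, simulation and answer. Registers start at 0, of bit length 1, so
    [1 + T] of the accuracy bounds their lengths at halting. *)
Definition reduction_time n :=
  prelude_factor d' * (word_bound n * 2 ^ log_size n) +
  (sim_factor d' * (word_bound n * word_bound n * T (accuracy n)) +
   end_factor d' * (word_bound n + (1 + T (accuracy n)))).

Lemma onth_sumn_le (X : Type) (g : X -> nat) (q : seq X) j i :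
  onth q j = Some i -> g i <= sumn [seq g x | x <- q].
Proof.
elim: q j => [|x q ih] [|j] //=; first by case=> ->; rewrite leq_addr.
by move=> /ih h; apply: leq_trans h (leq_addl _ _).
Qed.

Lemma reduction_solves :
  approximates_distance R (poly_box d box_exponent) p T ->
  solves_ksum R k (reduction p) reduction_time.
Proof.
move=> happ n A n0 inst c correct.
set s := log_size n; set B := word_bound n; set M := accuracy n.
have NP : k * n <= 2 ^ s by apply: up_logP.
have P0 : 0 < 2 ^ s by rewrite expn_gt0.
have dP : d' <= 2 ^ s by nia.
have e0 : 0 < box_exponent by [].
have small x : x <= M ^ box_exponent -> bitlen x <= B.
  move=> xM; apply: leq_trans (bitlen_homo xM) _.
  by apply: leq_trans (bitlen_exp _ e0) _; rewrite /B /word_bound leq_addl.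
have smallM x : x <= M -> bitlen x <= B.
  by move=> xM; apply: small; apply: leq_trans xM _; rewrite -{1}[M]expn1 leq_pexp2l // muln_gt0.
have B_large : 4 * d' + 100 <= B by rewrite /B /word_bound -!addnA; lia.
have B_s : bitlen (8 * 2 ^ s) <= B by exact: smallM.
have B_P : bitlen (2 * 2 ^ s) <= B by apply: smallM; rewrite leq_mul2r orbT.
have B_Q : bitlen (d * n ^ (2 * k) + 2 ^ s) <= B.
  by apply: small; exact: (Q_bound n0 NP).
have B_reg : bitlen (list_reg d' (2 ^ s)) <= B.
  have -> : list_reg d' (2 ^ s) = (4 * (d' + 2 ^ s)) + 66 by [].
  apply: leq_trans (bitlenD _ _) _; rewrite -[bitlen 66]/7.
  have h : bitlen (4 * (d' + 2 ^ s)) <= bitlen M by apply: bitlen_homo; rewrite /M /accuracy -/s; lia.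
  rewrite /B /word_bound -/M; have : bitlen M <= box_exponent * bitlen M by rewrite leq_pmull.
  lia.
have B_val j : j < 2 ^ s -> bitlen `|pad_val d' n (flatten A) j| <= B.
  move=> jP; apply: small; apply: leq_trans (Q_bound n0 NP).
  exact: (val_bound_pad n0 inst).
have B_L j : bitlen `|(nth 0 (flatten A) j)%R| <= B.
  have [jN|Nj] := ltnP j (k * n).
    have := B_val j (leq_trans jN NP).
    by rewrite /pad_val (_ : (k * n <= j) = false) ?addr0 // leqNgt jN.
  by rewrite nth_default ?(size_L inst) //; apply: small.
set val := pad_val d' n (flatten A) in B_val.
have B_point J l : J < 2 * 2 ^ s -> l <= d ->
    bitlen `|nth 0%R (labeled (@label d') (point d' n val J)) l| <= B.
  move=> JP ld; have [ltd|ged] := ltnP l d.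
    rewrite /labeled nth_rcons size_map size_enum_ord ltd (nth_map ord0) ?size_enum_ord //.
    by apply: small; apply: (point_bound n0 inst NP).
  rewrite nth_labeled // (_ : l == d) ?eqn_leq ?ld ?ged //.
  by apply: smallM; apply: (@leq_trans 1); [case: (odd J)|rewrite muln_gt0].
have B_consts j i : onth p j = Some i -> instr_consts_le B i.
  move=> hi; apply: instr_constsP; apply: leq_trans (onth_sumn_le instr_consts hi) _.
  by rewrite /B /word_bound; lia.
pose D := instance_distr d' n A R s.
have D_box x : (0 < D x)%R -> poly_box d box_exponent M x.
  move=> /push_support[j jW ->] l.
  exact: (point_bound n0 inst NP).
have M0 : 0 < M by rewrite muln_gt0.
have [happ1 happ2] := happ M D (@label d') M0 D_box.
set accurate := [set r | _] in happ2.
have code0 : code_at (reduction p) 0 (prelude d').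
  by exists [::], (translate_prog (label_of (size (prelude d')) p) (size (prelude d')) p ++
     postlude d' (label_of (size (prelude d')) p (size p))).
have pre := prelude_spec n0 (erefl s) (size_L inst) B_large B_s B_Q B_reg B_L B_val code0.
have D_avg := @instance_distr_avg d' n A R s.
have D_point j : j < 2 ^ s.+1 -> (0 < D (point d' n val j))%R.
  by rewrite expnS => jW; exact: instance_distr_gt0.
have end_mono : {homo (fun V => end_factor d' * (B + V)) : a b / a <= b}.
  by move=> a b ab; rewrite leq_mul2l leq_add2l ab orbT.
have endg c2 m2 inp2 par2 V : sim d' n s B val c2 m2 ->
    (forall r, bitlen `|regs c2 r| <= V) ->
    good (reduction p) correct (end_factor d' * (B + V)) (\1_accurate (regs c2) : R)%:E
      (Config (label_of (size (prelude d')) p (size p)) m2 inp2 par2).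
  have decides r : accurate r -> (0 < decision d' (2 * 2 ^ s)%N%:Z (r 0) (r 1))%R <-> ksum_yes k A.
    by move=> hr; apply: (decision_correct n0 inst NP); exact: hr.
  by move=> hs2 hV; exact: (end_good R p B_large B_P decides inp2 par2 hs2 hV).
have simu := simulate (mass_ge0 D) D_avg D_point B_large B_P B_point B_consts
  (reduction_code p) end_mono endg happ1.
have zero_regs r : bitlen `|regs (start [::] (binary M)) r| <= 1 by [].
have main j : good (reduction p) correct (reduction_time n)
    (prob_in_steps (access_oracle (@label d')) D p accurate j (start [::] (binary M))) c.
  (* The set-up tosses no coin, so the mean is over a single outcome. *)
  rewrite -/(avg 0 (fun=> prob_in_steps (access_oracle (@label d')) D p accurate j (start [::] (binary M)))).
  apply: (reach_good pre) => j1 c1 _ [m [inp [-> hs]]].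
  have h0 : label_of (size (prelude d')) p (pc (start [::] (binary M))) = size (prelude d').
    by rewrite /label_of take0 addn0.
  have := simu m inp [::] 1 j hs zero_regs; rewrite h0; exact.
split; first by have [] := main 0.
apply: le_trans happ2 _; apply: ge_ereal_sup => _ [j _ <-].
have [_ hj] := main j; apply: le_trans hj _.
by apply: ereal_sup_ubound; exists (reduction_time n).
Qed.

End Solves.

(** * Running time of the reduction *)

Lemma up_log_lt2 N : (1 < N)%N -> (2 ^ up_log 2 N < 2 * N)%N.
Proof.
move=> N1; have /andP[h _] := @up_log_bounds 2 N isT N1.
by rewrite -(prednK (_ : 0 < up_log 2 N)%N) ?up_log_gt0 // expnS ltn_pmul2l.
Qed.

(** The accuracy parameter 8P is linear in [n], so words have length O(log n). *)
Lemma reduction_time_le d' (p : program (access d'.+1)) T :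
  exists K, forall n, (0 < n)%N ->
    (reduction_time p T n <= K * bitlen n ^ 2 * (n + T (accuracy d' n)))%N.
Proof.
set C0 := (4 * d' + 100 + sumn [seq instr_consts i | i <- p])%N.
set C := (C0 + box_exponent d' * (bitlen (16 * d'.+2) + 1))%N.
exists (prelude_factor d' * C * (2 * d'.+2) + sim_factor d' * (C * C) + end_factor d' * (C + 1))%N.
move=> n n0; have P_le : (2 ^ log_size d' n <= 2 * d'.+2 * n)%N.
  by rewrite -mulnA; apply: ltnW; apply: up_log_lt2; nia.
have b0 : (0 < bitlen n)%N by [].
have B_le : (word_bound p n <= C * bitlen n)%N.
  have hM : (bitlen (accuracy d' n) <= bitlen (16 * d'.+2) + bitlen n)%N.
    by apply: leq_trans (bitlen_homo _) (bitlenM _ _); rewrite /accuracy; lia.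
  rewrite /word_bound -/C0 /C mulnDl leq_add ?leq_pmulr // -mulnA leq_mul2l.
  apply/orP; right; apply: leq_trans hM _; rewrite mulnDl mul1n leq_add2r.
  by rewrite leq_pmulr.
rewrite /reduction_time; move: (T _) (2 ^ _)%N (word_bound p n) (bitlen n) P_le B_le b0.
move: (prelude_factor _) (sim_factor _) (end_factor _) C => f1 f2 f3 C t P B b P_le B_le b0.
have h1 : (B * P <= C * (2 * d'.+2) * (b ^ 2 * n))%N.
  apply: leq_trans (leq_mul B_le P_le) _.
  have -> : (C * b * (2 * d'.+2 * n) = C * (2 * d'.+2) * (b * n))%N by ring.
  by rewrite leq_mul2l leq_mul2r -[X in (X <= _)%N]expn1 leq_pexp2l // !orbT.
have h2 : (B * B * t <= C * C * (b ^ 2 * t))%N.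
  by rewrite mulnA leq_mul // (leq_trans (leq_mul B_le B_le)) // mulnACA.
have h3 : (B + (1 + t) <= (C + 1) * (b ^ 2 * (n + t)))%N.
  have e1 : (b <= b ^ 2)%N by rewrite -[X in (X <= _)%N]expn1 leq_pexp2l.
  have e2 : (C * b <= C * (b ^ 2 * (n + t)))%N.
    by rewrite leq_mul2l; apply/orP; right; nia.
  have e3 : (1 + t <= b ^ 2 * (n + t))%N by nia.
  by rewrite mulnDl mul1n; apply: leq_add e3; apply: leq_trans B_le e2.
have g1 := leq_mul (leqnn f1) h1; have g2 := leq_mul (leqnn f2) h2; have g3 := leq_mul (leqnn f3) h3.
apply: leq_trans (leq_add g1 (leq_add g2 g3)) _.
move: (b ^ 2)%N => c.
have k1 : (c * n <= c * (n + t))%N by rewrite leq_mul2l leq_addr orbT.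
have k2 : (c * t <= c * (n + t))%N by rewrite leq_mul2l leq_addl orbT.
have r1 := leq_mul (leqnn (f1 * (C * (2 * d'.+2)))%N) k1.
have r2 := leq_mul (leqnn (f2 * (C * C))%N) k2.
have -> : ((f1 * C * (2 * d'.+2) + f2 * (C * C) + f3 * (C + 1)) * c * (n + t) =
    f1 * (C * (2 * d'.+2)) * (c * (n + t)) + (f2 * (C * C) * (c * (n + t)) +
    f3 * ((C + 1) * (c * (n + t)))))%N by ring.
rewrite leq_add //; first by apply: leq_trans r1; rewrite mulnA.
by rewrite leq_add //; apply: leq_trans r2; rewrite mulnA.
Qed.

Lemma bernoulli_le (R : realFieldType) (x : R) n : 0 <= 1 + x ->
  1 + n%:R * x <= (1 + x) ^+ n.
Proof.
move=> x1; elim: n => [|n ih]; first by rewrite mul0r addr0 expr0.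
rewrite exprS; apply: le_trans (ler_wpM2l x1 ih); rewrite -[n.+1%:R]natr1 -subr_ge0.
have -> : (1 + x) * (1 + n%:R * x) - (1 + (n%:R + 1) * x) = n%:R * x ^+ 2 by ring.
by rewrite mulr_ge0 // sqr_ge0.
Qed.

(** With b = 2^a and t the integer part of the binary logarithm of n, Bernoulli gives 1 + t(b - 1)
    <= b^t <= n^a. *)
Lemma bitlen_powR (R : realType) (a : R) : 0 < a ->
  exists2 C : R, 0 < C & forall n, (0 < n)%N -> (bitlen n)%:R <= C * n%:R `^ a.
Proof.
move=> a0; set b := 2 `^ a : R; have b1 : 1 < b.
  have := @gt0_ltr_powR R a a0 1 2; rewrite powR1; apply; rewrite ?nnegrE ?ler0n //.
  by rewrite ltr1n.
pose C := 1 + (b - 1)^-1.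
have C0 : 0 < C by rewrite addr_gt0 // invr_gt0 subr_gt0.
exists C => // n n0; set t := trunc_log 2 n.
have bn : b ^+ t <= n%:R `^ a.
  rewrite -powR_mulrn ?powR_ge0 // /b powRAC powR_mulrn //.
  apply: ge0_ler_powR; rewrite ?nnegrE ?exprn_ge0 // ?(ltW a0) //.
  by rewrite -natrX ler_nat; apply: trunc_logP.
apply: le_trans (_ : C * (1 + t%:R * (b - 1)) <= _).
  have d0 : 0 < b - 1 by rewrite subr_gt0.
  have -> : C * (1 + t%:R * (b - 1)) = t%:R + 1 + (t%:R * (b - 1) + (b - 1)^-1).
    by rewrite /C; field; rewrite gt_eqF.
  by rewrite /bitlen -/t -natr1 lerDl addr_ge0 // ?mulr_ge0 ?invr_ge0 // ltW.
rewrite ler_pM2l //; apply: le_trans bn.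
have := @bernoulli_le R (b - 1) t; rewrite [1 + (b - 1)]addrC subrK; apply.
by rewrite ltW // (lt_trans ltr01).
Qed.

(** Half of the gain [g] pays for two logarithmic factors, each O(n^(g/4)); the reading time [n] is
    absorbed because e - g >= 1. *)
Lemma bigO_reduction_time (R : realType) d' (p : program (access d'.+1)) T (e g : R) :
  0 < g -> g <= e - 1 -> bigO_pow T (e - g) ->
  bigO_pow (reduction_time p T) (e - g / 2).
Proof.
move=> g0 ge [C hC]; have [K hK] := reduction_time_le p T.
have [D D0 hD] := bitlen_powR (divr_gt0 g0 (ltr0n R 4)).
have C0 : 0 <= C by have := hC 1%N isT; rewrite powR1 mulr1; apply: le_trans.
set E := (16 * d'.+2)%:R `^ (e - g) : R.
exists (K%:R * D ^+ 2 * (1 + C * E)) => n n0.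
have nR : 0 < n%:R :> R by rewrite ltr0n.
have n1 : 1 <= n%:R :> R by rewrite ler1n.
have eg0 : 0 <= e - g by lra.
have T_le : (T (accuracy d' n))%:R <= C * E * n%:R `^ (e - g).
  apply: le_trans (hC _ _) _; first by rewrite muln_gt0 expn_gt0.
  rewrite -mulrA ler_wpM2l // /E -powRM // -natrM.
  apply: ge0_ler_powR; rewrite ?nnegrE // ler_nat /accuracy /log_size.
  have h : (2 ^ up_log 2 (d'.+2 * n) < 2 * (d'.+2 * n))%N by apply: up_log_lt2; nia.
  by move: (2 ^ _)%N h => x h; lia.
have n_le : n%:R <= n%:R `^ (e - g) :> R.
  by rewrite -{1}[n%:R]powRr1 // ler_powR //; lra.
have b_le : ((bitlen n)%:R ^+ 2 : R) <= D ^+ 2 * n%:R `^ (g / 2).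
  have -> : g / 2 = g / 4 + g / 4 :> R by field.
  rewrite powRD; last by rewrite (gt_eqF nR) implybT.
  rewrite -expr2 -exprMn; apply: lerXn2r; rewrite ?nnegrE ?ler0n ?mulr_ge0 ?powR_ge0 ?(ltW D0) //.
  exact: hD.
apply: (@le_trans _ _ ((K * bitlen n ^ 2 * (n + T (accuracy d' n)))%N%:R)).
  by rewrite ler_nat hK.
rewrite natrM (natrM _ K) natrX natrD.
have -> : e - g / 2 = g / 2 + (e - g) :> R by field.
rewrite powRD; last by rewrite (gt_eqF nR) implybT.
rewrite [leRHS](_ : _ = K%:R * ((D ^+ 2 * n%:R `^ (g / 2)) *
  ((1 + C * E) * n%:R `^ (e - g)))); last by ring.
rewrite -mulrA; apply: ler_wpM2l => //; apply: ler_pM => //.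
by rewrite mulrDl mul1r lerD.
Qed.

(** * Dimension one *)

Section ProbabilityBounds.
Variables (R : realType) (O : Type) (X : choiceType) (orc : oracle O X) (p : program O).
Implicit Type D : distr R X.

(** After [t] steps every run has halted, except on samples outside the support, which carry no
    mass. *)
Lemma prob_in_steps_le_halted (D : distr R X) E t c : halts_within orc D p t c ->
  forall n, (prob_in_steps orc D p E n c <= prob_in_steps orc D p E t c)%E.
Proof.
elim=> {t c} [t c st|t c w a st wt _ ih] n; first by rewrite !prob_in_steps_halted.
have w0 := step_cost_gt0 st.
have -> : t = (t - w + w.-1).+1 by lia.
have ih' c1 : successor D a c1 -> forall n1,
    (prob_in_steps orc D p E n1 c1 <= prob_in_steps orc D p E (t - w + w.-1) c1)%E.
  move=> su n1; apply: le_trans (ih c1 su n1) _.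
  by apply: prob_in_steps_homo; [exact: mass_ge0|rewrite leq_addr].
case: n => [|n].
  by apply: prob_in_steps_homo => //; exact: mass_ge0.
rewrite /= st; case: a {st} ih ih' => [c1|k|k] _ ih /=.
- exact: ih.
- apply: lee_wpmul2l; first by rewrite lee_fin invr_ge0.
  by apply: leeD; apply: ih; eexists.
- apply: le_esum => x _; have := mass_ge0 D x; rewrite le_eqVlt => /orP[/eqP <-|x0].
    by rewrite !mul0e.
  by apply: lee_wpmul2l; [rewrite lee_fin ltW|apply: ih; exists x].
Qed.

(** A change of the sampling distribution that keeps a fraction [r] of every
    mass keeps a fraction [r ^ n] of the probability of every run of length
    [n], as such a run draws at most [n] samples. *)
Lemma prob_in_steps_dominated W (pt : nat -> X) (q0 q1 : nat -> R) E (r : R) n c :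
  0 <= r <= 1 -> (forall j, 0 <= q0 j) -> (forall j, r * q0 j <= q1 j) ->
  ((r ^+ n)%:E * prob_in_steps orc (push_mass W q0 pt) p E n c <=
   prob_in_steps orc (push_mass W q1 pt) p E n c)%E.
Proof.
move=> /andP[r0 r1] q00 q01.
have q10 j : 0 <= q1 j by apply: le_trans (q01 j); rewrite mulr_ge0.
have p0 m c1 := prob_in_steps_ge0 orc p E (push_mass_ge0 W pt q00) m c1.
have p1 m c1 := prob_in_steps_ge0 orc p E (push_mass_ge0 W pt q10) m c1.
have rn1 m : r ^+ m.+1 <= r ^+ m by rewrite exprS ler_piMl // exprn_ge0.
elim: n c => [|n ih] c.
  by rewrite expr0 mul1e /=; case: step => [[w []]|].
rewrite /=; case: step => [[w [c1|k|k]]|].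
- by apply: le_trans (ih c1); apply: lee_wpmul2r; rewrite ?lee_fin.
- rewrite muleCA; apply: lee_wpmul2l; first by rewrite lee_fin invr_ge0.
  apply: le_trans (leeD (ih _) (ih _)); rewrite -ge0_muleDr //.
  by apply: lee_wpmul2r; rewrite ?lee_fin ?adde_ge0.
- rewrite !esum_push // ge0_sume_distrr; last first.
    by move=> j _; apply: mule_ge0; rewrite ?lee_fin.
  apply: lee_sum => j _; rewrite exprS EFinM muleACA -EFinM.
  apply: le_trans (_ : (r * q0 j)%:E * prob_in_steps orc (push_mass W q1 pt) p E n (k (pt j)) <= _)%E.
    by apply: lee_wpmul2l; rewrite ?lee_fin ?mulr_ge0.
  by apply: lee_wpmul2r; rewrite ?lee_fin.
- by rewrite lee_fin ler_piMl ?exprn_ile1 // indicE.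
Qed.

Lemma prob_in_steps_disjoint (D : distr R X) (E1 E2 : set (nat -> int)) n c :
  (forall m, E1 m -> ~ E2 m) ->
  (prob_in_steps orc D p E1 n c + prob_in_steps orc D p E2 n c <= 1)%E.
Proof.
move=> dis; have halted c1 : ((\1_E1 (regs c1) : R)%:E + (\1_E2 (regs c1) : R)%:E <= 1)%E.
  rewrite -EFinD lee_fin !indicE -natrD lern1.
  case: (boolP (_ \in E1)) => [/set_mem h|_]; last by case: (_ \in _).
  by rewrite memNset //; exact: dis.
have p0 E m c1 := prob_in_steps_ge0 orc p E (mass_ge0 D) m c1.
elim: n c => [|n ih] c.
  by rewrite /=; case: step => [[w [c1|k|k]]|]; rewrite ?adde0 ?lee01 //.
rewrite /=; case: step => [[w [c1|k|k]]|] //.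
- rewrite -ge0_muleDr ?adde_ge0 // addeACA.
  apply: le_trans (_ : (2^-1)%:E * (1 + 1) <= _)%E.
    by apply: lee_wpmul2l; rewrite ?lee_fin ?invr_ge0 // leeD.
  by rewrite -EFinD -EFinM lee_fin mulVf.
- rewrite -esumD; try by move=> x _; apply: mule_ge0; rewrite ?lee_fin ?mass_ge0.
  rewrite -(mass_total D); apply: le_esum => x _; rewrite -ge0_muleDr //.
  by rewrite -[leRHS]mule1; apply: lee_wpmul2l; rewrite ?lee_fin ?mass_ge0.
Qed.

End ProbabilityBounds.

Section SamplingLowerBound.
Variables (R : realType) (d' : nat).
Local Notation d := d'.+1.

Definition line_point (a : nat) : 'rV[int]_d := const_mx a%:Z.

Definition middle_label (x : 'rV[int]_d) : bool := x 0 0 != 1.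

(** The three points 0, 1, 2 of a line are labelled true, false, true, so that
    the distance is the mass [t] of the middle one. *)
Definition middle_weight (t : R) (a : nat) : R := if a == 1%N then t else (1 - t) / 2.

Lemma middle_weight_ge0 t : 0 <= t <= 1 -> forall a, 0 <= middle_weight t a.
Proof.
move=> /andP[t0 t1] a; rewrite /middle_weight; case: ifP => // _.
by rewrite divr_ge0 // subr_ge0.
Qed.

Lemma middle_weight_total t : \sum_(a < 3) middle_weight t a = 1.
Proof. by rewrite !big_ord_recr big_ord0 /middle_weight /=; field. Qed.

Lemma disagreement_middle t (t01 : 0 <= t <= 1) (h : 'rV[int]_d -> bool) :
  disagreement (push line_point (middle_weight_ge0 t01) (middle_weight_total t)) middle_label h =
  (~~ h (line_point 0))%:R * ((1 - t) / 2) + (h (line_point 1))%:R * t +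
  (~~ h (line_point 2))%:R * ((1 - t) / 2).
Proof.
rewrite disagreement_push big_mkcond !big_ord_recr big_ord0 /= add0r.
rewrite /middle_label /middle_weight !mxE /=.
by case: (h _); case: (h _); case: (h _); rewrite ?mul1r ?mul0r.
Qed.

(** A halfspace containing both outer points contains the middle one and errs with mass t; any other
    misses an outer point, of mass (1 - t)/2 >= t. *)
Lemma dist_middle t (t01 : 0 <= t <= 1)
    (D := push line_point (middle_weight_ge0 t01) (middle_weight_total t)) :
  t <= 1 / 3 -> dist_class D middle_label (@halfspaces R d) = t.
Proof.
move=> t3; have Htrue : @halfspaces R d (halfspace (0 : 'rV[R]_d) 0) by exists 0, 0.
have /andP[t0 t1] := t01.
apply/eqP; rewrite eq_le; apply/andP; split.
  apply: (dist_class_le Htrue); rewrite disagreement_middle.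
  have hT x : halfspace (0 : 'rV[R]_d) 0 x.
    by rewrite /halfspace addr0 big1 // => i _; rewrite mxE mul0r.
  by rewrite !hT /= !mul0r mul1r add0r addr0.
apply: (dist_class_ge Htrue) => _ [w [theta ->]]; rewrite disagreement_middle.
have hE a : halfspace w theta (line_point a) = (0 <= (\sum_(i < d) w 0 i) * a%:R + theta).
  rewrite /halfspace mulr_suml; congr (0 <= _ + _); apply: eq_bigr => i _.
  by rewrite mxE.
rewrite !hE mulr0 mulr1 add0r; move: (\sum_(i < d) _) => S.
case: (leP 0 theta) => h0; case: (leP 0 (S * 2 + theta)) => h2; rewrite /=.
- have -> : 0 <= S + theta by lra.
  by rewrite !mul0r mul1r add0r addr0.
- by case: (0 <= _) => /=; lra.
- by case: (0 <= _) => /=; lra.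
- by case: (0 <= _) => /=; lra.
Qed.

(** Middle masses 0 and t = 3/m require disjoint sets of answers. The run keeps a fraction (1 - t)^T
    >= 3/4 of its probability when the mass is moved, so the answers for 0 keep probability 1/2, and
    1/2 + 2/3 > 1. *)
Lemma sampling_lower_bound c (e : R) : (0 < c)%N -> e < 1 ->
  ~ approximable (poly_box d c) e.
Proof.
move=> c0 e1 [p [T [[C hC] happ]]].
have C0 : 0 <= C by have := hC 1%N isT; rewrite powR1 mulr1; apply: le_trans.
have a0 : 0 < 1 - e by rewrite subr_gt0.
(* Since b^(1-e) = 12C, having m >= b yields 12 T(m) <= m; the summand 12 in [m] ensures t <=
   1/4. *)
pose b := (12 * C) `^ (1 - e)^-1; pose m := (12 + Num.bound b)%N.
have m0 : (0 < m)%N by [].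
have mR : 0 < m%:R :> R by rewrite ltr0n.
have Tm : 12 * (T m)%:R <= m%:R :> R.
  apply: le_trans (_ : 12 * (C * m%:R `^ e) <= _); first by rewrite ler_pM2l // hC.
  rewrite mulrA; apply: le_trans (_ : m%:R `^ (1 - e) * m%:R `^ e <= _).
    apply: ler_wpM2r; first exact: powR_ge0.
    have -> : 12 * C = b `^ (1 - e) by rewrite /b -powRrM mulVf ?powRr1 ?gt_eqF // mulr_ge0.
    apply: ge0_ler_powR; rewrite ?nnegrE ?powR_ge0 ?(ltW a0) //.
    have := archi_boundP (powR_ge0 (12 * C) (1 - e)^-1); rewrite -/b /m natrD.
    by move=> /ltW h; apply: le_trans h _; rewrite lerDr.
  by rewrite -powRD ?(gt_eqF mR) ?implybT // subrK powRr1.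
pose t : R := 3 / m%:R.
have tm : t * m%:R = 3 by rewrite /t mulfVK // gt_eqF.
have m12 : 12 <= m%:R :> R by rewrite ler_nat /m leq_addr.
have t0 : 0 <= t by rewrite divr_ge0.
have t4 : t <= 1 / 4 by rewrite ler_pdivrMr //; lra.
have t01 : 0 <= t <= 1 by rewrite t0; lra.
have z01 : 0 <= (0 : R) <= 1 by rewrite lexx ler01.
pose D u (u01 : 0 <= u <= 1) : distr R 'rV[int]_d :=
  push line_point (middle_weight_ge0 u01) (middle_weight_total u).
have box u (u01 : 0 <= u <= 1) x : 0 < D u u01 x -> poly_box d c m x.
  move=> /push_support[j j3 ->] i; rewrite mxE absz_nat.
  apply: (@leq_trans 12); first by apply: leq_trans (ltnW j3) _.
  apply: (@leq_trans m); first exact: leq_addr.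
  by rewrite -[X in (X <= _)%N]expn1 leq_pexp2l.
have [h0 s0] := happ m (D 0 z01) (@middle_label) m0 (box 0 z01).
have [h1 s1] := happ m (D t t01) (@middle_label) m0 (box t t01).
rewrite dist_middle in s0; last by lra.
rewrite dist_middle in s1; last by lra.
set E0 := [set r | _] in s0; set E1 := [set r | _] in s1.
set st := start [::] (binary m) in h0 h1 s0 s1.
have disj r : E0 r -> ~ E1 r.
  rewrite /E0 /E1 /= ler_distl => /andP[l0 _]; rewrite ler_distl => /andP[_ l1].
  have mV : m%:R^-1 = t / 3 :> R by rewrite /t; field; rewrite gt_eqF.
  have tp : 0 < t by rewrite divr_gt0.
  by move: l0 l1; rewrite mV; move: (output R r) => o; lra.
set D0 := D 0 z01 in h0 s0; set D1 := D t t01 in h1 s1.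
have {}s0 : ((2 / 3)%:E <= prob_in_steps (access_oracle (@middle_label)) D0 p E0 (T m) st)%E.
  apply: le_trans s0 _; apply: ge_ereal_sup => _ [n _ <-].
  exact: prob_in_steps_le_halted.
have {}s1 : ((2 / 3)%:E <= prob_in_steps (access_oracle (@middle_label)) D1 p E1 (T m) st)%E.
  apply: le_trans s1 _; apply: ge_ereal_sup => _ [n _ <-].
  exact: prob_in_steps_le_halted.
have r01 : 0 <= 1 - t <= 1 by lra.
have weights j : (1 - t) * middle_weight 0 j <= middle_weight t j.
  by rewrite /middle_weight; case: ifP => _; lra.
have dom := prob_in_steps_dominated (access_oracle (@middle_label)) p 3 line_point E0 (T m) st r01
  (middle_weight_ge0 z01) weights.
have half : ((1 / 2)%:E <= prob_in_steps (access_oracle (@middle_label)) D1 p E0 (T m) st)%E.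
  apply: le_trans dom; apply: le_trans (_ : ((3 / 4)%:E * (2 / 3)%:E <= _)%E).
    by rewrite -EFinM lee_fin; lra.
  apply: lee_pmul => //; rewrite ?lee_fin ?divr_ge0 //.
  have := @bernoulli_le R (- t) (T m); rewrite mulrN => /(_ _)/wrap[|]; first by lra.
  apply: le_trans; have : (T m)%:R * t <= 1 / 4; last by lra.
  by rewrite -(ler_pM2r mR) -mulrA tm; lra.
have := prob_in_steps_disjoint (access_oracle (@middle_label)) p D1 (T m) st disj.
move=> /(le_trans (leeD half s1)).
by rewrite -EFinD lee_fin; lra.
Qed.

End SamplingLowerBound.

(** * Monotonicity in exponent and promise, and the conclusion *)

Lemma bigO_pow_mono (R : realType) T (e e' : R) : e <= e' -> bigO_pow T e -> bigO_pow T e'.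
Proof.
move=> ee' [C hC].
have C0 : 0 <= C by have := hC 1%N isT; rewrite powR1 mulr1; apply: le_trans.
exists C => n n0; apply: le_trans (hC n n0) _.
by rewrite ler_wpM2l // ler_powR // ler1n.
Qed.

Lemma approximable_mono (R : realType) d (S S' : nat -> set 'rV[int]_d) (e e' : R) :
  (forall m, S m `<=` S' m) -> e <= e' -> approximable S' e -> approximable S e'.
Proof.
move=> SS' ee' [p [T [hT hp]]]; exists p, T; split; first exact: bigO_pow_mono hT.
by move=> m D f m0 hS; apply: hp => // x /hS; exact: SS'.
Qed.

Theorem theorem4p3 (R : realType) :
  ksum_conjecture R ->
  forall d : nat, (0 < d)%N ->
    (forall g : R, 0 < g ->
       ~ approximable (fun=> [set: 'rV[int]_d]) ((uphalf d.+1)%:R - g)) /\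
    (exists c : nat, forall g : R, 0 < g ->
       ~ approximable (poly_box d c) ((uphalf d.+1)%:R - g)).
Proof.
move=> ksum [//|d'] _.
have hard g : 0 < g ->
    ~ approximable (poly_box d'.+1 (box_exponent d')) ((uphalf d'.+2)%:R - g :> R).
  case: d' => [|d'] g0; first by apply: sampling_lower_bound => //; rewrite gtrBl.
  (* Now the dimension is at least 2 and e >= 2, so capping the gain at 1 gives e - g1 >= 1; the cap
     only weakens the time bound to be refuted. *)
  set e := (uphalf d'.+3)%:R; pose g1 := Num.min g 1.
  have g1_gt0 : 0 < g1 by rewrite lt_min g0 ltr01.
  have g1e : g1 <= e - 1.
    rewrite ge_min; apply/orP; right.
    by rewrite lerBrDr -(natrD _ 1 1) ler_nat.
  have ge1 : e - g <= e - g1 by rewrite lerD2l lerN2 ge_min lexx.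
  move/(approximable_mono (fun _ => @subset_refl _ _) ge1) => [p [T [hT hp]]].
  apply: (ksum d'.+3 (g1 / 2)) => //; first by rewrite divr_gt0.
  exists (reduction p), (reduction_time p T); split.
    exact: bigO_reduction_time.
  exact: reduction_solves.
(* An algorithm for all distributions also works under the promise. *)
split=> [g g0 happ|]; last by exists (box_exponent d').
by apply: (hard g g0); apply: approximable_mono happ.
Qed.
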